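(* Let $G$ be a Lie group acting on $T^*T^*G\simeq(G\circledS\mathfrak g_1^* )\circledS(\mathfrak g_2^*\times\mathfrak g_3)$ by $((h,\mu,\nu,\xi);g)\mapsto(hg,\mu,\nu,\xi)$. Poisson reduction of $T^*T^*G$ under the action of $G$ results in $\mathfrak g_1^*\circledS(\mathfrak g_2^*\times\mathfrak g_3)$ endowed with the Poisson bracket $$\{H,K\}(\mu,\nu,\xi)=\Big\langle\frac{\delta H}{\delta\mu},\frac{\delta K}{\delta\xi}\Big\rangle-\Big\langle\frac{\delta K}{\delta\mu},\frac{\delta H}{\delta\xi}\Big\rangle+\Big\langle\nu,\Big[\frac{\delta H}{\delta\nu},\frac{\delta K}{\delta\nu}\Big]\Big\rangle+\Big\langle\xi,\mathrm{ad}^*_{\frac{\delta H}{\delta\nu}}\frac{\delta K}{\delta\xi}-\mathrm{ad}^*_{\frac{\delta K}{\delta\nu}}\frac{\delta H}{\delta\xi}\Big\rangle+\Big\langle\mu,\Big[\frac{\delta H}{\delta\mu},\frac{\delta K}{\delta\nu}\Big]-\Big[\frac{\delta K}{\delta\mu},\frac{\delta H}{\delta\nu}\Big]\Big\rangle,$$ and (Marsden-Weinstein) symplectic reduction at $\mu\in\mathfrak g^*$ gives $\mathcal O_\mu\times\mathfrak g^*\times\mathfrak g$, where $\mathcal O_\mu$ is the coadjoint orbit through $\mu$, with the symplectic two-form defined by $$\Omega^{/G}_{T^*T^*G}\big((\eta_{\mathfrak g^*}(\mu),\lambda,\zeta),(\bar\eta_{\mathfrak g^*}(\mu),\bar\lambda,\bar\zeta)\big)=\langle\zeta,\bar\lambda\rangle-\langle\bar\zeta,\lambda\rangle-\langle\mu,[\eta,\bar\eta]\rangle$$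 on two elements $(\eta_{\mathfrak g^*}(\mu),\lambda,\zeta)$ and $(\bar\eta_{\mathfrak g^*}(\mu),\bar\lambda,\bar\zeta)$ of $T_\mu\mathcal O_\mu\times\mathfrak g^*\times\mathfrak g$.
   Context: $G$ is a (finite-dimensional) Lie group with identity $e$, $\mathfrak g=T_eG$; $\mathfrak g_i,\mathfrak g_i^*$ are copies of $\mathfrak g,\mathfrak g^*$. $R_g$ is right multiplication, $T_e^*R_g:T_g^*G\to\mathfrak g^*$ the dual of $T_eR_g$. $\mathrm{Ad}_g=T_e(h\mapsto ghg^{-1})$, $\mathrm{ad}_\xi\eta=[\xi,\eta]=\frac{d}{dt}|_{t=0}\mathrm{Ad}_{\exp t\xi}\eta$, $\langle\mathrm{Ad}^*_g\mu,\xi\rangle=\langle\mu,\mathrm{Ad}_{g^{-1}}\xi\rangle$, $\langle\mathrm{ad}^*_\xi\mu,\eta\rangle=-\langle\mu,[\xi,\eta]\rangle$, $\mathcal O_\mu=\{\mathrm{Ad}^*_g\mu:g\in G\}$, and $\eta_{\mathfrak g^*}(\mu)=\mathrm{ad}^*_\eta\mu$ for $\eta\in\mathfrak g$; $\lambda,\bar\lambda\in\mathfrak g^*$, $\zeta,\bar\zeta\in\mathfrak g$. The formula for the two-form is understood at every point of the orbit. $T^*G$ is identified with $G\circledS\mathfrak g^*$ by $\alpha_g\mapsto(g,T_e^*R_g\alpha_g)$, with group law $(g,\mu)(h,\nu)=(gh,\mu+\mathrm{Ad}^*_g\nu)$. $T^*T^*G=T^*(G\circledS\mathfrak g^* )$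 is identified with $G\times\mathfrak g_1^*\times\mathfrak g_2^*\times\mathfrak g_3$ by sending a covector $(\alpha_g,\alpha_\mu)\in T^*_gG\times\mathfrak g$ at $(g,\mu)$ to $(g,\mu,\nu,\xi)=(g,\mu,T_e^*R_g\alpha_g-\mathrm{ad}^*_{\alpha_\mu}\mu,\alpha_\mu)$; the symplectic form is $\Omega_{T^*T^*G}=d\theta$ ($\theta$ the Liouville form) transported by this map. Hamiltonian vector fields satisfy $i_{X_H}\Omega=-dH$, and $\{H,K\}=dH(X_K)$; the Poisson reduced bracket is its restriction to functions independent of $g$. The action is the cotangent lift of the action of $G\subset G\circledS\mathfrak g^*$ by right translation, with momentum map $\langle\mathbf J,\eta\rangle=\theta(X_\eta)$, $X_\eta$ the infinitesimal generator of $\eta\in\mathfrak g$. The reduction is meant up to symplectic diffeomorphism. *)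

(* Defs.v *)
From HB Require Import structures.
From mathcomp Require Import all_boot all_order all_algebra.
From mathcomp Require Import all_classical all_reals all_analysis.

Set Implicit Arguments.
Unset Strict Implicit.
Unset Printing Implicit Defensive.

Import Order.TTheory GRing.Theory Num.Theory.
Import numFieldNormedType.Exports.

Local Open Scope classical_set_scope.
Local Open Scope ring_scope.

Section Manifolds.
Context {R : realType}.

(* C^k and C^oo maps on an open subset U of a normed space. In finite
   dimension (the only case used) this recursion is the usual notion. *)
Fixpoint Ck (k : nat) (E F : normedModType R) (U : set E) (f : E -> F) : Prop :=
  match k with
  | 0 => forall x, U x -> {for x, continuous f}
  | k'.+1 => (forall x, U x -> differentiable f x) /\
             forall v, Ck k' U (fun x => 'D_v f x)
  end.

Definition smooth_on (E F : normedModType R) (U : set E) (f : E -> F) : Prop :=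
  forall k, Ck k U f.

(* cinv is meaningful only on the image of cdom under cmap *)
Record chart (M : Type) (E : normedModType R) := Chart {
  cdom : set M;
  cmap : M -> E;
  cinv : E -> M }.

(* Atlases are indexed by the points, the chart A x being defined around x.
   The topology of M is the one induced by the atlas (mopen). The tangent space
   at x is the model space E, a vector being given by its components in the
   chart A x. *)
Definition atlas (M : Type) (E : normedModType R) := M -> chart M E.

Definition mopen (M : Type) (E : normedModType R) (A : atlas M E) (U : set M) :=
  forall x, open (cmap (A x) @` (U `&` cdom (A x))).

Definition is_manifold (M : Type) (E : normedModType R) (A : atlas M E) : Prop :=
  [/\ forall x, cdom (A x) x,
      forall x y, cdom (A x) y -> cinv (A x) (cmap (A x) y) = y,
      forall x y, let D := cmap (A x) @` (cdom (A x) `&` cdom (A y)) in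
        open D /\ smooth_on D (cmap (A y) \o cinv (A x)),
      forall x y, x <> y -> exists U V : set M,
        [/\ mopen A U, mopen A V, U x, V y & U `&` V = set0] &
      exists B : nat -> set M, (forall i, mopen A (B i)) /\
        forall U x, mopen A U -> U x -> exists i, B i x /\ B i `<=` U].

Definition vec_atlas (E : normedModType R) : atlas E E :=
  fun=> Chart setT id id.
Arguments vec_atlas : clear implicits.

Definition prod_atlas (M N : Type) (E F : normedModType R)
    (A : atlas M E) (B : atlas N F) : atlas (M * N) (E * F)%type :=
  fun p => Chart (cdom (A p.1) `*` cdom (B p.2))
    (fun q => (cmap (A p.1) q.1, cmap (B p.2) q.2))
    (fun e => (cinv (A p.1) e.1, cinv (B p.2) e.2)).

Section Maps.
Context {M N : Type} {E F : normedModType R} (A : atlas M E) (B : atlas N F).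

Definition local_rep (f : M -> N) (x : M) : E -> F :=
  cmap (B (f x)) \o f \o cinv (A x).

Definition smooth (f : M -> N) : Prop :=
  forall x, exists W : set E,
    [/\ open W, W (cmap (A x) x), W `<=` cmap (A x) @` cdom (A x),
        forall e, W e -> cdom (B (f x)) (f (cinv (A x) e)) &
        smooth_on W (local_rep f x)].

(* the tangent map T_x f *)
Definition tmap (f : M -> N) (x : M) : E -> F :=
  'd (local_rep f x) (cmap (A x) x).

Definition submersion (f : M -> N) : Prop :=
  smooth f /\ forall x w, exists v, tmap f x v = w.

Definition immersion (f : M -> N) : Prop :=
  smooth f /\ forall x, injective (tmap f x).

Definition embedding (f : M -> N) : Prop :=
  [/\ immersion f, injective f &
      forall U, mopen A U <-> exists2 V, mopen B V & U = f @^-1` V].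

End Maps.

Definition diffeomorphism (M N : Type) (E F : normedModType R)
    (A : atlas M E) (B : atlas N F) (f : M -> N) (g : N -> M) : Prop :=
  [/\ smooth A B f, smooth B A g, cancel f g & cancel g f].

Section Forms.
Context {M : Type} {E : normedModType R} (A : atlas M E).

Definition form1 := M -> E -> R.
Definition form2 := M -> E -> E -> R.

(* df, for a real-valued function f *)
Definition dfun (f : M -> R) : form1 := tmap A (vec_atlas R^o) f.

(* T_e (A x)^-1, the result being in components for the chart at (A x)^-1 e *)
Definition tinv (x : M) (e : E) : E -> E :=
  'd (cmap (A (cinv (A x) e)) \o cinv (A x)) e.

Definition rep1 (th : form1) (x : M) (v : E) (e : E) : R :=
  th (cinv (A x) e) (tinv x e v).

Definition rep2 (om : form2) (x : M) (u v : E) (e : E) : R :=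
  om (cinv (A x) e) (tinv x e u) (tinv x e v).

(* d th (X, Y) = X(th Y) - Y(th X) - th [X, Y], written on the constant fields
   of the chart at x *)
Definition extd (th : form1) : form2 := fun x u v =>
  'D_u (rep1 th x v) (cmap (A x) x) - 'D_v (rep1 th x u) (cmap (A x) x).

Definition closed2 (om : form2) : Prop := forall x u v w,
  'D_u (rep2 om x v w) (cmap (A x) x) + 'D_v (rep2 om x w u) (cmap (A x) x)
  + 'D_w (rep2 om x u v) (cmap (A x) x) = 0.

Definition smooth2 (om : form2) : Prop := forall x, exists W : set E,
  [/\ open W, W (cmap (A x) x), W `<=` cmap (A x) @` cdom (A x) &
      forall u v, smooth_on W (rep2 om x u v)].

Definition alternating (om : form2) : Prop := forall x,
  (forall a u u' v, om x (a *: u + u') v = a * om x u v + om x u' v) /\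
  (forall u v, om x u v = - om x v u).

Definition nondegenerate (om : form2) : Prop := forall x u,
  (forall v, om x u v = 0) -> u = 0.

Definition symplectic (om : form2) : Prop :=
  [/\ is_manifold A, smooth2 om, alternating om, nondegenerate om & closed2 om].

(* X is the value at x of the Hamiltonian vector field X_H: i_X om = - dH *)
Definition ham_vec (om : form2) (H : M -> R) (x : M) (X : E) : Prop :=
  forall v, om x X v = - dfun H x v.

(* {H, K}(x) = r, where {H, K} = dH(X_K) *)
Definition pbracket_at (om : form2) (H K : M -> R) (x : M) (r : R) : Prop :=
  exists X, unique (ham_vec om K x) X /\ dfun H x X = r.

Definition smooth_fun (f : M -> R) : Prop := smooth A (vec_atlas R^o) f.

Definition poisson_manifold (br : (M -> R) -> (M -> R) -> M -> R) : Prop :=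
  is_manifold A /\
  forall f g h, smooth_fun f -> smooth_fun g -> smooth_fun h ->
  [/\ smooth_fun (br f g),
      forall x, br f g x = - br g f x,
      forall (a : R) x, br (fun y => a * f y + g y) h x = a * br f h x + br g h x,
      forall x, br (fun y => f y * g y) h x = f x * br g h x + g x * br f h x &
      forall x, br (br f g) h x + br (br g h) f x + br (br h f) g x = 0].

End Forms.

Section Pullback.
Context {M N : Type} {E F : normedModType R} (A : atlas M E) (B : atlas N F).

Definition pullback1 (f : M -> N) (th : N -> F -> R) : M -> E -> R :=
  fun x v => th (f x) (tmap A B f x v).

Definition pullback2 (f : M -> N) (om : N -> F -> F -> R) : M -> E -> E -> R :=
  fun x u v => om (f x) (tmap A B f x u) (tmap A B f x v).

End Pullback.

Section Reduction.
Context {P : Type} {E : normedModType R} (A : atlas P E) (om : P -> E -> E -> R)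
  {G : groupType} (act : P -> G -> P).

(* (Q, br) is the Poisson reduction of (P, om) by G, pr being the projection to
   the orbit space; the manifold structure of P / G is the one making pr a
   submersion *)
Definition poisson_reduction (Q : Type) (F : normedModType R) (B : atlas Q F)
    (pr : P -> Q) (br : (Q -> R) -> (Q -> R) -> Q -> R) : Prop :=
  [/\ submersion A B pr,
      forall q, exists p, pr p = q,
      forall p p', pr p = pr p' <-> exists g, p' = act p g,
      poisson_manifold B br &
      forall h k, smooth_fun B h -> smooth_fun B k -> forall p,
        pbracket_at A om (h \o pr) (k \o pr) p (br h k (pr p))].

(* (Q, w) is a model of the Marsden-Weinstein quotient J^-1(mu) / G_mu, where
   J^-1(mu) carries the embedded submanifold structure C and S = G_mu *)
Definition mw_reduction (V : Type) (J : P -> V) (mu : V) (S : set G)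
    (H : normedModType R) (C : atlas {p : P | J p = mu} H)
    (Q : Type) (F : normedModType R) (B : atlas Q F)
    (w : Q -> F -> F -> R) : Prop :=
  [/\ is_manifold C,
      embedding C A (fun z => sval z),
      symplectic B w &
      exists pr : {p : P | J p = mu} -> Q,
      [/\ submersion C B pr,
          forall q, exists z, pr z = q,
          forall z z', pr z = pr z' <-> exists2 g, S g & sval z' = act (sval z) g &
          pullback2 C B pr w = pullback2 C A (fun z => sval z) om]].

End Reduction.

(* Covectors on 'rV_n are columns, so that 'cV_n is the dual of 'rV_n (and
   'rV_n the dual of 'cV_n). *)
Section Duality.
Context {n : nat}.

Definition pairing (m : 'cV[R]_n) (x : 'rV[R]_n) : R := (x *m m) 0 0.

(* the covector, resp. vector, representing a linear form *)
Definition covec (f : 'rV[R]_n -> R) : 'cV[R]_n := \col_i f (delta_mx 0 i).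
Definition dvec (f : 'cV[R]_n -> R) : 'rV[R]_n := \row_i f (delta_mx i 0).

(* the cotangent bundle of M, a point being a pair (x, covector at x) *)
Definition cot_atlas (M : Type) (A : atlas M 'rV[R]_n) :
    atlas (M * 'cV[R]_n) ('rV[R]_n * 'cV[R]_n)%type :=
  fun p => Chart [set q | cdom (A p.1) q.1]
    (fun q => let e := cmap (A p.1) q.1 in
      (e, covec (fun v => pairing q.2 ('d (cmap (A q.1) \o cinv (A p.1)) e v))))
    (fun e => let x := cinv (A p.1) e.1 in
      (x, covec (fun v => pairing e.2 ('d (cmap (A p.1) \o cinv (A x)) (cmap (A x) x) v)))).

End Duality.

Section LieGroup.
Context {n : nat} {G : groupType} (A : atlas G 'rV[R]_n).

Local Notation g := ('rV[R]_n).
Local Notation gd := ('cV[R]_n).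
Local Notation VV := ('cV[R]_n * 'cV[R]_n * 'rV[R]_n)%type.

Definition lie_group : Prop :=
  [/\ is_manifold A,
      smooth (prod_atlas A A) A (fun p => (p.1 * p.2)%g) &
      smooth A A (fun x => x^-1%g)].

Definition Ad (x : G) : g -> g := tmap A A (fun h => (x * h * x^-1)%g) 1%g.

(* [xi, eta] = ad_xi eta: the derivative of x |-> Ad_x eta at e along xi *)
Definition ad (xi eta : g) : g := tmap A (vec_atlas g) (fun x => Ad x eta) 1%g xi.

Definition Adstar (x : G) (m : gd) : gd := covec (fun xi => pairing m (Ad x^-1%g xi)).

Definition adstar (xi : g) (m : gd) : gd := covec (fun eta => - pairing m (ad xi eta)).

Definition sdmul (a b : G * gd) : G * gd := ((a.1 * b.1)%g, a.2 + Adstar a.1 b.2).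

Definition sd_atlas : atlas (G * gd) (g * gd)%type := prod_atlas A (vec_atlas gd).

(* T^*(G (S) g^* ) = T^*G x (g^* x g): ((x, alpha_x), (mu, alpha_mu)) *)
Definition TsS : Type := ((G * gd) * (gd * g))%type.

Definition TsS_atlas : atlas TsS ((g * gd) * (gd * g))%type :=
  prod_atlas (cot_atlas A) (vec_atlas (gd * g)%type).

Definition TsS_base (z : TsS) : G * gd := (z.1.1, z.2.1).

Definition TsS_pair (z : TsS) (v : g * gd) : R := pairing z.1.2 v.1 + pairing v.2 z.2.2.

Definition liouville : TsS -> (g * gd) * (gd * g) -> R := fun z w =>
  TsS_pair z (tmap TsS_atlas sd_atlas TsS_base z w).

(* z' is the image of z under the cotangent lift of a map r of G (S) g^* *)
Definition is_cot_lift (r : G * gd -> G * gd) (z z' : TsS) : Prop :=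
  TsS_base z' = r (TsS_base z) /\
  forall v, TsS_pair z' (tmap sd_atlas sd_atlas r (TsS_base z) v) = TsS_pair z v.

(* G x g_1^* x g_2^* x g_3, the trivialised T^*T^*G *)
Definition PP : Type := (G * VV)%type.
Definition PP_atlas : atlas PP (g * VV)%type := prod_atlas A (vec_atlas VV).

Definition triv (z : TsS) : PP :=
  let: ((x, al), (mu, xi)) := z in
  (x, (mu, covec (fun v => pairing al (tmap A A (fun h => (h * x)%g) 1%g v)) - adstar xi mu, xi)).

(* the inverse of triv *)
Definition untriv (p : PP) : TsS :=
  let: (x, (mu, nu, xi)) := p in
  ((x, covec (fun v => pairing (nu + adstar xi mu) (tmap A A (fun h => (h * x^-1)%g) x v))),
   (mu, xi)).

Definition theta_P : PP -> g * VV -> R := pullback1 PP_atlas TsS_atlas untriv liouville.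

Definition omega_P : PP -> g * VV -> g * VV -> R :=
  pullback2 PP_atlas TsS_atlas untriv (extd TsS_atlas liouville).

Definition act_P (p : PP) (x : G) : PP := ((p.1 * x)%g, p.2).

(* the infinitesimal generator X_eta of the action: the derivative at e along
   eta of x |-> p . x *)
Definition generator (eta : g) (p : PP) : g * VV := tmap A PP_atlas (act_P p) 1%g eta.

Definition momentum (p : PP) : gd := covec (fun eta => theta_P p (generator eta p)).

Definition ddmu (H : VV -> R) (v : VV) : g := dvec (fun l => 'D_(l, 0, 0) H v).
Definition ddnu (H : VV -> R) (v : VV) : g := dvec (fun l => 'D_(0, l, 0) H v).
Definition ddxi (H : VV -> R) (v : VV) : gd := covec (fun z => 'D_(0, 0, z) H v).

Definition reduced_bracket (H K : VV -> R) (v : VV) : R :=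
  let: (mu, nu, xi) := v in
  pairing (ddxi K v) (ddmu H v) - pairing (ddxi H v) (ddmu K v)
  + pairing nu (ad (ddnu H v) (ddnu K v))
  + pairing (adstar (ddnu H v) (ddxi K v) - adstar (ddnu K v) (ddxi H v)) xi
  + pairing mu (ad (ddmu H v) (ddnu K v) - ad (ddmu K v) (ddnu H v)).

Definition orbit_space (mu : gd) : Type := {m : gd | exists x, Adstar x mu = m}.

Definition orbit_map (mu : gd) (x : G) : orbit_space mu :=
  exist _ (Adstar x mu) (ex_intro _ x erefl).

Definition coadj_stab (mu : gd) : set G := [set x | Adstar x mu = mu].

Section Orbit.
Context (mu : gd) (d : nat) (B : atlas (orbit_space mu) 'rV[R]_d).

Definition orbit_incl : orbit_space mu -> gd := fun o => sval o.

Definition orbit_structure : Prop :=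
  [/\ is_manifold B,
      submersion A B (orbit_map mu) &
      immersion B (vec_atlas gd) orbit_incl].

(* t is the tangent vector eta_{g^*}(m) = ad^*_eta m at the point m = orbit_incl o *)
Definition is_gen (o : orbit_space mu) (eta : g) (t : 'rV[R]_d) : Prop :=
  tmap B (vec_atlas gd) orbit_incl o t = adstar eta (orbit_incl o).

Definition QQ : Type := (orbit_space mu * gd * g)%type.
Definition QQ_atlas : atlas QQ ('rV[R]_d * gd * g)%type :=
  prod_atlas (prod_atlas B (vec_atlas gd)) (vec_atlas g).

Definition reduced_form_spec (w : QQ -> 'rV[R]_d * gd * g -> 'rV[R]_d * gd * g -> R) : Prop :=
  forall (q : QQ) (eta eta' : g) (t t' : 'rV[R]_d) (l l' : gd) (z z' : g),
    is_gen q.1.1 eta t -> is_gen q.1.1 eta' t' ->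
    w q (t, l, z) (t', l', z') =
      pairing l' z - pairing l z' - pairing (orbit_incl q.1.1) (ad eta eta').

End Orbit.
End LieGroup.
End Manifolds.

Arguments TsS R n G : clear implicits.
Arguments PP R n G : clear implicits.
Arguments vec_atlas {R} E _.

(* Main.v *)
(* In the right trivialisation, with N = nu + ad*_xi mu (the trivialised alpha_g)
   and r(U) the right-trivialised G-component of a tangent vector U = (.., l, .., z),
     Omega(U, V) = <dN(U), r(V)> - <dN(V), r(U)> + <N, [r(U), r(V)]> + <l', z> - <l, z'>,
   where the bracket comes from the Maurer-Cartan equation, and the momentum map
   is J(h, mu, nu, xi) = Ad*_{h^-1} N.
   Poisson reduction: i_X Omega = - dK is solved explicitly for functions of
   (mu, nu, xi), so that {H, K} = dH(X_K) = B(dH, dK) for the Hamiltonian vector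
   field X_K on the quotient. In the Jacobi identity the second derivatives cancel
   by Schwarz, and what remains is an identity in the Lie algebra.
   Marsden-Weinstein reduction: J = m is N = Ad*_h m, a graph over (h, mu, xi),
   and (h, mu, xi) |-> (Ad*_h m, mu, xi) is the projection. A chart of the orbit at a
   point p is a linear projection of the orbit to R^d that is injective on its
   tangent space at p: the orbit map has constant rank d, and the inverse function
   theorem with the mean value theorem gives the local form of the orbit and a local
   section s of the orbit map. Pulled back by s, the orbit part <m, [.,.]> of the
   reduced form is - d<s^* m, s^* rho>, hence closed. *)
Require Import Defs.
From HB Require Import structures.
From mathcomp Require Import all_boot all_order all_algebra.
From mathcomp Require Import ring lra.
From mathcomp Require Import all_classical all_reals all_analysis.
Import Order.TTheory GRing.Theory Num.Theory.
Import numFieldNormedType.Exports.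
Local Open Scope classical_set_scope.
Local Open Scope ring_scope.
Set Implicit Arguments.
Unset Strict Implicit.
Unset Printing Implicit Defensive.

(** * Differential calculus along plots *)

Section Directional.
Context {R : realType}.
Implicit Types E F K H : normedModType R.

(** A tangent vector at x is given by its components in the chart centred at x, and that chart may
    change with x without any continuity, so components at a moving point cannot be differentiated
    as they stand. Differential geometry is therefore done along plots: maps from a normed space
    into the manifold, differentiated in the chart centred at the fixed point [p k]. The group
    identities are proved for arbitrary plots, then applied to inverse charts, to local sections and
    to two-parameter maps such as [p a * (p b)^-1]. The other obstacle is the orbit, in general only
    immersed in g^*: its charts are cut out by open sets of G, and its topology takes separation
    from g^* and countability from G. The relation [der] keeps differentiability and the value of
    the derivative together, so that one application of a rule yields both. *)

Definition der E F (f : E -> F) (x v : E) (w : F) : Prop :=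
  differentiable f x /\ 'd f x v = w.

Lemma derE E F (f : E -> F) x v : differentiable f x -> der f x v ('d f x v).
Proof. by []. Qed.

Lemma der_d E F (f : E -> F) x v w : der f x v w -> 'd f x v = w.
Proof. by case. Qed.

Lemma der_of E F (f g : E -> F) x v :
  differentiable f x /\ 'd f x = g :> (E -> F) -> der f x v (g v).
Proof. by case=> df <-. Qed.

Lemma der_D E F (f : E -> F) x v w : der f x v w -> 'D_v f x = w.
Proof. by case=> df <-; rewrite deriveE. Qed.

Lemma der_eq E F (f : E -> F) x v w w' : der f x v w -> w = w' -> der f x v w'.
Proof. by move=> + <-. Qed.

(** Bundles a map known to be linear, so that the rules for bundled linear maps apply to it. *)
Lemma linear_pack E F (f : E -> F) : linear f -> exists g : {linear E -> F}, f = g.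
Proof.
move=> fl; pose fM := GRing.isLinear.Build _ _ _ _ f fl.
by exists (HB.pack f fM : {linear E -> F}).
Qed.

(** Trades little-o for an explicit estimate, the form used to differentiate a local inverse and to
    expand a second difference. *)
Lemma diff_normP E F (f df : E -> F) x : linear df -> continuous df ->
  (forall e, 0 < e -> \forall y \near x, `|f y - f x - df (y - x)| <= e * `|y - x|) <->
  differentiable f x /\ 'd f x = df :> (E -> F).
Proof.
move=> /linear_pack[g ->] gc; split=> [h|[/diff_locally fx <-] e e0].
  have fE : f \o shift x = cst (f x) + g +o_ 0 id.
    apply/eqaddoP => _/posnumP[e].
    have := h _ [gt0 of e%:num]; rewrite (near_shift 0)/=; apply: filterS => y /=.
    by rewrite /= subr0 addrK /cst opprD addrA.
  have dg := diff_unique gc fE; split=> //.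
  by apply/diff_locallyP; rewrite dg.
move/eqaddoP : fx => /(_ _ e0).
rewrite [X in _ -> X](near_shift 0) /=; apply: filterS => y /=.
by rewrite subr0 !fctE /= opprD addrA addrK.
Qed.

Lemma diff_near E F (f g : E -> F) x : (\forall y \near x, f y = g y) ->
  differentiable f x -> differentiable g x /\ 'd g x = 'd f x :> (E -> F).
Proof.
move=> fg df; have dc : continuous ('d f x) by exact: diff_continuous.
apply: (diff_normP g x (linearP _) dc).1 => e e0.
have := (diff_normP f x (linearP _) dc).2 (conj df erefl) e e0.
have fgx := nbhs_singleton fg.
by move: fg; apply: filterS2 => y <-; rewrite -fgx.
Qed.

Lemma der_near E F (f g : E -> F) x v w : (\forall y \near x, f y = g y) ->
  der f x v w -> der g x v w.
Proof.
move=> fg [df <-]; have [dg dE] := diff_near fg df.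
by split; [exact: dg|exact: (congr1 (@^~ v) dE)].
Qed.

Lemma der_comp E F K (f : E -> F) (g : F -> K) x v w u :
  der f x v w -> der g (f x) w u -> der (fun y => g (f y)) x v u.
Proof.
move=> [df <-] [dg <-]; rewrite -[fun y => _]/(g \o f).
by split; [exact: differentiable_comp|rewrite diff_comp].
Qed.

Lemma der_pair E F K (f : E -> F) (g : E -> K) x v w u :
  der f x v w -> der g x v u -> der (fun y => (f y, g y)) x v (w, u).
Proof.
by move=> [df <-] [dg <-]; split; [exact: differentiable_pair|rewrite diff_pair].
Qed.

Lemma der_clin E F (g : E -> F) x v : linear g -> continuous g -> der g x v (g v).
Proof.
move=> /linear_pack[h ->] hc; split; first exact: linear_differentiable.
by rewrite diff_lin.
Qed.

Lemma der_cst E F (a : F) (x v : E) : der (fun=> a) x v 0.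
Proof. by split; [exact: differentiable_cst|rewrite (diff_cst _ x)]. Qed.

Lemma der_id E (x v : E) : der (fun y => y) x v v.
Proof. by apply: der_clin => // y; exact: cvg_id. Qed.

Lemma der_add E F (f g : E -> F) x v w u :
  der f x v w -> der g x v u -> der (fun y => f y + g y) x v (w + u).
Proof.
move=> [df <-] [dg <-]; rewrite -[fun y => _]/(f + g).
by split; [exact: differentiableD|rewrite diffD].
Qed.

Lemma der_opp E F (f : E -> F) x v w :
  der f x v w -> der (fun y => - f y) x v (- w).
Proof.
move=> [df <-]; rewrite -[fun y => _]/(- f).
by split; [exact: differentiableN|rewrite diffN].
Qed.

Lemma der_sub E F (f g : E -> F) x v w u :
  der f x v w -> der g x v u -> der (fun y => f y - g y) x v (w - u).
Proof. by move=> fw gu; apply: der_add => //; exact: der_opp. Qed.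

Lemma der_bilin E F K (B : E -> F -> K) (H : normedModType R)
    (f : H -> E) (g : H -> F) (x v : H) w u :
  (forall a, linear (B a)) -> (forall b, linear (B^~ b)) ->
  continuous (fun p : E * F => B p.1 p.2) ->
  der f x v w -> der g x v u ->
  der (fun y => B (f y) (g y)) x v (B w (g x) + B (f x) u).
Proof.
move=> Br Bl Bc fw gu.
have Bb : bilinear_for (GRing.Scale.Law.clone _ _ *:%R _)
  (GRing.Scale.Law.clone _ _ *:%R _) B.
  by split=> [b|a] k y z; [exact: Bl|exact: Br].
pose BM := bilinear_isBilinear.Build R E F K _ _ B Bb.
pose BB : {bilinear E -> F -> K} := HB.pack B BM.
have := @der_comp _ _ _ (fun y => (f y, g y)) (fun p => BB p.1 p.2) x v (w, u).
apply; first exact: der_pair.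
split; first exact: differentiable_bilin.
by rewrite diff_bilin //= addrC.
Qed.

Lemma der_scale E F (a : E -> R) (h : E -> F) x v b w :
  der (a : E -> R^o) x v b -> der h x v w ->
  der (fun y => a y *: h y) x v (b *: h x + a x *: w).
Proof.
apply: (@der_bilin R^o F F (fun a h => a *: h)) => [k|k|p].
- by move=> c y z; rewrite scalerDr !scalerA mulrC.
- by move=> c y z; rewrite scalerDl scalerA.
- by apply: cvgZ; [exact: cvg_fst|exact: cvg_snd].
Qed.

Lemma der_sum E F (I : finType) (f : I -> E -> F) x v (w : I -> F) :
  (forall i, der (f i) x v (w i)) ->
  der (fun y => \sum_i f i y) x v (\sum_i w i).
Proof.
move=> fw; rewrite unlock /=; elim: (index_enum I) => [|i r IH] /=; first exact: der_cst.
exact: der_add.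
Qed.

(** A finite resolution of the identity with continuous coordinate forms; the [b i] span but may be
    dependent. This already makes linear maps continuous and expresses derivatives through finitely
    many directions. *)
Class findim E : Prop := FinDim { findimP : exists (I : finType) (b : I -> E)
  (c : I -> {linear E -> R^o}),
  (forall i, continuous (c i)) /\ forall w, w = \sum_i c i w *: b i }.

Global Instance findim_R : findim R^o.
Proof.
split; exists unit, (fun=> 1), (fun=> idfun); split => [_ x|w]; first exact: cvg_id.
by rewrite big_const card_unit /= addr0 /GRing.scale /= mulr1.
Qed.

Global Instance findim_mx m n : findim 'M[R]_(m, n).
Proof.
split.
have cl i j : linear (fun M : 'M[R]_(m, n) => M i j : R^o).
  by move=> a u v; rewrite !mxE.
have [c cE] := choice (fun ij : 'I_m * 'I_n => linear_pack (cl ij.1 ij.2)).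
exists ('I_m * 'I_n)%type, (fun ij => delta_mx ij.1 ij.2), c; split=> [i|w].
  by rewrite -cE; exact: coord_continuous.
rewrite [LHS]matrix_sum_delta pair_big /=; apply: eq_bigr => i _.
by rewrite -cE.
Qed.

Global Instance findim_prod E F : findim E -> findim F -> findim (E * F)%type.
Proof.
move=> [[I [b [c [cc cE]]]]] [[J [b' [c' [cc' cE']]]]]; split.
have l1 i : linear (fun w : E * F => c i w.1) by move=> a u v; rewrite linearP.
have l2 i : linear (fun w : E * F => c' i w.2) by move=> a u v; rewrite linearP.
have [d dE] := choice (fun i => linear_pack (l1 i)).
have [d' dE'] := choice (fun i => linear_pack (l2 i)).
exists (I + J)%type, (fun i => match i with inl i => (b i, 0) | inr j => (0, b' j) end),
  (fun i => match i with inl i => d i | inr j => d' j end); split=> [[i|j] w|w].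
- by rewrite -dE; apply: continuous_comp; [exact: cvg_fst|exact: cc].
- by rewrite -dE'; apply: continuous_comp; [exact: cvg_snd|exact: cc'].
rewrite big_sumType /=; case: w => w w'.
under eq_bigr do rewrite -dE; under [X in _ = _ + X]eq_bigr do rewrite -dE'.
congr pair.
  rewrite !(raddf_sum (@fst E F)) /= [X in _ + X]big1 ?addr0 => [|i _]; last exact: scaler0.
  exact: cE.
rewrite !(raddf_sum (@snd E F)) /= [X in X + _]big1 ?add0r => [|i _]; last exact: scaler0.
exact: cE'.
Qed.

Lemma continuous_big_sum E F (I : finType) (h : I -> E -> F) x :
  (forall i, {for x, continuous (h i)}) ->
  {for x, continuous (fun w => \sum_i h i w)}.
Proof.
move=> hc; rewrite unlock /=; elim: (index_enum I) => [|i r IH] /=; first exact: cvg_cst.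
by apply: continuousD => //; exact: hc.
Qed.

Lemma findim_continuous E F (f : E -> F) : findim E -> linear f -> continuous f.
Proof.
move=> [[I [b [c [cc cE]]]]] /linear_pack[g ->] x.
rewrite (_ : (g : _ -> _) = (fun w => \sum_i c i w *: g (b i))); last first.
  by apply/funext => w; rewrite {1}[w]cE linear_sum; apply: eq_bigr => i _; rewrite linearZ.
apply: continuous_big_sum => i; apply: cvgZr_tmp; exact: cc.
Qed.

Lemma der_lin E F K (f : K -> E) (L : E -> F) x v w : findim E -> linear L ->
  der f x v w -> der (fun y => L (f y)) x v (L w).
Proof.
move=> fE lL fw; apply: der_comp fw _.
by apply: der_clin => //; exact: findim_continuous.
Qed.

Lemma bilinear_continuous E F K (B : E -> F -> K) : findim E -> findim F ->
  (forall a, linear (B a)) -> (forall b, linear (B^~ b)) ->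
  continuous (fun p : E * F => B p.1 p.2).
Proof.
move=> [[I [b [c [cc cE]]]]] fF Br Bl p.
have -> : (fun p : E * F => B p.1 p.2) = (fun q => \sum_i c i q.1 *: B (b i) q.2).
  apply/funext => q; rewrite {1}[q.1]cE.
  have [L LE] := linear_pack (Bl q.2).
  rewrite -[LHS]/((B^~ q.2) _) LE linear_sum; apply: eq_bigr => i _.
  by rewrite linearZ -LE.
apply: continuous_big_sum => i; apply: cvgZ.
  by apply: continuous_comp; [exact: cvg_fst|exact: cc].
by apply: (@continuous_comp _ _ _ snd (B (b i)));
  [exact: cvg_snd|exact: findim_continuous].
Qed.

Lemma der_bil E F K (B : E -> F -> K) (H : normedModType R)
    (f : H -> E) (g : H -> F) (x v : H) w u : findim E -> findim F ->
  (forall a, linear (B a)) -> (forall b, linear (B^~ b)) ->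
  der f x v w -> der g x v u ->
  der (fun y => B (f y) (g y)) x v (B w (g x) + B (f x) u).
Proof. by move=> fE fF Br Bl; apply: der_bilin => //; exact: bilinear_continuous. Qed.

End Directional.

(** * Smooth functions in finite dimension *)

Section Smooth.
Context {R : realType}.
Implicit Types E F K H : normedModType R.

(** [differentiable] and ['D_v f] refer to the ambient function, so the recursion uses [U] only
    through its points, and [Ck] is a condition at each point separately. *)
Lemma Ck_pt E F k (U : set E) (f : E -> F) :
  Ck k U f <-> forall x, U x -> Ck k [set x] f.
Proof.
elim: k f => [|k IH] f /=.
  by split=> [h x Ux y ->|h x Ux]; [exact: h|exact: (h x Ux x)].
split=> [[df h] x Ux|h].
  by split=> [y ->|v]; [exact: df|move: x Ux; apply/IH].
split=> [y Uy|v]; last by apply/IH => x /h[_]; apply.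
by have [dfy _] := h y Uy; exact: dfy.
Qed.

Lemma Ck_sub E F k (U V : set E) (f : E -> F) : V `<=` U -> Ck k U f -> Ck k V f.
Proof. by move=> VU /Ck_pt h; apply/Ck_pt => x /VU; exact: h. Qed.

Lemma Ck_ext E F k (U : set E) (f g : E -> F) : open U ->
  (forall x, U x -> f x = g x) -> Ck k U f -> Ck k U g.
Proof.
move=> Uo; have Un x : U x -> \forall y \near x, U y by move=> ?; exact: open_nbhs_nbhs.
elim: k f g => [|k IH] f g fg /=.
  move=> h x Ux; rewrite /prop_for /continuous_at -(fg x Ux).
  apply: cvg_trans (h x Ux); apply: near_eq_cvg.
  by apply: filterS (Un x Ux) => y /fg.
move=> [df h]; split=> [x Ux|v].
  have /diff_near-/(_ (df x Ux))[] // : \forall y \near x, f y = g y.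
  by apply: filterS (Un x Ux) => y /fg.
apply: IH (h v) => x Ux; apply: near_eq_derive.
by apply: filterS (Un x Ux) => y /fg.
Qed.

Lemma Ck_cont E F k (U : set E) (f : E -> F) : Ck k U f ->
  forall x, U x -> {for x, continuous f}.
Proof. by case: k => [//|k [df _] x Ux]; apply: differentiable_continuous; exact: df. Qed.

Lemma CkW E F k (U : set E) (f : E -> F) : Ck k.+1 U f -> Ck k U f.
Proof.
elim: k f => [|k IH] f h; first exact: Ck_cont h.
by case: h => df h; split=> // v; apply: IH.
Qed.

Lemma Ck_cst E F k (U : set E) (a : F) : Ck k U (fun=> a).
Proof.
elim: k a => [|k IH] a /=; first by move=> x _; exact: cvg_cst.
split=> [x _|v]; first exact: differentiable_cst.
rewrite (_ : 'D_v _ = fun=> 0) //; apply/funext => x.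
exact: der_D (der_cst a x v).
Qed.

Lemma Ck_lin E F K k (U : set E) (f : E -> F) (L : F -> K) : open U ->
  linear L -> continuous L -> Ck k U f -> Ck k U (fun x => L (f x)).
Proof.
move=> Uo Ll Lc; elim: k f => [|k IH] f /= h.
  by move=> x Ux; apply: continuous_comp; [exact: h|exact: Lc].
have [df h'] := h.
have dL x v : U x -> der (fun y => L (f y)) x v (L ('D_v f x)).
  move=> Ux; rewrite deriveE; last exact: df.
  by apply: der_comp (derE v (df x Ux)) _; exact: der_clin.
split=> [x Ux|v]; first by have [] := dL x 0 Ux.
by apply: (Ck_ext Uo _ (IH _ (h' v))) => x Ux; rewrite (der_D (dL x v Ux)).
Qed.

Lemma Ck_id E k (U : set E) : Ck k U (fun x : E => x).
Proof.
case: k => [|k] /=; first by move=> x _; exact: cvg_id.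
split=> [x _|v]; first by have [] := der_id x x.
rewrite (_ : 'D_v _ = fun=> v); first exact: Ck_cst.
by apply/funext => x; exact: der_D (der_id x v).
Qed.

Lemma Ck_add E F k (U : set E) (f g : E -> F) : open U ->
  Ck k U f -> Ck k U g -> Ck k U (fun x => f x + g x).
Proof.
move=> Uo; elim: k f g => [|k IH] f g /= hf hg.
  by move=> x Ux; apply: continuousD; [exact: hf|exact: hg].
have [df hf'] := hf; have [dg hg'] := hg.
have dL x v : U x -> der (fun y => f y + g y) x v ('D_v f x + 'D_v g x).
  move=> Ux; rewrite !deriveE; [|exact: dg|exact: df].
  by apply: der_add; apply: derE; [exact: df|exact: dg].
split=> [x Ux|v]; first by have [] := dL x 0 Ux.
by apply: (Ck_ext Uo _ (IH _ _ (hf' v) (hg' v))) => x Ux; rewrite (der_D (dL x v Ux)).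
Qed.

Lemma Ck_sum E F k (I : finType) (U : set E) (f : I -> E -> F) : open U ->
  (forall i, Ck k U (f i)) -> Ck k U (fun x => \sum_i f i x).
Proof.
move=> Uo h; rewrite unlock /=; elim: (index_enum I) => [|i r IH] /=; first exact: Ck_cst.
exact: Ck_add.
Qed.

Lemma Ck_scale E F k (U : set E) (a : E -> R^o) (f : E -> F) : open U ->
  Ck k U a -> Ck k U f -> Ck k U (fun x => a x *: f x).
Proof.
move=> Uo; elim: k a f => [|k IH] a f ha hf.
  by move=> x Ux; apply: cvgZ; [exact: ha|exact: hf].
have [da ha'] := ha; have [df hf'] := hf.
have dL x v : U x -> der (fun y => a y *: f y) x v ('D_v a x *: f x + a x *: 'D_v f x).
  move=> Ux; rewrite !deriveE; [|exact: df|exact: da].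
  by apply: der_scale; apply: derE; [exact: da|exact: df].
split=> [x Ux|v]; first by have [] := dL x 0 Ux.
have h : Ck k U (fun x => 'D_v a x *: f x + a x *: 'D_v f x).
  by apply: (Ck_add Uo); [exact: IH (ha' v) (CkW hf)|exact: IH (CkW ha) (hf' v)].
by apply: (Ck_ext Uo _ h) => x Ux; rewrite (der_D (dL x v Ux)).
Qed.

Lemma Ck_pair E F K k (U : set E) (f : E -> F) (g : E -> K) : open U ->
  Ck k U f -> Ck k U g -> Ck k U (fun x => (f x, g x)).
Proof.
move=> Uo; elim: k f g => [|k IH] f g /= hf hg.
  by move=> x Ux; apply: cvg_pair; [exact: hf|exact: hg].
have [df hf'] := hf; have [dg hg'] := hg.
have dL x v : U x -> der (fun y => (f y, g y)) x v ('D_v f x, 'D_v g x).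
  move=> Ux; rewrite !deriveE; [|exact: dg|exact: df].
  by apply: der_pair; apply: derE; [exact: df|exact: dg].
split=> [x Ux|v]; first by have [] := dL x 0 Ux.
by apply: (Ck_ext Uo _ (IH _ _ (hf' v) (hg' v))) => x Ux; rewrite (der_D (dL x v Ux)).
Qed.

(** The chain rule is expanded over the fixed directions [b i], so that each summand is a product of
    functions covered by the induction hypothesis. *)
Lemma Ck_comp E F K k (U : set E) (V : set F) (f : E -> F) (g : F -> K) :
  findim F -> open U -> open V -> f @` U `<=` V ->
  Ck k U f -> Ck k V g -> Ck k U (fun x => g (f x)).
Proof.
move=> [[I [b [c [cc cE]]]]] Uo Vo fUV.
elim: k f g fUV => [|k IH] f g fUV hf hg.
  move=> x Ux; apply: continuous_comp; first exact: hf.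
  by apply: hg; apply: fUV; exists x.
have [df hf'] := hf; have [dg hg'] := hg.
have dL x v : U x ->
    der (fun y => g (f y)) x v (\sum_i c i ('D_v f x) *: 'D_(b i) g (f x)).
  move=> Ux; have Vfx : V (f x) by apply: fUV; exists x.
  apply: der_comp (derE v (df x Ux)) _.
  apply: der_eq; first exact: derE (dg _ Vfx).
  rewrite -(deriveE v (df x Ux)) {1}['D_v f x]cE linear_sum; apply: eq_bigr => i _.
  by rewrite linearZ (deriveE _ (dg _ Vfx)).
split=> [x Ux|v]; first by have [] := dL x 0 Ux.
have h : Ck k U (fun x => \sum_i c i ('D_v f x) *: 'D_(b i) g (f x)).
  apply: (Ck_sum Uo) => i; apply: (Ck_scale Uo).
    by apply: (Ck_lin (L := c i)) => //; [exact: linearP|exact: hf'].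
  exact: (IH f ('D_(b i) g) fUV (CkW hf) (hg' (b i))).
by apply: (Ck_ext Uo _ h) => x Ux; rewrite (der_D (dL x v Ux)).
Qed.

Lemma Ck_inv E k (U : set E) (f : E -> R^o) : open U -> (forall x, U x -> f x != 0) ->
  Ck k U f -> Ck k U (fun x => (f x)^-1 : R^o).
Proof.
move=> Uo f0; elim: k => [|k IH] hf.
  by move=> x Ux; apply: cvgV; [exact: f0|exact: hf].
have [df hf'] := hf.
have dL x v : U x -> der (fun y => (f y)^-1 : R^o) x v (- (f x)^-1 *: ((f x)^-1 *: 'D_v f x)).
  move=> Ux; split; first by apply: differentiableV; [exact: df|exact: f0].
  have := diffV (df x Ux) (f0 x Ux).
  move=> /(congr1 (@^~ v)) /= ->.
  by rewrite (deriveE v (df x Ux)) scalerA mulNr -expr2 exprVn.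
split=> [x Ux|v]; first by have [] := dL x 0 Ux.
have IH' := IH (CkW hf).
have h : Ck k U (fun x => - (f x)^-1 *: ((f x)^-1 *: 'D_v f x)).
  apply: (Ck_scale Uo _ (Ck_scale Uo IH' (hf' v))).
  apply: (@Ck_lin E R^o R^o k U _ (fun x => - x)) => //; last exact: opp_continuous.
  by move=> a x y; rewrite opprD scalerN.
by apply: (Ck_ext Uo _ h) => x Ux; rewrite (der_D (dL x v Ux)).
Qed.

(** Smoothness of the germ at x; the rules below then compose without tracking open domains. *)
Definition sm E F (x : E) (f : E -> F) : Prop :=
  exists U, [/\ open U, U x & smooth_on U f].

Lemma open_near E (U : set E) x : open U -> U x -> \forall y \near x, U y.
Proof. by move=> *; exact: open_nbhs_nbhs. Qed.

Lemma near_open E (P : set E) x : (\forall y \near x, P y) ->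
  exists U, [/\ open U, U x & U `<=` P].
Proof.
move=> h; exists P°; split; [exact: open_interior|exact: h|exact: interior_subset].
Qed.

Lemma smI E F (f : E -> F) U x : open U -> smooth_on U f -> U x -> sm x f.
Proof. by exists U. Qed.

Lemma sm_smooth E F (U : set E) (f : E -> F) : (forall x, U x -> sm x f) -> smooth_on U f.
Proof.
move=> h k; apply/Ck_pt => x /h[V [Vo Vx fV]]; have /Ck_pt := fV k; exact.
Qed.

Lemma sm_near E F (f : E -> F) x : sm x f -> \forall y \near x, sm y f.
Proof. by move=> [U [Uo Ux fU]]; apply: filterS (open_near Uo Ux) => y; exact: smI. Qed.

Lemma sm_ext E F (f g : E -> F) x : (\forall y \near x, f y = g y) -> sm x f -> sm x g.
Proof.
move=> /near_open[V [Vo Vx fg]] [U [Uo Ux fU]]; exists (U `&` V); split=> //.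
  exact: openI.
move=> k; apply: (Ck_ext (f := f)); first exact: openI.
  by move=> y [_ /fg].
by apply: Ck_sub (fU k) => y [].
Qed.

Lemma sm_diff E F (f : E -> F) x : sm x f -> differentiable f x.
Proof. by move=> [U [Uo Ux /(_ 1)[df _]]]; exact: df. Qed.

Lemma sm_der E F (f : E -> F) x v : sm x f -> der f x v ('d f x v).
Proof. by move=> /sm_diff /derE. Qed.

Lemma sm_cont E F (f : E -> F) x : sm x f -> {for x, continuous f}.
Proof. by move=> /sm_diff /differentiable_continuous. Qed.

Lemma sm_near_set E F (f : E -> F) x (V : set F) : sm x f ->
  open V -> V (f x) -> \forall y \near x, V (f y).
Proof. by move=> /sm_cont fc Vo Vfx; apply: fc; exact: open_nbhs_nbhs. Qed.

Lemma sm_D E F (f : E -> F) x v : sm x f -> sm x ('D_v f).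
Proof. by move=> [U [Uo Ux fU]]; exists U; split=> // k; have [_ +] := fU k.+1; exact. Qed.

Lemma sm_cst E F (a : F) (x : E) : sm x (fun=> a).
Proof. by exists setT; split=> // [|k]; [exact: openT|exact: Ck_cst]. Qed.

Lemma sm_id E (x : E) : sm x (fun y => y).
Proof. by exists setT; split=> // [|k]; [exact: openT|exact: Ck_id]. Qed.

Lemma sm_comp E F K (f : E -> F) (g : F -> K) x : findim F ->
  sm x f -> sm (f x) g -> sm x (fun y => g (f y)).
Proof.
move=> fF fx [V [Vo Vx gV]].
have /near_open[W [Wo Wx fW]] := sm_near_set fx Vo Vx.
have [U [Uo Ux fU]] := fx.
exists (U `&` W); split=> // [|k]; first exact: openI.
apply: (Ck_comp (V := V)) => //; first exact: openI.
- by move=> _ [y [_ /fW] + <-].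
- by apply: Ck_sub (fU k) => y [].
Qed.

Lemma sm2 E F K (f : E -> F) (g : E -> K) x : sm x f -> sm x g ->
  exists U, [/\ open U, U x, smooth_on U f & smooth_on U g].
Proof.
move=> [U [Uo Ux fU]] [V [Vo Vx fV]]; exists (U `&` V); split=> //; first exact: openI.
- by move=> k; apply: Ck_sub (fU k) => y [].
- by move=> k; apply: Ck_sub (fV k) => y [].
Qed.

Lemma sm_pair E F K (f : E -> F) (g : E -> K) x : sm x f -> sm x g ->
  sm x (fun y => (f y, g y)).
Proof.
move=> fx gx; have [U [Uo Ux fU gU]] := sm2 fx gx.
by exists U; split=> // k; exact: Ck_pair.
Qed.

Lemma sm_add E F (f g : E -> F) x : sm x f -> sm x g -> sm x (fun y => f y + g y).
Proof.
move=> fx gx; have [U [Uo Ux fU gU]] := sm2 fx gx.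
by exists U; split=> // k; exact: Ck_add.
Qed.

Lemma sm_scale E F (a : E -> R^o) (f : E -> F) x : sm x a -> sm x f ->
  sm x (fun y => a y *: f y).
Proof.
move=> fx gx; have [U [Uo Ux fU gU]] := sm2 fx gx.
by exists U; split=> // k; exact: Ck_scale.
Qed.

Lemma sm_mul E (a b : E -> R^o) x : sm x a -> sm x b -> sm x (fun y => a y * b y : R^o).
Proof. exact: sm_scale. Qed.

Lemma sm_lin E F K (L : F -> K) (f : E -> F) x : findim F -> linear L ->
  sm x f -> sm x (fun y => L (f y)).
Proof.
move=> fF Ll [U [Uo Ux fU]]; exists U; split=> // k.
by apply: Ck_lin => //; exact: findim_continuous.
Qed.

Lemma sm_opp E F (f : E -> F) x : sm x f -> sm x (fun y => - f y).
Proof.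
move=> [U [Uo Ux fU]]; exists U; split=> // k.
apply: (Ck_lin (L := fun y : F => - y)) => //; last exact: opp_continuous.
by move=> a u v; rewrite opprD scalerN.
Qed.

Lemma sm_sub E F (f g : E -> F) x : sm x f -> sm x g -> sm x (fun y => f y - g y).
Proof. by move=> fx gx; apply: sm_add => //; exact: sm_opp. Qed.

Lemma sm_sum E F (I : finType) (f : I -> E -> F) x :
  (forall i, sm x (f i)) -> sm x (fun y => \sum_i f i y).
Proof.
move=> h; rewrite unlock /=; elim: (index_enum I) => [|i r IH] /=; first exact: sm_cst.
exact: sm_add.
Qed.

Lemma sm_inv E (f : E -> R^o) x : sm x f -> f x != 0 -> sm x (fun y => (f y)^-1 : R^o).
Proof.
move=> fx fx0.
have : \forall y \near x, f y != 0.
  have := sm_cont fx; rewrite /prop_for /continuous_at => /cvgr_neq0; exact.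
move=> /near_open[W [Wo Wx W0]]; have [U [Uo Ux fU]] := fx.
exists (U `&` W); split=> // [|k]; first exact: openI.
apply: Ck_inv; [exact: openI|by move=> y [_ /W0]|by apply: Ck_sub (fU k) => y []].
Qed.

Lemma sm_bil E F K H (B : F -> K -> H) (f : E -> F) (g : E -> K) x :
  findim F -> findim K -> (forall a, linear (B a)) -> (forall b, linear (B^~ b)) ->
  sm x f -> sm x g -> sm x (fun y => B (f y) (g y)).
Proof.
move=> [[I [b [c [cc cE]]]]] fK Br Bl fx gx.
apply: (@sm_ext _ _ (fun y => \sum_i c i (f y) *: B (b i) (g y))).
  near=> y; rewrite [in RHS](cE (f y)).
  have [L LE] := linear_pack (Bl (g y)).
  rewrite -[RHS]/((B^~ (g y)) _) LE linear_sum; apply: eq_bigr => i _.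
  by rewrite linearZ -LE.
apply: sm_sum => i; apply: sm_scale; last exact: sm_lin.
apply: sm_lin => //; last exact: linearP.
by split; exists I, b, c.
Unshelve. all: by end_near. Qed.

(** Base point and direction both move; expanding the direction over [b i] reduces to the smooth
    functions ['D_(b i) f]. *)
Lemma sm_d E F K (f : F -> K) (p : E -> F) (v : E -> F) x : findim F ->
  sm x p -> sm x v -> sm (p x) f -> sm x (fun y => 'd f (p y) (v y)).
Proof.
move=> fF px vx fx; have [[I [b [c [cc cE]]]]] := fF.
apply: (@sm_ext _ _ (fun y => \sum_i c i (v y) *: 'D_(b i) f (p y))).
  have [V [Vo Vx fV]] := fx.
  have := sm_near_set px Vo Vx; apply: filterS => y Vy.
  have dfy : differentiable f (p y) by exact: sm_diff (smI Vo fV Vy).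
  rewrite [in RHS](cE (v y)) linear_sum; apply: eq_bigr => i _.
  by rewrite linearZ (deriveE _ dfy).
apply: sm_sum => i; apply: sm_scale; first by apply: sm_lin => //; exact: linearP.
by apply: (sm_comp (g := 'D_(b i) f)) => //; exact: sm_D.
Qed.

End Smooth.

(** Completeness of matrix spaces, on which the fixed point theorem in [contraction_solve] rests. *)
HB.instance Definition _ (R : realType) (m n : nat) :=
  Uniform_isComplete.Build 'M[R]_(m, n) (@cauchy_cvg [the completeType of 'M[R]_(m, n)]).

(** * Mean value, Schwarz and inverse function theorems *)

Section MeanValue.
Context {R : realType}.
Implicit Types E F K : normedModType R.

Lemma MVT_der (f df : R -> R) :
  (forall t, 0 <= t <= 1 -> der (f : R^o -> R^o) t 1 (df t)) ->
  exists2 t, 0 <= t <= 1 & f 1 - f 0 = df t.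
Proof.
move=> h.
have [||t] := @MVT_segment R f df 0 1 ler01.
- move=> x; rewrite in_itv /= => /andP[/ltW x0 /ltW x1].
  have [|df' E] := h x; first by rewrite x0 x1.
  by apply: DeriveDef; [exact: diff_derivable|rewrite deriveE].
- apply: continuous_in_subspaceT => x; rewrite inE /= in_itv /= => xI.
  by have [df' _] := h x xI; exact: differentiable_continuous.
by rewrite in_itv /= subr0 mulr1 => tI ->; exists t.
Qed.

Lemma der_line E (x w : E) (t : R^o) : der (fun s : R^o => x + s *: w) t 1 w.
Proof.
apply: der_eq.
  have H := (der_add (der_cst x t 1) (@der_scale R R^o E (fun s => s) _ t 1 _ _ (der_id t _) (der_cst w t 1))).
  exact: H.
by rewrite /= scaler0 addr0 scale1r add0r.
Qed.

Lemma der_along E F (f : E -> F) (x w : E) (t : R^o) :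
  differentiable f (x + t *: w) ->
  der (fun s : R^o => f (x + s *: w)) t 1 ('d f (x + t *: w) w).
Proof. by move=> df; apply: der_comp (der_line x w t) _; exact: derE. Qed.

Lemma mean_value_coord E m n (f : E -> 'M[R]_(m, n)) (x w : E) i j :
  (forall t : R, 0 <= t <= 1 -> differentiable f (x + t *: w)) ->
  exists2 t : R, 0 <= t <= 1 & (f (x + w) - f x) i j = 'd f (x + t *: w) w i j.
Proof.
move=> df.
have cl : linear (fun M : 'M[R]_(m, n) => M i j : R^o) by move=> a u v; rewrite !mxE.
have [t tI E1] := @MVT_der (fun t => f (x + t *: w) i j)
  (fun t => 'd f (x + t *: w) w i j)
  (fun t tI => der_lin _ cl (der_along (df t tI))).
by exists t; rewrite // -E1 !mxE scale1r scale0r addr0.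
Qed.

(** The matrix norm is the maximum of the entries, so the scalar theorem is used entry by entry with
    no loss in the constant; the intermediate parameter depends on the entry, whence an
    inequality. *)
Lemma mean_value_le E m n (f : E -> 'M[R]_(m, n)) (x w : E) (b : R) : 0 <= b ->
  (forall t : R, 0 <= t <= 1 -> differentiable f (x + t *: w)) ->
  (forall t : R, 0 <= t <= 1 -> `|'d f (x + t *: w) w| <= b) ->
  `|f (x + w) - f x| <= b.
Proof.
move=> b0 df db; rewrite [leLHS]/Num.Def.normr /= mx_normrE.
apply: bigmax_le => // -[i j] _ /=.
have [t tI ->] := mean_value_coord i j df.
apply: le_trans (db t tI); rewrite [leRHS]/Num.Def.normr /= mx_normrE.
exact: (le_bigmax _ (fun ij : 'I_m * 'I_n => `|'d f (x + t *: w) w ij.1 ij.2|) (i, j)).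
Qed.

Lemma mean_value_const E m n (f : E -> 'M[R]_(m, n)) (x w : E) :
  (forall t : R, 0 <= t <= 1 -> der f (x + t *: w) w 0) -> f (x + w) = f x.
Proof.
move=> h; apply/eqP; rewrite -subr_eq0 -normr_le0.
apply: mean_value_le => // t tI; have [df dE] := h t tI; first exact: df.
by rewrite dE normr0.
Qed.

(** The mean value theorem along u is applied to the increment of f along v; the first-order
    expansion of ['D_u f] at x gives the rest. *)
Lemma second_difference E (f : E -> R^o) (x u v : E) (e : R) : 0 < e ->
  (\forall y \near x, differentiable f y) -> differentiable ('D_u f) x ->
  \forall h \near 0^'+, `|f (x + h *: u + h *: v) - f (x + h *: u) - f (x + h *: v) + f x
    - h ^+ 2 * 'D_v ('D_u f) x| <= e * h ^+ 2.
Proof.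
move=> e0 df dg.
set g := 'D_u f in dg *.
have gl : linear ('d g x) by exact: linearP.
have gc : continuous ('d g x) by exact: diff_continuous.
(* [h * c] bounds the distance from x to the whole parallelogram. The two error terms, each at most
   [e / (2 * c)] times it, add up to [e * h]; the 1 keeps c positive when u and v vanish. *)
pose c := `|u| + `|v| + 1.
have c0 : 0 < c by rewrite ltr_wpDl // addr_ge0.
have e1 : 0 < e / (2 * c) by rewrite divr_gt0 // mulr_gt0.
have := (diff_normP g x gl gc).2 (conj dg erefl) _ e1.
move=> /(filterI df)/nbhs_normP[d /= d0 hd].
near=> h.
have h0 : 0 < h by near: h; exact: nbhs_right_gt.
have hd' : h * c < d.
  by rewrite -ltr_pdivlMr //; near: h; apply: nbhs_right_lt; rewrite divr_gt0.
pose P (t s : R) := x + t *: (h *: u) + s *: (h *: v).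
have PE t s : P t s - x = t *: (h *: u) + s *: (h *: v) by rewrite /P addrAC [x + _]addrC addrK addrC.
have inb (t s : R) : 0 <= t <= 1 -> 0 <= s <= 1 -> `|P t s - x| <= h * c.
  move=> /andP[t0 t1] /andP[s0 s1]; rewrite PE; apply: le_trans (ler_normD _ _) _.
  rewrite !normrZ (gtr0_norm h0) (ger0_norm t0) (ger0_norm s0).
  have ha : t * (h * `|u|) <= h * `|u| by rewrite ler_piMl // mulr_ge0 // ltW.
  have hb : s * (h * `|v|) <= h * `|v| by rewrite ler_piMl // mulr_ge0 // ltW.
  by apply: le_trans (lerD ha hb) _; rewrite -mulrDr ler_wpM2l ?(ltW h0) // /c lerDl.
have inb' (t s : R) : 0 <= t <= 1 -> 0 <= s <= 1 -> ball_ Num.norm x d (P t s).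
  by move=> tI sI; rewrite /ball_ /= distrC; apply: le_lt_trans (inb t s tI sI) _.
have I0 : (0 : R) <= (0 : R) <= 1 by lra.
have I1 : (0 : R) <= (1 : R) <= 1 by lra.
have dP (t s : R) : der (fun t : R^o => P t s) t 1 (h *: u).
  apply: der_eq; first exact: (der_add (der_line _ _ _) (der_cst _ _ _)).
  by rewrite addr0.
have dfP (t s : R) : 0 <= t <= 1 -> 0 <= s <= 1 ->
    der (fun t : R^o => f (P t s)) t 1 (h * g (P t s)).
  move=> tI sI; have [dfp _] := hd _ (inb' t s tI sI).
  apply: der_eq; first by apply: der_comp (dP t s) _; exact: derE.
  by rewrite linearZ /g deriveE.
have [t tI] := @MVT_der (fun t => f (P t 1) - f (P t 0)) _
  (fun t tI => der_sub (dfP t 1 tI I1) (dfP t 0 tI I0)).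
have -> : x + h *: u + h *: v = P 1 1 by rewrite /P !scale1r.
have -> : x + h *: u = P 1 0 by rewrite /P !scale1r scale0r addr0.
have -> : x + h *: v = P 0 1 by rewrite /P !scale1r scale0r addr0.
have {1}-> : x = P 0 0 by rewrite /P !scale0r !addr0.
move=> E1.
have [_ h1] := hd _ (inb' t 1 tI I1); have [_ h2] := hd _ (inb' t 0 tI I0).
have -> : f (P 1 1) - f (P 1 0) - f (P 0 1) + f (P 0 0) = h * (g (P t 1) - g (P t 0)).
  by rewrite mulrBr -E1; ring.
have -> : h * (g (P t 1) - g (P t 0)) - h ^+ 2 * 'D_v g x =
    h * ((g (P t 1) - g x - 'd g x (P t 1 - x)) - (g (P t 0) - g x - 'd g x (P t 0 - x))).
  have -> : 'd g x (P t 1 - x) = 'd g x (P t 0 - x) + h * 'd g x v.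
    by rewrite !PE scale1r scale0r addr0 linearD [X in _ + X]linearZ.
  rewrite (deriveE _ dg); ring.
rewrite normrM (gtr0_norm h0) expr2 mulrCA ler_wpM2l ?(ltW h0) //.
apply: le_trans (ler_normB _ _) _; apply: le_trans (lerD h1 h2) _.
rewrite -mulrDr -mulrA ler_pM2l // mulrC ler_pdivrMr ?mulr_gt0 //.
have := inb t 1 tI I1; have := inb t 0 tI I0; lra.
Unshelve. all: by end_near. Qed.

(** The second difference is symmetric in u and v; comparing its two expansions at one small h and
    dividing by [h ^+ 2] bounds the gap by any e. *)
Lemma schwarz_scalar E (f : E -> R^o) (x u v : E) : sm x f ->
  'D_v ('D_u f) x = 'D_u ('D_v f) x.
Proof.
move=> fx.
have df : \forall y \near x, differentiable f y.
  by apply: filterS (sm_near fx) => y; exact: sm_diff.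
have dg w : differentiable ('D_w f) x by apply: sm_diff; exact: sm_D.
apply/eqP; rewrite -subr_eq0 -normr_le0; apply/ler_addgt0Pl => e e0; rewrite addr0.
have e2 : 0 < e / 2 by rewrite divr_gt0.
have h1 := second_difference v e2 df (dg u).
have h2 := second_difference u e2 df (dg v).
have [h [[hh1 hh2] h0]] := filter_ex (filterI (filterI h1 h2) (nbhs_right_gt (0 : R))).
move: hh2; rewrite [x + h *: v + h *: u]addrAC [_ - f (x + h *: v) - f _]addrAC => hh2.
have := le_trans (ler_normB _ _) (lerD hh2 hh1).
set a := 'D_v _ x; set b := 'D_u _ x; set F := _ + f x.
rewrite (_ : _ - _ - _ = h ^+ 2 * (a - b)); last by ring.
rewrite normrM (ger0_norm (sqr_ge0 h)) -mulrDl -splitr mulrC.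
by rewrite ler_pM2r // exprn_gt0.
Qed.

Lemma schwarz E F (f : E -> F) (x u v : E) : findim F -> sm x f ->
  'D_v ('D_u f) x = 'D_u ('D_v f) x.
Proof.
move=> fF fx; have [[I [b [c [cc cE]]]]] := fF.
have cD (g : E -> F) y w i : sm y g -> 'D_w (fun z => c i (g z) : R^o) y = c i ('D_w g y).
  move=> gy; apply: der_D; apply: (@der_lin R F R^o E g (c i)) => //; first exact: linearP.
  by rewrite (deriveE _ (sm_diff gy)); exact: sm_der.
have cDD w w' i : c i ('D_w ('D_w' f) x) = 'D_w ('D_w' (fun z => c i (f z) : R^o)) x.
  rewrite -cD; last exact: sm_D.
  apply: near_eq_derive; apply: filterS (sm_near fx) => y fy; by rewrite cD.
have E1 i : c i ('D_v ('D_u f) x) = c i ('D_u ('D_v f) x).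
  rewrite !cDD; apply: schwarz_scalar; apply: (@sm_lin R E F R^o (c i)) => //.
  exact: linearP.
by rewrite ['D_v _ x]cE ['D_u _ x]cE; apply: eq_bigr => i _; rewrite E1.
Qed.

(** Smallness of the finitely many partial derivatives becomes an operator bound through the
    Lipschitz constants [k i] of the coordinate forms. *)
Lemma small_opnorm E m n (f : E -> 'M[R]_(m, n)) (x : E) (e : R) : findim E ->
  sm x f -> 'd f x = (fun=> 0) :> (E -> _) -> 0 < e ->
  \forall z \near x, forall w, `|'d f z w| <= e * `|w|.
Proof.
move=> [[I [b [c [cc cE]]]]] fx d0 e0.
have /choice[k kp] : forall i, exists k, 0 < k /\ forall w, `|c i w| <= k * `|w|.
  move=> i; have := linear_lipschitz (cc i).
  by move=> [k k0 h]; exists k.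
pose S := \sum_i k i.
have S0 : 0 <= S by apply: sumr_ge0 => i _; have [/ltW] := kp i.
have e1 : 0 < e / (S + 1) by rewrite divr_gt0 // ltr_wpDl.
have h : \forall z \near x, forall i, `|'D_(b i) f z| <= e / (S + 1).
  apply: filter_forall => i.
  have := sm_cont (sm_D (b i) fx); rewrite /prop_for /continuous_at.
  rewrite (deriveE _ (sm_diff fx)) d0 => /cvgrPdist_le/(_ _ e1).
  by apply: filterS => z; rewrite sub0r normrN.
near=> z => w.
have fz : sm z f by near: z; exact: sm_near.
have hz : forall i, `|'D_(b i) f z| <= e / (S + 1) by near: z.
rewrite {1}(cE w) linear_sum; apply: le_trans (ler_norm_sum _ _ _) _.
apply: (@le_trans _ _ (\sum_i k i * `|w| * (e / (S + 1)))).
  apply: ler_sum => i _; rewrite linearZ normrZ ler_pM //.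
    by have [_] := kp i; exact.
  by rewrite -(deriveE _ (sm_diff fz)).
rewrite -!mulr_suml -/S -mulrA mulrCA [leRHS]mulrC ler_wpM2l //.
rewrite mulrA ler_pdivrMr ?ltr_wpDl // mulrC ler_wpM2l ?ltW //; lra.
Unshelve. all: by end_near. Qed.

Lemma sm_mx E m n (f : E -> 'M[R]_(m, n)) x :
  (forall i j, sm x (fun y => f y i j : R^o)) -> sm x f.
Proof.
move=> h; apply: (@sm_ext _ _ _ (fun y => \sum_i \sum_j (f y i j : R^o) *: delta_mx i j)).
  by near=> y; rewrite [RHS]matrix_sum_delta.
by apply: sm_sum => i; apply: sm_sum => j; apply: sm_scale => //; exact: sm_cst.
Unshelve. all: by end_near. Qed.

Lemma linear_coord m n i j : linear (fun M : 'M[R]_(m, n) => M i j : R^o).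
Proof. by move=> a u v; rewrite !mxE. Qed.

Lemma sm_coord E m n (f : E -> 'M[R]_(m, n)) x i j : sm x f -> sm x (fun y => f y i j : R^o).
Proof. exact: (sm_lin (findim_mx _ _) (@linear_coord m n i j)). Qed.

Lemma sm_prod E (I : finType) (f : I -> E -> R^o) x :
  (forall i, sm x (f i)) -> sm x (fun y => \prod_i f i y : R^o).
Proof.
move=> h; rewrite unlock /=; elim: (index_enum I) => [|i r IH] /=; first exact: sm_cst.
exact: sm_mul.
Qed.

Lemma sm_det E n (f : E -> 'M[R]_n) x : sm x f -> sm x (fun y => \det (f y) : R^o).
Proof.
move=> fx; apply: sm_sum => s; apply: sm_mul; first exact: sm_cst.
by apply: sm_prod => i; exact: sm_coord.
Qed.

(** Cramer's rule: adjugate over determinant, both polynomial in the entries. *)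
Lemma sm_invmx E n (f : E -> 'M[R]_n) x : sm x f -> f x \in unitmx ->
  sm x (fun y => invmx (f y)).
Proof.
move=> fx; rewrite unitmxE unitfE => d0.
have dx := sm_det fx.
apply: (@sm_ext _ _ _ (fun y => (\det (f y))^-1 *: \adj (f y))).
  have := sm_cont dx; rewrite /prop_for /continuous_at => /cvgr_neq0/(_ d0).
  by apply: filterS => y dy; rewrite /invmx unitmxE unitfE dy.
apply: sm_scale; first exact: sm_inv.
apply: sm_mx => i j.
apply: (@sm_ext _ _ _ (fun y => (-1) ^+ (j + i) * \det (row' j (col' i (f y))) : R^o)).
  by near=> y; rewrite !mxE.
apply: sm_mul; first exact: sm_cst.
apply: sm_det; apply: sm_mx => k l.
apply: (@sm_ext _ _ _ (fun y => f y (lift j k) (lift i l) : R^o)).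
  by near=> y; rewrite !mxE.
exact: sm_coord.
Unshelve. all: by end_near. Qed.

Lemma near_ball (V : normedModType R) (P : V -> Prop) (x : V) : (\forall y \near x, P y) ->
  exists2 d : R, 0 < d & forall y, `|y - x| < d -> P y.
Proof.
move=> /nbhs_normP[d /= d0 h]; exists d => // y yx; apply: h.
by rewrite /ball_ /= distrC.
Qed.

Lemma ball_near (V : normedModType R) (x : V) (d : R) : 0 < d ->
  \forall y \near x, `|y - x| < d.
Proof. by move=> d0; apply/nbhs_normP; exists d => //= y; rewrite /ball_ /= distrC. Qed.

Lemma segment_ball (V : normedModType R) (c x w : V) (d t : R) :
  `|x - c| <= d -> `|x + w - c| <= d -> 0 <= t <= 1 -> `|x + t *: w - c| <= d.
Proof.
move=> h1 h2 /andP[t0 t1].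
have -> : x + t *: w - c = (1 - t) *: (x - c) + t *: (x + w - c).
  by rewrite [x + w - c]addrAC scalerBl scale1r [t *: (_ + w)]scalerDr addrA subrK addrAC.
apply: le_trans (ler_normD _ _) _; rewrite !normrZ (ger0_norm t0) ger0_norm ?subr_ge0 //.
have ha : (1 - t) * `|x - c| <= (1 - t) * d by rewrite ler_wpM2l // subr_ge0.
have hb : t * `|x + w - c| <= t * d by rewrite ler_wpM2l.
by apply: le_trans (lerD ha hb) _; rewrite -mulrDl subrK mul1r.
Qed.

(** Banach's theorem for [y + r x] on the closed ball: half of the radius is spent on the
    displacement of y, half on the contraction. *)
Lemma contraction_solve n (r : 'rV[R]_n -> 'rV[R]_n) (c y : 'rV[R]_n) (d : R) : 0 <= d ->
  (forall x x', `|x - c| <= d -> `|x' - c| <= d -> `|r x - r x'| <= 2^-1 * `|x - x'|) ->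
  `|y - (c - r c)| <= d / 2 -> exists2 x, `|x - c| <= d & x = y + r x.
Proof.
move=> d0 rL yc.
pose U := [set x : 'rV[R]_n | `|x - c| <= d].
have cU : U c by rewrite /U /= subrr normr0.
have fU : set_fun U U (fun x => y + r x).
  move=> x Ux; rewrite /U /=.
  have -> : y + r x - c = (y - (c - r c)) + (r x - r c).
    by apply/rowP => i; rewrite !mxE; ring.
  apply: le_trans (ler_normD _ _) _; rewrite [leRHS]splitr lerD //.
  apply: le_trans (rL _ _ Ux cU) _; rewrite mulrC ler_pM2r ?invr_gt0 //; exact: Ux.
pose fM := isFun.Build _ _ U U (fun x => y + r x) fU.
pose f : {fun U >-> U} := HB.pack (fun x => y + r x) fM.
have q0 : (0 : R) <= 2^-1 by rewrite invr_ge0.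
have ctr : is_contraction f.
  exists (NngNum q0); split=> /=; first by rewrite invf_lt1 // ltr1n.
  move=> [x x'] [/= Ux Ux'] /=.
  by rewrite opprD addrACA subrr add0r; exact: rL.
have cl : closed U.
  have -> : U = (fun x => `|x - c|) @^-1` [set t : R | t <= d] by [].
  apply: closed_comp; last exact: closed_le.
  move=> x _; apply: continuous_comp; last exact: norm_continuous.
  exact: (sm_cont (sm_sub (sm_id x) (sm_cst c x))).
have [|x Ux xE] := banach_fixed_point ctr cl; first by exists c.
by exists x.
Qed.

Lemma linear_row_mx m n (L : 'rV[R]_m -> 'rV[R]_n) (v : 'rV[R]_m) : linear L ->
  L v = v *m (\matrix_i L (delta_mx 0 i)).
Proof.
move=> /linear_pack[g ->]; rewrite {1}[v]row_sum_delta linear_sum mulmx_sum_row.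
by apply: eq_bigr => i _; rewrite linearZ rowK.
Qed.

(** With the derivative at c equal to the identity, [r] is 1/2-Lipschitz on a small ball: equations
    [F x = y] become fixed point problems, and F shrinks distances at most by a factor 2. The
    inverse is thus Lipschitz, from which its differentiability follows. *)
Lemma inverse_function n (F : 'rV[R]_n -> 'rV[R]_n) (c : 'rV[R]_n) :
  sm c F -> (forall v, 'd F c v = v) ->
  exists Fi, [/\ sm (F c) Fi, \forall y \near F c, F (Fi y) = y
    & \forall x \near c, Fi (F x) = x].
Proof.
move=> Fc dF; pose r x := x - F x.
have rc : sm c r by apply: sm_sub => //; exact: sm_id.
have dr z v : sm z F -> 'd r z v = v - 'd F z v.
  by move=> Fz; apply: der_d; apply: der_sub; [exact: der_id|exact: sm_der].
have dr0 : 'd r c = (fun=> 0) :> ('rV[R]_n -> _).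
  by apply/funext => v; rewrite dr // dF subrr.
have h2 : (0 : R) < 2^-1 by rewrite invr_gt0.
have [d1 d10 hd] := near_ball (filterI (small_opnorm (findim_mx _ _) rc dr0 h2) (sm_near Fc)).
(* The estimates hold on an open ball of radius [d1]; halving it allows closed balls. *)
pose d := d1 / 2; have d0 : 0 < d by rewrite divr_gt0.
have dd1 : d < d1 by rewrite /d; lra.
have inb z : `|z - c| <= d -> (forall w, `|'d r z w| <= 2^-1 * `|w|) /\ sm z F.
  by move=> zc; apply: hd; apply: le_lt_trans dd1.
have rL x x' : `|x - c| <= d -> `|x' - c| <= d -> `|r x - r x'| <= 2^-1 * `|x - x'|.
  move=> xc xc'.
  have E1 : x = x' + (x - x') by rewrite addrC subrK.
  rewrite {1}E1; apply: mean_value_le; first by rewrite mulr_ge0 // ltW.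
    move=> t tI; have [] := inb (x' + t *: (x - x')).
      by apply: segment_ball => //; rewrite -E1.
    by move=> _ Fz; apply: sm_diff; apply: sm_sub => //; exact: sm_id.
  move=> t tI; have [|h _] := inb (x' + t *: (x - x')); last exact: h.
  by apply: segment_ball => //; rewrite -E1.
have FL x x' : `|x - c| <= d -> `|x' - c| <= d -> `|x - x'| <= 2 * `|F x - F x'|.
  move=> xc xc'; have h := rL x x' xc xc'.
  have : `|x - x'| <= `|r x - r x'| + `|F x - F x'|.
    have -> : x - x' = (r x - r x') + (F x - F x').
      by apply/rowP => i; rewrite !mxE; ring.
    exact: ler_normD.
  lra.
have ex y : `|y - F c| <= d / 2 -> exists x, `|x - c| <= d /\ F x = y.
  move=> yc; have [|x xc xE] := @contraction_solve n r c y d (ltW d0) rL.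
    by rewrite /r subKr.
  exists x; split=> //; apply: (addrI (r x)).
  by rewrite {1}/r subrK {1}xE addrC.
(* Outside the ball the inverse takes the default value 0. *)
have /choice[Fi FiP] : forall y, exists x, `|y - F c| <= d / 2 -> `|x - c| <= d /\ F x = y.
  move=> y; case: (pselect (`|y - F c| <= d / 2)) => [/ex[x xP]|n0]; first by exists x.
  by exists 0 => /n0.
pose V := [set y | `|y - F c| < d / 2].
have Vo : open V.
  have -> : V = ball (F c) (d / 2).
    by apply/funext => y; rewrite /V -ball_normE /ball_ /= distrC.
  exact: ball_open.
have Vc : V (F c) by rewrite /V /= subrr normr0 divr_gt0.
have VF y : V y -> [/\ `|Fi y - c| < d, F (Fi y) = y & sm (Fi y) F].
  move=> Vy; have [h1 h3] := FiP y (ltW Vy); split=> //; last by have [] := inb _ h1.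
  have := FL (Fi y) c h1; rewrite subrr normr0 h3 => /(_ (ltW d0)); move: Vy; rewrite /V /=.
  lra.
have FiL y y' : V y -> V y' -> `|Fi y - Fi y'| <= 2 * `|y - y'|.
  move=> Vy Vy'; have [h1 h3 _] := VF _ Vy; have [h1' h3' _] := VF _ Vy'.
  by have := FL _ _ (ltW h1) (ltW h1'); rewrite h3 h3'.
pose J z := \matrix_(i < n) 'd F z (delta_mx 0 i).
have JE z v : 'd F z v = v *m J z by apply: linear_row_mx; exact: linearP.
have Ju z : `|z - c| <= d -> J z \in unitmx.
  move=> zc; rewrite -row_free_unit; apply/inj_row_free => v; rewrite -JE => dv.
  have [h Fz] := inb z zc; have := h v; rewrite dr // dv subr0 => h3.
  by apply/eqP; rewrite -normr_le0; lra.
have Jsm z : sm z F -> sm z J.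
  move=> Fz; apply: sm_mx => i j.
  apply: (@sm_ext _ _ _ (fun y => 'd F y (delta_mx 0 i) 0 j : R^o)).
    by near=> y; rewrite /J mxE.
  apply: sm_coord; apply: (sm_d (p := fun y => y)) => //; [exact: sm_id|exact: sm_cst].
have dFi y v : V y -> der Fi y v (v *m invmx (J (Fi y))).
  move=> Vy; have [h1 h3 h4] := VF _ Vy.
  pose g w := w *m invmx (J (Fi y)) : 'rV[R]_n.
  have gl : linear g by move=> a u w; rewrite /g mulmxDl scalemxAl.
  have gc : continuous g by apply: findim_continuous.
  apply: (der_of (g := g)); apply: (diff_normP _ _ gl gc).1 => e e0.
  have [k k0 gk] : exists2 k : R, 0 < k & forall w, `|g w| <= k * `|w|.
    by have [G GE] := linear_pack gl; rewrite GE in gc *; exact: linear_lipschitz.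
  (* The inverse Jacobian costs a factor k and the Lipschitz bound of [Fi] a factor 2. *)
  have e1 : 0 < e / (2 * k) by rewrite divr_gt0 // mulr_gt0.
  have FcFi : continuous ('d F (Fi y)) by apply: diff_continuous; exact: sm_diff.
  have := (diff_normP F (Fi y) (linearP _) FcFi).2 (conj (sm_diff h4) erefl) _ e1.
  move=> /near_ball[d2 d20 hd2].
  have d22 : 0 < d2 / 2 by rewrite divr_gt0.
  near=> y'.
  have Vy' : V y' by near: y'; exact: (open_near Vo Vy).
  have [h1' h3' h4'] := VF _ Vy'.
  have yy' : `|y' - y| < d2 / 2 by near: y'; exact: (ball_near y d22).
  have L := FiL _ _ Vy' Vy.
  have := hd2 (Fi y'); rewrite h3 h3' => /(_ _) E1.
  have {}E1 : `|y' - y - 'd F (Fi y) (Fi y' - Fi y)| <= e / (2 * k) * `|Fi y' - Fi y|.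
    by apply: E1; lra.
  have -> : Fi y' - Fi y - g (y' - y) = - g (y' - y - 'd F (Fi y) (Fi y' - Fi y)).
    by rewrite JE /g [in RHS]mulmxBl mulmxK ?opprB //; apply: Ju; exact: ltW.
  rewrite normrN; apply: le_trans (gk _) _.
  have E2 : e / (2 * k) * `|Fi y' - Fi y| <= e / (2 * k) * (2 * `|y' - y|).
    by rewrite ler_wpM2l // ltW.
  have := ler_wpM2l (ltW k0) (le_trans E1 E2) => /le_trans; apply.
  by rewrite (_ : k * _ = e * `|y' - y|) //; field; rewrite gt_eqF.
exists Fi; split.
(* Bootstrapping: the derivative of [Fi] is a smooth function composed with [Fi], so class C^k of
   [Fi] gives class C^(k+1). *)
- exists V; split=> //; elim=> [|k IH].
    move=> y Vy; apply: differentiable_continuous; by have [] := dFi y 0 Vy.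
  split=> [y Vy|v]; first by have [] := dFi y 0 Vy.
  apply: (Ck_ext (f := fun y => v *m invmx (J (Fi y)))) => //.
    by move=> y Vy; rewrite (der_D (dFi y v Vy)).
  pose U := [set z | `|z - c| < d].
  have Uo : open U.
    have -> : U = ball c d.
      by apply/funext => y; rewrite /U -ball_normE /ball_ /= distrC.
    exact: ball_open.
  apply: (Ck_comp (V := U) (g := fun z => v *m invmx (J z))) => //.
    by move=> _ [y Vy <-]; have [] := VF y Vy.
  apply: sm_smooth => z Uz; have [_ Fz] := inb z (ltW Uz).
  apply: (sm_lin (L := fun M => v *m M)); first by move=> a A B; rewrite mulmxDr scalemxAr.
  by apply: sm_invmx; [exact: Jsm|apply: Ju; exact: ltW].
- by apply: filterS (open_near Vo Vc) => y /VF[].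
- have := sm_near_set Fc Vo Vc.
  apply: filterS2 (ball_near c d0) => x xc Vx.
  have [h1 h3 _] := VF _ Vx.
  apply/eqP; rewrite -subr_eq0 -normr_le0.
  by have := FL _ _ (ltW h1) (ltW xc); rewrite h3 subrr normr0 mulr0.
Unshelve. all: by end_near. Qed.

End MeanValue.

(** * Smooth plots of a manifold and their velocities *)

Section Plots.
Context {R : realType}.
Implicit Types E F K : normedModType R.

(** The local half of [is_manifold], in terms of germs; [atlas_manifold] adds separation and
    countability. *)
Definition is_atlas (M : Type) E (A : atlas M E) : Prop :=
  [/\ forall x, cdom (A x) x,
      forall x y, cdom (A x) y -> cinv (A x) (cmap (A x) y) = y &
      forall x y z, cdom (A x) z -> cdom (A y) z ->
        (\forall e \near cmap (A x) z,
          cdom (A x) (cinv (A x) e) /\ cdom (A y) (cinv (A x) e) /\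
          cmap (A x) (cinv (A x) e) = e) /\
        sm (cmap (A x) z) (fun e => cmap (A y) (cinv (A x) e))].

Lemma manifold_atlas (M : Type) E (A : atlas M E) : is_manifold A -> is_atlas A.
Proof.
move=> [A1 A2 A3 _ _]; split=> // x y z xz yz.
have [Do Ds] := A3 x y.
have Dz : (cmap (A x) @` (cdom (A x) `&` cdom (A y))) (cmap (A x) z) by exists z.
split; last exact: smI Do Ds Dz.
apply: filterS (open_near Do Dz) => _ [w [xw yw] <-].
by rewrite A2.
Qed.

Section OneAtlas.
Context {M : Type} {E : normedModType R} (A : atlas M E).
Hypothesis Aa : is_atlas A.
Hypothesis Ef : findim E.
Implicit Type p : forall K : normedModType R, K -> M.

Let A1 := let: And3 h _ _ := Aa in h.
Let A2 := let: And3 _ h _ := Aa in h.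

Lemma atlas_near x z : cdom (A x) z -> \forall e \near cmap (A x) z,
  cdom (A x) (cinv (A x) e) /\ cmap (A x) (cinv (A x) e) = e.
Proof.
by move=> xz; have [_ _ /(_ x x z xz xz)[+ _]] := Aa; apply: filterS => e [? [_ ?]].
Qed.

Lemma cmapK x : cinv (A x) (cmap (A x) x) = x.
Proof. exact: A2. Qed.

(** The chart centred at [p k] is the one whose components encode tangent vectors at [p k], so that
    [vel] below is a tangent vector in this encoding. *)
Definition psm K (p : K -> M) (k : K) : Prop :=
  (\forall k' \near k, cdom (A (p k)) (p k')) /\ sm k (fun k' => cmap (A (p k)) (p k')).

Definition vel K (p : K -> M) (k v : K) : E := 'd (fun k' => cmap (A (p k)) (p k')) k v.

(** With the converse [psm_of_chart], smoothness of a plot is independent of the chart. *)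
Lemma psm_in_chart K (p : K -> M) k x : psm p k -> cdom (A x) (p k) ->
  (\forall k' \near k, cdom (A x) (p k')) /\ sm k (fun k' => cmap (A x) (p k')).
Proof.
move=> [pk ps] xp; have [_ _ /(_ (p k) x (p k) (A1 _) xp)[h1 h2]] := Aa.
have h : \forall k' \near k, cdom (A x) (p k') /\
    cmap (A x) (cinv (A (p k)) (cmap (A (p k)) (p k'))) = cmap (A x) (p k').
  have := sm_cont ps; rewrite /prop_for /continuous_at => /(_ _ h1).
  apply: filterS2 pk => k' pk' /= [_ [+ _]].
  by rewrite A2.
split; first by apply: filterS h => k' [].
apply: (sm_ext (f := fun k' => cmap (A x) (cinv (A (p k)) (cmap (A (p k)) (p k'))))).
  by apply: filterS h => k' [].
exact: (sm_comp Ef ps h2).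
Qed.

Lemma psm_of_chart K (p : K -> M) k x :
  (\forall k' \near k, cdom (A x) (p k')) -> sm k (fun k' => cmap (A x) (p k')) ->
  psm p k.
Proof.
move=> pk ps; have xp := nbhs_singleton pk.
have [_ _ /(_ x (p k) (p k) xp (A1 _))[h1 h2]] := Aa.
have h : \forall k' \near k, cdom (A (p k)) (p k') /\
    cmap (A (p k)) (cinv (A x) (cmap (A x) (p k'))) = cmap (A (p k)) (p k').
  have := sm_cont ps; rewrite /prop_for /continuous_at => /(_ _ h1).
  apply: filterS2 pk => k' pk' /= [_ [+ _]].
  by rewrite A2.
split; first by apply: filterS h => k' [].
apply: (sm_ext (f := fun k' => cmap (A (p k)) (cinv (A x) (cmap (A x) (p k'))))).
  by apply: filterS h => k' [].
exact: (sm_comp Ef ps h2).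
Qed.

Lemma psm_near K (p : K -> M) k : psm p k -> \forall k' \near k, psm p k'.
Proof.
move=> [pk ps]; have := sm_near ps; move: pk => /near_join.
by apply: filterS2 => k'; exact: psm_of_chart.
Qed.

Lemma vel_ext K (p q : K -> M) k v : (\forall k' \near k, p k' = q k') -> psm p k ->
  vel p k v = vel q k v.
Proof.
move=> pq [pk ps]; have pqk := nbhs_singleton pq; rewrite /vel -pqk.
apply/esym; apply: der_d; apply: der_near (sm_der v ps).
by apply: filterS pq => k' ->.
Qed.

Lemma psm_comp K K' (p : K -> M) (g : K' -> K) k : findim K ->
  psm p (g k) -> sm k g -> psm (fun k' => p (g k')) k.
Proof.
move=> Kf [pk ps] gk; split; last exact: (sm_comp Kf gk ps).
exact: (sm_cont gk pk).
Qed.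

Lemma vel_comp K K' (p : K -> M) (g : K' -> K) k v : psm p (g k) -> sm k g ->
  vel (fun k' => p (g k')) k v = vel p (g k) ('d g k v).
Proof.
move=> [pk ps] gk; apply: der_d.
exact: (der_comp (sm_der v gk) (sm_der _ ps)).
Qed.

Lemma vel_der K (p : K -> M) k v : psm p k ->
  der (fun k' => cmap (A (p k)) (p k')) k v (vel p k v).
Proof. by move=> [_ /sm_der]; exact. Qed.

Lemma psm_cst K (x : M) (k : K) : psm (fun=> x) k.
Proof. by split; [apply: nearW => _; exact: A1|exact: sm_cst]. Qed.

Lemma vel_cst K (x : M) (k v : K) : vel (fun=> x) k v = 0.
Proof. exact: der_d (der_cst _ _ _). Qed.

Lemma psm_cinv x z : cdom (A x) z -> psm (cinv (A x)) (cmap (A x) z).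
Proof.
move=> xz; apply: (psm_of_chart (x := x)).
  by apply: filterS (atlas_near xz) => e [].
apply: (sm_ext (f := fun e => e)); last exact: sm_id.
by apply: filterS (atlas_near xz) => e [].
Qed.

Lemma psm_cinv0 x : psm (cinv (A x)) (cmap (A x) x).
Proof. exact: psm_cinv. Qed.

Lemma vel_cinv0 x v : vel (cinv (A x)) (cmap (A x) x) v = v.
Proof.
rewrite /vel cmapK; apply: der_d; apply: der_near (der_id _ _).
by apply: filterS (atlas_near (A1 x)) => e [_ ->].
Qed.

(** Components computed in an off-centre chart are corrected by [tinv], itself a velocity of the
    inverse chart. *)
Lemma vel_chart K (p : K -> M) k x v : psm p k -> cdom (A x) (p k) ->
  vel p k v = tinv A x (cmap (A x) (p k)) ('d (fun k' => cmap (A x) (p k')) k v).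
Proof.
move=> pk xp; have [pk' ps] := psm_in_chart pk xp.
rewrite -[tinv _ _ _]/(vel (cinv (A x)) (cmap (A x) (p k))).
rewrite -(@vel_comp _ _ (cinv (A x)) (fun k' => cmap (A x) (p k'))) //; last exact: psm_cinv.
apply: vel_ext => //.
by apply: filterS pk' => k' xk'; rewrite A2.
Qed.

Lemma mopen_plot K (p : K -> M) k U : psm p k -> mopen A U -> U (p k) ->
  \forall k' \near k, U (p k').
Proof.
move=> [pk ps] /(_ (p k)) Uo Up.
have : (cmap (A (p k)) @` (U `&` cdom (A (p k)))) (cmap (A (p k)) (p k)).
  by exists (p k).
move=> /(sm_near_set ps Uo); apply: filterS2 pk => k' pk' [y [Uy ydom] E1].
by rewrite -(A2 pk') -E1 A2.
Qed.

Lemma mopenP U : (forall x, U x -> \forall e \near cmap (A x) x, U (cinv (A x) e)) <->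
  mopen A U.
Proof.
split=> [h x|Uo x Ux]; last first.
  by apply: mopen_plot => //; [exact: psm_cinv0|rewrite cmapK].
rewrite openE => _ [y [Uy xy] <-]; rewrite /interior /=.
have [_ _ /(_ x y y xy (A1 y))[h1 h2]] := Aa.
have := sm_cont h2; rewrite /prop_for /continuous_at A2 // => /(_ _ (h y Uy)).
apply: filterS2 h1 => e [xe [ye eE]] /= Ue.
by exists (cinv (A x) e) => //; split=> //; rewrite A2 in Ue.
Qed.

Lemma mopen_chart x (O : set E) : open O -> mopen A (cdom (A x) `&` cmap (A x) @^-1` O).
Proof.
move=> Oo; apply/mopenP => y [xy Oy].
have [h1 h2] := psm_in_chart (psm_cinv0 y) (x := x) (eq_ind_r _ xy (cmapK y)).
have Oy' : O (cmap (A x) (cinv (A y) (cmap (A y) y))) by rewrite cmapK.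
by have := sm_near_set h2 Oo Oy'; apply: filterS2 h1.
Qed.

End OneAtlas.

Section Maps.
Context {M N : Type} {E F : normedModType R} (A : atlas M E) (B : atlas N F).
Hypotheses (Aa : is_atlas A) (Ba : is_atlas B) (Ef : findim E) (Ff : findim F).

Lemma smooth_psm K (f : M -> N) (p : K -> M) k :
  smooth A B f -> psm A p k -> psm B (fun k' => f (p k')) k.
Proof.
move=> /(_ (p k))[W [Wo Wk Wd fW fs]] [pk ps].
have h := sm_near_set ps Wo Wk.
have cK : \forall k' \near k, cinv (A (p k)) (cmap (A (p k)) (p k')) = p k'.
  by apply: filterS pk => k'; have [_ + _] := Aa; exact.
split; first by apply: filterS2 h cK => k' /fW + E1; rewrite E1.
apply: (sm_ext (f := fun k' => local_rep A B f (p k) (cmap (A (p k)) (p k')))).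
  by apply: filterS cK => k' E1; rewrite /local_rep /= E1.
exact: (sm_comp Ef ps (smI Wo fs Wk)).
Qed.

Lemma smooth_local_rep (f : M -> N) x : smooth A B f ->
  sm (cmap (A x) x) (local_rep A B f x).
Proof. by move=> /(_ x)[W [Wo Wk Wd fW fs]]; exact: smI fs Wk. Qed.

Lemma tmapE (f : M -> N) x v : tmap A B f x v = vel B (fun e => f (cinv (A x) e)) (cmap (A x) x) v.
Proof. by rewrite /vel cmapK. Qed.

(** The way to evaluate a tangent map: realise the vector as the velocity of a plot and push the
    plot forward. *)
Lemma tmap_vel K (f : M -> N) (p : K -> M) k v : smooth A B f -> psm A p k ->
  tmap A B f (p k) (vel A p k v) = vel B (fun k' => f (p k')) k v.
Proof.
move=> fs pk; have [pk1 pk2] := pk.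
apply/esym/der_d.
have := der_comp (sm_der v pk2) (sm_der _ (smooth_local_rep (p k) fs)).
apply: der_near; apply: filterS pk1 => k' pk'.
by have [_ A2 _] := Aa; rewrite /local_rep /= A2.
Qed.

Lemma tmap_linear (f : M -> N) x : linear (tmap A B f x).
Proof. exact: linearP. Qed.

(** Inverse charts are universal plots, so smoothness need only be tested on them. *)
Lemma psm_smooth (f : M -> N) :
  (forall x, psm B (fun e => f (cinv (A x) e)) (cmap (A x) x)) -> smooth A B f.
Proof.
move=> h x; have [h1 [V [Vo Vx fV]]] := h x; rewrite cmapK // in h1 fV.
have hx : \forall e \near cmap (A x) x,
    [/\ V e, cdom (B (f x)) (f (cinv (A x) e)) & (cmap (A x) @` cdom (A x)) e].
  near=> e; split.
  - by near: e; exact: open_near.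
  - by near: e.
  - have [xe E1] : cdom (A x) (cinv (A x) e) /\ cmap (A x) (cinv (A x) e) = e.
      by near: e; apply: atlas_near => //; have [] := Aa.
    by exists (cinv (A x) e).
have [W [Wo Wx WV]] := near_open hx.
exists W; split=> //; first by move=> e /WV[].
  by move=> e /WV[].
move=> k; apply: Ck_sub (fV k) => e /WV[].
by [].
Unshelve. all: by end_near. Qed.

Lemma smooth_mopen (f : M -> N) V : smooth A B f -> mopen B V -> mopen A (f @^-1` V).
Proof.
move=> fs Vo; apply/mopenP => // x Vx.
have := smooth_psm fs (psm_cinv0 Aa Ef x).
move=> /(mopen_plot Ba)-/(_ _ Vo); apply.
by rewrite cmapK.
Qed.

End Maps.

Section VecAtlas.
Context {E : normedModType R}.

Lemma vec_is_atlas : is_atlas (vec_atlas E).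
Proof.
split=> // x y z _ _ /=; split; first exact: nearW.
exact: sm_id.
Qed.

Lemma psm_vec K (p : K -> E) k : psm (vec_atlas E) p k <-> sm k p.
Proof. by split=> [[]|pk] //; split=> //=; exact: nearW. Qed.

Lemma mopen_vec (U : set E) : mopen (vec_atlas E) U <-> open U.
Proof.
rewrite /mopen /= setIT; split=> [/(_ 0)|h _]; by rewrite image_id.
Qed.

Lemma smooth_vecP F (f : E -> F) :
  smooth (vec_atlas E) (vec_atlas F) f <-> forall x, sm x f.
Proof.
split=> [h x|h x].
  by have [W [Wo Wx _ _ Ws]] := h x; exact: (smI Wo Ws Wx).
have [W [Wo Wx fW]] := h x; exists W; split=> //.
by rewrite image_id.
Qed.

End VecAtlas.

Section ProdAtlas.
Context {M N : Type} {E F : normedModType R} (A : atlas M E) (B : atlas N F).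
Hypotheses (Aa : is_atlas A) (Ba : is_atlas B) (Ef : findim E) (Ff : findim F).

Lemma near_fst (P : E -> Prop) (e : E * F) :
  (\forall x \near e.1, P x) -> \forall x \near e, P x.1.
Proof. by move=> h; have := @cvg_fst _ _ (nbhs e.1) (nbhs e.2); apply. Qed.

Lemma near_snd (P : F -> Prop) (e : E * F) :
  (\forall x \near e.2, P x) -> \forall x \near e, P x.2.
Proof. by move=> h; have := @cvg_snd _ _ (nbhs e.1) (nbhs e.2); apply. Qed.

Lemma sm_fst K (f : K -> E * F) k : sm k f -> sm k (fun x => (f x).1).
Proof. by apply: (sm_lin (L := fst)). Qed.

Lemma sm_snd K (f : K -> E * F) k : sm k f -> sm k (fun x => (f x).2).
Proof. by apply: (sm_lin (L := snd)). Qed.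

Lemma der_fst K (f : K -> E * F) k v w : der f k v w -> der (fun x => (f x).1) k v w.1.
Proof. by apply: (der_lin (L := fst)). Qed.

Lemma der_snd K (f : K -> E * F) k v w : der f k v w -> der (fun x => (f x).2) k v w.2.
Proof. by apply: (der_lin (L := snd)). Qed.

Lemma prod_is_atlas : is_atlas (prod_atlas A B).
Proof.
have [A1 A2 A3] := Aa; have [B1 B2 B3] := Ba; split=> [x|x [y y'] /= [h1 h2]|].
- by split; [exact: A1|exact: B1].
- by rewrite A2 ?B2.
move=> [x x'] [y y'] [z z'] /= [/= xz xz'] [/= yz yz'].
have [a1 a2] := A3 x y z xz yz; have [b1 b2] := B3 x' y' z' xz' yz'; split.
  have c1 := @near_fst _ (cmap (A x) z, cmap (B x') z') a1.
  have c2 := @near_snd _ (cmap (A x) z, cmap (B x') z') b1.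
  by apply: filterS2 c1 c2 => -[e e'] /= [? [? ->]] [? [? ->]].
set ee := (cmap (A x) z, _).
have i1 : sm ee fst by apply: (sm_fst (f := fun e => e)); exact: sm_id.
have i2 : sm ee snd by apply: (sm_snd (f := fun e => e)); exact: sm_id.
apply: sm_pair.
  exact: (sm_comp (g := fun e => cmap (A y) (cinv (A x) e)) Ef i1 a2).
exact: (sm_comp (g := fun e => cmap (B y') (cinv (B x') e)) Ff i2 b2).
Qed.

Lemma psm_prod K (p : K -> M * N) k :
  psm (prod_atlas A B) p k <-> psm A (fun k' => (p k').1) k /\ psm B (fun k' => (p k').2) k.
Proof.
split=> [[h1 h2]|[[a1 a2] [b1 b2]]].
  split; split.
  - by apply: filterS h1 => k' [].
  - exact: (sm_fst h2).
  - by apply: filterS h1 => k' [].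
  - exact: (sm_snd h2).
split; first by apply: filterS2 a1 b1.
exact: sm_pair.
Qed.

Lemma vel_prod K (p : K -> M * N) k v : psm (prod_atlas A B) p k ->
  vel (prod_atlas A B) p k v = (vel A (fun k' => (p k').1) k v, vel B (fun k' => (p k').2) k v).
Proof.
move=> /psm_prod[[a1 a2] [b1 b2]]; apply: der_d.
by apply: der_pair; exact: sm_der.
Qed.

End ProdAtlas.
End Plots.

(** * Partial derivatives and their symmetries on the diagonal *)

Section Partial.
Context {R : realType}.
Implicit Types E F K H : normedModType R.

Lemma der_scalec E F (a : R) (h : E -> F) x v w : der h x v w ->
  der (fun y => a *: h y) x v (a *: w).
Proof.
by move=> hw; have := der_scale (der_cst (a : R^o) x v) hw; rewrite scale0r add0r.
Qed.

Lemma sm_pfst E F (q : E * F) : findim E -> findim F -> sm q fst.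
Proof. by move=> Ef Ff; exact: (sm_fst Ef Ff (sm_id q)). Qed.

Lemma sm_psnd E F (q : E * F) : findim E -> findim F -> sm q snd.
Proof. by move=> Ef Ff; exact: (sm_snd Ef Ff (sm_id q)). Qed.

Lemma psm_pfst (M : Type) E F K (A : atlas M E) (p : F -> M) (q : F * K) :
  findim F -> findim K -> psm A p q.1 -> psm A (fun q => p q.1) q.
Proof. by move=> Ff Kf pq; apply: (psm_comp (g := fst)) => //; exact: sm_pfst. Qed.

Lemma psm_psnd (M : Type) E F K (A : atlas M E) (p : K -> M) (q : F * K) :
  findim F -> findim K -> psm A p q.2 -> psm A (fun q => p q.2) q.
Proof. by move=> Ff Kf pq; apply: (psm_comp (g := snd)) => //; exact: sm_psnd. Qed.

Lemma sm_incl1 E F (a : E) (b : F) : sm a (fun a' => (a', b)).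
Proof. by apply: sm_pair; [exact: sm_id|exact: sm_cst]. Qed.

Lemma sm_incl2 E F (a : E) (b : F) : sm b (fun b' => (a, b')).
Proof. by apply: sm_pair; [exact: sm_cst|exact: sm_id]. Qed.

Lemma der_partial1 E F H (P : E * F -> H) a b v : differentiable P (a, b) ->
  der (fun a' => P (a', b)) a v ('d P (a, b) (v, 0)).
Proof.
move=> dP; apply: (der_comp (f := fun a' => (a', b)) (w := (v, 0))); last exact: derE.
by apply: der_pair; [exact: der_id|exact: der_cst].
Qed.

Lemma der_partial2 E F H (P : E * F -> H) a b v : differentiable P (a, b) ->
  der (fun b' => P (a, b')) b v ('d P (a, b) (0, v)).
Proof.
move=> dP; apply: (der_comp (f := fun b' => (a, b')) (w := (0, v))); last exact: derE.
by apply: der_pair; [exact: der_cst|exact: der_id].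
Qed.

Lemma near_pull E F (f : E -> F) x (Q : F -> Prop) : sm x f ->
  (\forall y \near f x, Q y) -> \forall y \near x, Q (f y).
Proof. by move=> /sm_cont fx h; exact: fx. Qed.

Lemma near_incl1 E F (Q : E * F -> Prop) (a : E) (b : F) : (\forall p \near (a, b), Q p) ->
  \forall a' \near a, Q (a', b).
Proof. exact: (near_pull (sm_incl1 a b)). Qed.

Lemma near_incl2 E F (Q : E * F -> Prop) (a : E) (b : F) : (\forall p \near (a, b), Q p) ->
  \forall b' \near b, Q (a, b').
Proof. exact: (near_pull (sm_incl2 a b)). Qed.

(** The parameter enters the differentiated function itself; the partial derivative is the full one
    along [(0, w k')]. *)
Lemma sm_partial2 K E F (P : K * E -> F) (g : K -> E) (w : K -> E) k :
  findim K -> findim E -> sm (k, g k) P -> sm k g -> sm k w ->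
  sm k (fun k' => 'd (fun e => P (k', e)) (g k') (w k')).
Proof.
move=> Kf Ef Pk gk wk.
have pk : sm k (fun k' => (k', g k')) by apply: sm_pair => //; exact: sm_id.
apply: (sm_ext (f := fun k' => 'd P (k', g k') (0, w k'))).
  have := near_pull pk (sm_near Pk); apply: filterS => k' /= /sm_diff dP.
  exact/esym/(der_d (der_partial2 (w k') dP)).
apply: (sm_d (p := fun k' => (k', g k'))) => //.
by apply: sm_pair => //; exact: sm_cst.
Qed.

Lemma mixed_partial E F H (P : E * F -> H) a b v u : findim E -> findim F -> findim H ->
  sm (a, b) P ->
  'D_v (fun a' => 'd (fun b' => P (a', b')) b u) a =
  'D_u (fun b' => 'd (fun a' => P (a', b')) a v) b.
Proof.
move=> Ef Ff Hf Pab.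
have -> : 'D_v (fun a' => 'd (fun b' => P (a', b')) b u) a = 'D_(v, 0) ('D_(0, u) P) (a, b).
  rewrite (deriveE _ (sm_diff (sm_D _ Pab))); apply: der_D.
  apply: der_near (der_partial1 v (sm_diff (sm_D (0, u) Pab))).
  apply: filterS (near_incl1 (sm_near Pab)) => a' /sm_diff dP.
  by rewrite (deriveE _ dP) (der_d (der_partial2 u dP)).
have -> : 'D_u (fun b' => 'd (fun a' => P (a', b')) a v) b = 'D_(0, u) ('D_(v, 0) P) (a, b).
  rewrite (deriveE _ (sm_diff (sm_D _ Pab))); apply: der_D.
  apply: der_near (der_partial2 u (sm_diff (sm_D (v, 0) Pab))).
  apply: filterS (near_incl2 (sm_near Pab)) => b' /sm_diff dP.
  by rewrite (deriveE _ dP) (der_d (der_partial1 v dP)).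
exact: schwarz.
Qed.

(** The base point and the parameter move together; splitting [(u, u)] as [(u, 0) + (0, u)]
    separates their contributions. *)
Lemma diagonal_partial E H (P : E * E -> H) a v u : findim E -> findim H ->
  sm (a, a) P ->
  'D_u (fun b => 'd (fun a' => P (a', b)) b v) a =
  'D_(u, 0) ('D_(v, 0) P) (a, a) + 'D_u (fun b => 'd (fun a' => P (a', b)) a v) a.
Proof.
move=> Ef Hf Paa.
have dv := sm_diff (sm_D (v, 0) Paa).
have -> : 'D_u (fun b' => 'd (fun a' => P (a', b')) a v) a = 'D_(0, u) ('D_(v, 0) P) (a, a).
  rewrite (deriveE _ dv); apply: der_D.
  apply: der_near (der_partial2 u dv).
  apply: filterS (near_incl2 (sm_near Paa)) => b' /sm_diff dP.
  by rewrite (deriveE _ dP) (der_d (der_partial1 v dP)).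
have ds : sm a (fun a' : E => (a', a')) by apply: sm_pair; exact: sm_id.
rewrite !(deriveE _ dv) -linearD; apply: der_D.
have := der_comp (der_pair (der_id a u) (der_id a u)) (derE (u, u) dv).
rewrite -[(u, 0) + (0, u)]/(u + 0, 0 + u) addr0 add0r.
apply: der_near; have := near_pull ds (sm_near Paa); apply: filterS => b /= /sm_diff dP.
by rewrite (deriveE _ dP) (der_d (der_partial1 v dP)).
Qed.

(** Antisymmetrising kills the pure second derivative in the first slot, and Schwarz turns the rest
    into derivatives of the second-slot partial. This is the analytic half of the Maurer-Cartan
    equation, with [P (a, b)] equal to [p a * (p b)^-1]. *)
Lemma diagonal_antisym E H (P : E * E -> H) a v u : findim E -> findim H ->
  sm (a, a) P ->
  'D_u (fun b => 'd (fun a' => P (a', b)) b v) a -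
    'D_v (fun b => 'd (fun a' => P (a', b)) b u) a =
  'D_v (fun a' => 'd (fun b => P (a', b)) a u) a -
    'D_u (fun a' => 'd (fun b => P (a', b)) a v) a.
Proof.
move=> Ef Hf Paa; rewrite !diagonal_partial // (schwarz (v, 0) (u, 0) Hf Paa).
rewrite opprD addrACA subrr add0r; apply/esym.
exact: (congr2 (fun x y => x - y) (mixed_partial v u Ef Ef Hf Paa) (mixed_partial u v Ef Ef Hf Paa)).
Qed.

End Partial.

(** * Lie groups and the Maurer-Cartan equation *)

Section Lie.
Context {R : realType} {n : nat} {G : groupType} (A : atlas G 'rV[R]_n).
Hypothesis hG : lie_group A.
Implicit Types K : normedModType R.

Local Notation g := ('rV[R]_n).
Local Notation o := (cmap (A 1%g) 1%g).
Local Notation c1 := (cinv (A 1%g)).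

Lemma lie_atlas : is_atlas A.
Proof. by have [/manifold_atlas] := hG. Qed.

Let Aa := lie_atlas.
Let Ef : findim g := findim_mx _ _.

Lemma c1o : c1 o = 1%g.
Proof. exact: cmapK. Qed.

Lemma psmM K (p q : K -> G) k : psm A p k -> psm A q k -> psm A (fun k' => (p k' * q k')%g) k.
Proof.
move=> pk qk; have [_ ms _] := hG.
have AA := prod_is_atlas Aa Aa Ef Ef.
apply: (@smooth_psm _ _ _ _ _ _ _ AA _ _ (fun x : G * G => (x.1 * x.2)%g)
  (fun k' => (p k', q k')) k ms); exact/psm_prod.
Qed.

Lemma psmV K (p : K -> G) k : psm A p k -> psm A (fun k' => (p k')^-1%g) k.
Proof. by move=> pk; have [_ _ iv] := hG; exact: (smooth_psm Aa Ef iv pk). Qed.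

Lemma psm_c1 : psm A c1 o.
Proof. exact: psm_cinv0. Qed.

Lemma vel_c1 v : vel A c1 o v = v.
Proof. exact: vel_cinv0. Qed.

Lemma psm_sm1 K (p : K -> G) k x : psm A p k -> p k = x -> sm k (fun k' => cmap (A x) (p k')).
Proof. by move=> [_ ps] <-. Qed.

(* The velocity of the curve p transported to the identity by right translation *)
Definition rv K (p : K -> G) (k v : K) : g :=
  'd (fun k' => cmap (A 1%g) (p k' * (p k)^-1)%g) k v.

Lemma rvE K (p : K -> G) k v : rv p k v = vel A (fun k' => (p k' * (p k)^-1)%g) k v.
Proof. by rewrite /vel mulgV. Qed.

Lemma smooth_mulr x : smooth A A (fun h => (h * x)%g).
Proof. by apply: psm_smooth => // y; apply: psmM; [exact: psm_cinv0|exact: psm_cst]. Qed.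

Lemma smooth_conj x : smooth A A (fun h => (x * h * x^-1)%g).
Proof.
by apply: psm_smooth => // y; repeat apply: psmM; try exact: psm_cst; exact: psm_cinv0.
Qed.

Lemma rv_vel K (p : K -> G) k v : psm A p k ->
  rv p k v = tmap A A (fun h => h * (p k)^-1)%g (p k) (vel A p k v).
Proof. by move=> pk; rewrite rvE; apply/esym; exact: (tmap_vel Aa v (smooth_mulr _) pk). Qed.

Lemma rv_linear K (p : K -> G) k : linear (rv p k).
Proof. exact: linearP. Qed.

Lemma rv1 K (p : K -> G) k v : p k = 1%g -> rv p k v = vel A p k v.
Proof.
by move=> p1; rewrite rvE p1; congr (vel A _ k v); apply/funext => k'; rewrite invg1 mulg1.
Qed.

Lemma rv_cst K (x : G) (k v : K) : rv (fun=> x) k v = 0.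
Proof. by rewrite rvE vel_cst. Qed.

(** The derivative of multiplication at the identity is addition: each half of [(v, 0) + (0, w)] is
    the velocity of a pair with one constant factor. *)
Lemma velM1 K (p q : K -> G) k v : psm A p k -> psm A q k -> p k = 1%g -> q k = 1%g ->
  vel A (fun k' => (p k' * q k')%g) k v = vel A p k v + vel A q k v.
Proof.
move=> pk qk p1 q1; have [_ ms _] := hG.
pose m (x : G * G) := (x.1 * x.2)%g.
pose AA := prod_atlas A A.
have AAa : is_atlas AA by exact: prod_is_atlas.
have E1 (p' q' : K -> G) : psm A p' k -> psm A q' k -> p' k = 1%g -> q' k = 1%g ->
    vel A (fun k' => (p' k' * q' k')%g) k v = tmap AA A m (1%g, 1%g) (vel A p' k v, vel A q' k v).
  move=> p'k q'k p'1 q'1.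
  have pq' : psm AA (fun k' => (p' k', q' k')) k by exact/psm_prod.
  have := tmap_vel AAa v ms pq'.
  by rewrite (vel_prod Ef Ef v pq') p'1 q'1 => E1; exact: (esym E1).
have c0 : psm A (fun=> 1%g) k by exact: psm_cst.
have [L LE] := linear_pack (tmap_linear AA A m (1%g, 1%g)); rewrite LE in E1.
rewrite E1 //.
have -> : (vel A p k v, vel A q k v) = (vel A p k v, 0) + (0, vel A q k v) :> g * g.
  by rewrite -[RHS]/(_ + 0, 0 + _) addr0 add0r.
rewrite linearD.
have h1 := E1 p (fun=> 1%g) pk c0 p1 erefl; have h2 := E1 (fun=> 1%g) q c0 qk erefl q1.
have p1E : (fun k' => (p k' * 1)%g) = p by apply/funext => k'; rewrite mulg1.
have q1E : (fun k' => (1 * q k')%g) = q by apply/funext => k'; rewrite mul1g.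
have vc := vel_cst A 1%g k v.
rewrite p1E vc in h1; rewrite q1E vc in h2.
exact: (congr2 +%R (esym h1) (esym h2)).
Qed.

Lemma AdE x v : Ad A x v = vel A (fun e => (x * c1 e * x^-1)%g) o v.
Proof. by rewrite /Ad tmapE. Qed.

Lemma Ad_vel K (p : K -> G) k v x : psm A p k -> p k = 1%g ->
  vel A (fun k' => (x * p k' * x^-1)%g) k v = Ad A x (vel A p k v).
Proof. by move=> pk p1; rewrite -(tmap_vel Aa v (smooth_conj x) pk) p1. Qed.

Lemma Ad_linear x : linear (Ad A x).
Proof. exact: linearP. Qed.

(** The translated product is [P] times the conjugate of [Q] by [p k], two plots through the
    identity, where multiplication differentiates to addition. *)
Lemma rvM K (p q : K -> G) k v : psm A p k -> psm A q k ->
  rv (fun k' => (p k' * q k')%g) k v = rv p k v + Ad A (p k) (rv q k v).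
Proof.
move=> pk qk.
pose P k' := (p k' * (p k)^-1)%g; pose Q k' := (q k' * (q k)^-1)%g.
have Pk : psm A P k by apply: psmM => //; exact: psm_cst.
have Qk : psm A Q k by apply: psmM => //; exact: psm_cst.
have P1 : P k = 1%g by exact: mulgV.
have Q1 : Q k = 1%g by exact: mulgV.
pose Q' k' := (p k * Q k' * (p k)^-1)%g.
have Q'k : psm A Q' k by apply: psmM; [apply: psmM => //|]; exact: psm_cst.
have Q'1 : Q' k = 1%g by rewrite /Q' Q1 mulg1 mulgV.
rewrite !rvE -(Ad_vel v (p k) Qk Q1) -(velM1 v Pk Q'k P1 Q'1).
congr (vel A _ k v); apply/funext => k'.
by rewrite /P /Q' /Q invgM !mulgA mulgVK.
Qed.

Lemma Ad1 v : Ad A 1%g v = v.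
Proof.
rewrite AdE -[RHS]vel_c1; congr (vel A _ _ v); apply/funext => e.
by rewrite invg1 mulg1 mul1g.
Qed.

Lemma AdM x y v : Ad A (x * y)%g v = Ad A x (Ad A y v).
Proof.
rewrite [Ad A y v]AdE -Ad_vel; last 2 first.
- by apply: psmM; [apply: psmM|]; try exact: psm_cst; exact: psm_c1.
- by rewrite c1o mulg1 mulgV.
rewrite AdE; congr (vel A _ _ v); apply/funext => e.
by rewrite invgM !mulgA.
Qed.

Lemma AdK x v : Ad A x^-1%g (Ad A x v) = v.
Proof. by rewrite -AdM mulVg Ad1. Qed.

Lemma AdKV x v : Ad A x (Ad A x^-1%g v) = v.
Proof. by rewrite -AdM mulgV Ad1. Qed.

Lemma rvV K (p : K -> G) k v : psm A p k ->
  rv (fun k' => (p k')^-1%g) k v = - Ad A (p k)^-1%g (rv p k v).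
Proof.
move=> pk; apply/eqP; rewrite -addr_eq0 -rvM //; last exact: psmV.
rewrite -(rv_cst 1%g k v); apply/eqP; congr (rv _ k v).
by apply/funext => k'; rewrite mulVg.
Qed.

Lemma rv_mull K (p : K -> G) x k v : psm A p k ->
  rv (fun k' => (x * p k')%g) k v = Ad A x (rv p k v).
Proof. by move=> pk; rewrite (rvM _ (psm_cst Aa x k) pk) rv_cst add0r. Qed.

Lemma rv_mulr K (p : K -> G) x k v : psm A p k ->
  rv (fun k' => (p k' * x)%g) k v = rv p k v.
Proof.
move=> pk; rewrite (rvM _ pk (psm_cst Aa x k)) rv_cst.
by have [L ->] := linear_pack (Ad_linear (p k)); rewrite linear0 addr0.
Qed.

(** At a moving point [rv] is a partial derivative on the diagonal of a two-parameter map, always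
    read in the chart at the identity. *)
Lemma sm_rv K (p : K -> G) (w : K -> K) k : findim K -> psm A p k -> sm k w ->
  sm k (fun k' => rv p k' (w k')).
Proof.
move=> Kf pk wk.
apply: (@sm_partial2 _ K K g (fun q => cmap (A 1%g) (p q.2 * (p q.1)^-1)%g) (fun k' => k')) => //.
  apply: (@psm_sm1 _ (fun q : K * K => p q.2 * (p q.1)^-1)%g); last exact: mulgV.
  by apply: psmM; [exact: psm_psnd|apply: psmV; exact: psm_pfst].
exact: sm_id.
Qed.

Lemma AdE1 x v : Ad A x v = 'd (fun e => cmap (A 1%g) (x * c1 e * x^-1)%g) o v.
Proof. by rewrite AdE /vel c1o mulg1 mulgV. Qed.

Lemma sm_Ad K (p : K -> G) (w : K -> g) k : findim K -> psm A p k -> sm k w ->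
  sm k (fun k' => Ad A (p k') (w k')).
Proof.
move=> Kf pk wk.
have -> : (fun k' => Ad A (p k') (w k')) = (fun k' =>
    'd (fun e => cmap (A 1%g) (p k' * c1 e * (p k')^-1)%g) o (w k')).
  by apply/funext => k'; rewrite AdE1.
apply: (@sm_partial2 _ K g g (fun q => cmap (A 1%g) (p q.1 * c1 q.2 * (p q.1)^-1)%g) (fun=> o)) => //.
  have pk1 : psm A (fun q : K * g => p q.1) (k, o) by exact: psm_pfst.
  apply: (@psm_sm1 _ (fun q : K * g => p q.1 * c1 q.2 * (p q.1)^-1)%g).
    apply: psmM; last exact: psmV.
    apply: psmM => //; apply: psm_psnd => //; exact: psm_c1.
  by rewrite /= c1o mulg1 mulgV.
exact: sm_cst.
Qed.

Lemma smooth_Ad (w : g) : smooth A (vec_atlas g) (fun x => Ad A x w).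
Proof.
apply: psm_smooth => // x; apply/psm_vec.
apply: sm_Ad => //; [exact: psm_cinv0|exact: sm_cst].
Qed.

Lemma adE K (p : K -> G) k v w : psm A p k -> p k = 1%g ->
  'd (fun k' => Ad A (p k') w) k v = ad A (vel A p k v) w.
Proof.
move=> pk p1; rewrite /ad -{1}p1.
rewrite (tmap_vel Aa v (smooth_Ad w) pk); by [].
Qed.

(** Multiplicativity of [Ad] moves the base point to the identity, where the derivative is [ad] by
    definition. *)
Lemma der_Ad K (p : K -> G) k v w : findim K -> psm A p k ->
  der (fun k' => Ad A (p k') w) k v (ad A (rv p k v) (Ad A (p k) w)).
Proof.
move=> Kf pk.
have -> : (fun k' => Ad A (p k') w) =
    (fun k' => Ad A (p k' * (p k)^-1)%g (Ad A (p k) w)).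
  by apply/funext => k'; rewrite -AdM mulgVK.
have pk' : psm A (fun k' => p k' * (p k)^-1)%g k by apply: psmM => //; exact: psm_cst.
rewrite rvE -(adE _ _ pk' (mulgV _)).
by apply: sm_der; apply: sm_Ad => //; exact: sm_cst.
Qed.

Lemma ad_linearl w : linear (fun x => ad A x w).
Proof. exact: linearP. Qed.

Lemma der_Adc1 v w : der (fun e => Ad A (c1 e) w) o v (ad A v w).
Proof.
have := der_Ad v w Ef psm_c1.
by rewrite rv1 ?c1o // vel_c1 Ad1.
Qed.

Lemma ad_linearr v : linear (ad A v).
Proof.
move=> a w w'; rewrite -(der_d (der_Adc1 v (a *: w + w'))).
apply: der_d; have := der_add (der_scale (der_cst a o v) (der_Adc1 v w)) (der_Adc1 v w').
rewrite scale0r add0r; apply: der_near; near=> e.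
by rewrite Ad_linear.
Unshelve. all: by end_near. Qed.

(** Derivative in y, at the identity, of [Ad x (Ad y w) = Ad (x y x^-1) (Ad x w)]. *)
Lemma Ad_ad x v w : Ad A x (ad A v w) = ad A (Ad A x v) (Ad A x w).
Proof.
have := der_lin Ef (Ad_linear x) (der_Adc1 v w) => /der_d <-.
have q1 : psm A (fun e => x * c1 e * x^-1)%g o.
  by apply: psmM; [apply: psmM|]; try exact: psm_cst; exact: psm_c1.
have := der_Ad v (Ad A x w) Ef q1.
rewrite rv1 ?c1o ?mulg1 ?mulgV // -AdE Ad1 => H; apply: der_d.
apply: der_near H; near=> e.
by rewrite -!AdM mulgVK.
Unshelve. all: by end_near. Qed.

(** Derivative at the identity of the invariance [Ad_ad] of the bracket; the product rule gives the
    two terms. *)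
Lemma jacobi u v w : ad A u (ad A v w) = ad A (ad A u v) w + ad A v (ad A u w).
Proof.
rewrite -(der_d (der_Adc1 u (ad A v w))).
have := der_bil Ef Ef ad_linearr ad_linearl (der_Adc1 u v) (der_Adc1 u w).
rewrite c1o !Ad1 => H; apply: der_d; apply: der_near H; near=> e.
by rewrite Ad_ad.
Unshelve. all: by end_near. Qed.

(** [Ll] and [Rr] are the left- and right-invariant fields of v, read in the one chart at the
    identity so that they can be differentiated in x. *)
Let Ll x v := 'd (fun t => cmap (A 1%g) (x * c1 t)%g) o v.
Let Rr x v := 'd (fun t => cmap (A 1%g) (c1 t * x)%g) o v.

Let sm_in_chart1 K (p : K -> G) k : psm A p k -> cdom (A 1%g) (p k) ->
  sm k (fun k' => cmap (A 1%g) (p k')).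
Proof. by move=> pk pd; have [] := psm_in_chart Aa Ef pk pd. Qed.

Let LlE K (q : K -> G) k x v : psm A q k -> q k = 1%g -> cdom (A 1%g) x ->
  der (fun t => cmap (A 1%g) (x * q t)%g) k v (Ll x (vel A q k v)).
Proof.
move=> qk q1 xd.
have cK : \forall t \near k, c1 (cmap (A 1%g) (q t)) = q t.
  have [h _] := qk; rewrite q1 in h.
  by apply: filterS h => t; have [_ + _] := Aa; exact.
have s1 : sm o (fun t => cmap (A 1%g) (x * c1 t)%g).
  apply: (@sm_in_chart1 _ (fun t => x * c1 t)%g); last by rewrite c1o mulg1.
  by apply: psmM; [exact: psm_cst|exact: psm_c1].
have s2 := psm_sm1 qk q1.
have e1 : der (fun t => cmap (A 1%g) (q t)) k v (vel A q k v).
  by have := vel_der v qk; rewrite q1.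
have e2 : der (fun t => cmap (A 1%g) (x * c1 t)%g) (cmap (A 1%g) (q k)) (vel A q k v)
    (Ll x (vel A q k v)) by rewrite q1; exact: sm_der.
apply: der_near (der_comp e1 e2).
by apply: filterS cK => t ->.
Qed.

Let RrE K (q : K -> G) k x v : psm A q k -> q k = 1%g -> cdom (A 1%g) x ->
  der (fun t => cmap (A 1%g) (q t * x)%g) k v (Rr x (vel A q k v)).
Proof.
move=> qk q1 xd.
have cK : \forall t \near k, c1 (cmap (A 1%g) (q t)) = q t.
  have [h _] := qk; rewrite q1 in h.
  by apply: filterS h => t; have [_ + _] := Aa; exact.
have s1 : sm o (fun t => cmap (A 1%g) (c1 t * x)%g).
  apply: (@sm_in_chart1 _ (fun t => c1 t * x)%g); last by rewrite c1o mul1g.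
  by apply: psmM; [exact: psm_c1|exact: psm_cst].
have e1 : der (fun t => cmap (A 1%g) (q t)) k v (vel A q k v).
  by have := vel_der v qk; rewrite q1.
have e2 : der (fun t => cmap (A 1%g) (c1 t * x)%g) (cmap (A 1%g) (q k)) (vel A q k v)
    (Rr x (vel A q k v)) by rewrite q1; exact: sm_der.
apply: der_near (der_comp e1 e2).
by apply: filterS cK => t ->.
Qed.

Let LlRr x v : cdom (A 1%g) x -> Ll x v = Rr x (Ad A x v).
Proof.
move=> xd; have xc : psm A (fun t => x * c1 t * x^-1)%g o.
  by apply: psmM; [apply: psmM|]; try exact: psm_cst; exact: psm_c1.
have := RrE v xc _ xd; rewrite -AdE c1o mulg1 mulgV => /(_ erefl)/der_d <-.
rewrite /Ll; congr ('d _ _ v); apply/funext => t.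
by rewrite mulgVK.
Qed.

Let Rr1 v : Rr 1%g v = v.
Proof.
rewrite -[RHS]vel_c1 /Rr /vel c1o; congr ('d _ _ v); apply/funext => t.
by rewrite mulg1.
Qed.

Section MaurerCartan.
Context {K : normedModType R} (p : K -> G) (k : K).
Hypotheses (Kf : findim K) (pk : psm A p k).

Let P k' := (p k' * (p k)^-1)%g.
Let Pk : psm A P k. Proof. by apply: psmM => //; exact: psm_cst. Qed.
Let P1 : P k = 1%g. Proof. exact: mulgV. Qed.
Let rP v : vel A P k v = rv p k v. Proof. by rewrite rvE. Qed.
Let Pdom : \forall t \near k, cdom (A 1%g) (P t).
Proof. by have [] := Pk; rewrite P1. Qed.

Let pairP (q r : K -> G) : psm A q k -> psm A r k -> (q k * r k = 1)%g ->
  sm (k, k) (fun z : K * K => cmap (A 1%g) (q z.1 * r z.2)%g).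
Proof.
move=> qk rk e1; apply: (@psm_sm1 _ (fun z : K * K => q z.1 * r z.2)%g) => //.
by apply: psmM; [exact: psm_pfst|exact: psm_psnd].
Qed.

Let S v u := 'D_v (fun t => Ll (P t) (rv p k u)) k.

(** [P b * P a] is a right translate in b and a left translate in a: the mixed partials of one map
    exchange the two kinds of invariant field. *)
Let RrS v u : 'D_v (fun t => Rr (P t) (rv p k u)) k = S u v.
Proof.
have e1 : (P k * P k = 1)%g by rewrite P1 mulg1.
have s1 : sm (k, k) (fun z : K * K => cmap (A 1%g) (P z.2 * P z.1)%g).
  apply: (@psm_sm1 _ (fun z : K * K => P z.2 * P z.1)%g) => //.
  by apply: psmM; [exact: psm_psnd|exact: psm_pfst].
have := mixed_partial v u Kf Kf Ef s1.
have -> : 'D_v (fun a => 'd (fun b => cmap (A 1%g) (P b * P a)%g) k u) k =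
    'D_v (fun t => Rr (P t) (rv p k u)) k.
  apply: near_eq_derive; apply: filterS Pdom => t td.
  exact: (etrans (der_d (RrE u Pk P1 td)) (congr1 (Rr (P t)) (rP u))).
move=> ->; apply: near_eq_derive; apply: filterS Pdom => t td.
exact: (etrans (der_d (LlE v Pk P1 td)) (congr1 (Ll (P t)) (rP v))).
Qed.

Let sm_Ll w : sm k (fun t => Ll (P t) w).
Proof.
apply: (@sm_partial2 _ K g g (fun z => cmap (A 1%g) (P z.1 * c1 z.2)%g) (fun=> o)) => //.
  apply: (@psm_sm1 _ (fun z : K * g => P z.1 * c1 z.2)%g); last by rewrite /= c1o P1 mulg1.
  by apply: psmM; [exact: psm_pfst|apply: psm_psnd => //; exact: psm_c1].
all: exact: sm_cst.
Qed.

Let sm_Rr w : sm k (fun t => Rr (P t) w).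
Proof.
apply: (@sm_partial2 _ K g g (fun z => cmap (A 1%g) (c1 z.2 * P z.1)%g) (fun=> o)) => //.
  apply: (@psm_sm1 _ (fun z : K * g => c1 z.2 * P z.1)%g); last by rewrite /= c1o P1 mulg1.
  by apply: psmM; [apply: psm_psnd => //; exact: psm_c1|exact: psm_pfst].
all: exact: sm_cst.
Qed.

(** The product rule for a moving linear map on a moving vector, done in coordinates. At the
    identity [Rr] is the identity map, so the second term is the bare bracket. *)
Let der_RrAd v w : der (fun t => Rr (P t) (Ad A (P t) w)) k v
  ('D_v (fun t => Rr (P t) w) k + ad A (rv p k v) w).
Proof.
have RE x z : Rr x z = \sum_i (z 0 i : R^o) *: Rr x (delta_mx 0 i).
  have [L LE] := linear_pack (linearP ('d (fun t => cmap (A 1%g) (c1 t * x)%g) o)).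
  rewrite /Rr {1}[z]row_sum_delta LE linear_sum; apply: eq_bigr => i _.
  by rewrite linearZ.
have dA : der (fun t => Ad A (P t) w) k v (ad A (rv p k v) w).
  have := der_Ad v w Kf Pk; have -> : rv P k v = rv p k v by exact: (etrans (@rv1 K P k v P1) (rP v)).
  by rewrite P1 Ad1 => H; exact: H.
have H i : der (fun t => (Ad A (P t) w 0 i : R^o) *: Rr (P t) (delta_mx 0 i)) k v _ :=
  der_scale (der_lin Ef (@linear_coord R 1 n 0 i) dA)
    (derE v (sm_diff (sm_Rr (delta_mx 0 i)))).
have := der_sum H; rewrite big_split /= => H'.
have -> : (fun t => Rr (P t) (Ad A (P t) w)) =
    (fun t => \sum_i (Ad A (P t) w 0 i : R^o) *: Rr (P t) (delta_mx 0 i)).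
  by apply/funext => t; rewrite RE.
apply: der_eq H' _; rewrite addrC P1 Ad1; congr (_ + _); last first.
  by rewrite -RE Rr1.
apply/esym/der_D.
have := der_sum (fun i => der_scalec (w 0 i) (derE v (sm_diff (sm_Rr (delta_mx 0 i))))).
by apply: der_near; near=> t; rewrite [RHS]RE.
Unshelve. all: by end_near. Qed.

Let S_antisym v u : S v u - S u v = ad A (rv p k v) (rv p k u).
Proof.
apply/eqP; rewrite subr_eq addrC -(RrS v u); apply/eqP.
rewrite -(der_D (der_RrAd v (rv p k u))).
apply: near_eq_derive; apply: filterS Pdom => t td; exact: LlRr.
Qed.

(** By [diagonal_antisym] only the partial in the inverted factor matters. As
    [p a * (p b)^-1 = P a * Q b] with [Q] of velocity [- rv p k], that partial is a left-invariant
    field, and the difference is [S u v - S v u]. *)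
Lemma maurer_cartan v u : 'D_u (fun t => rv p t v) k - 'D_v (fun t => rv p t u) k =
  ad A (rv p k u) (rv p k v).
Proof.
have s1 : sm (k, k) (fun z : K * K => cmap (A 1%g) (p z.1 * (p z.2)^-1)%g).
  by apply: (@pairP p (fun t => (p t)^-1)%g); [exact: pk|exact: psmV|exact: mulgV].
have := diagonal_antisym v u Kf Ef s1.
rewrite -[LHS]/('D_u (fun t => rv p t v) k - 'D_v (fun t => rv p t u) k) => ->.
pose Q t := (p k * (p t)^-1)%g.
have Qk : psm A Q k by apply: psmM; [exact: psm_cst|exact: psmV].
have Q1 : Q k = 1%g by exact: mulgV.
have Qv w : vel A Q k w = - rv p k w.
  rewrite -(@rv1 K Q k w Q1) (@rv_mull K (fun t => (p t)^-1)%g (p k) k w (psmV pk)).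
  rewrite (@rvV K p k w pk); have [L LE] := linear_pack (Ad_linear (p k)).
  by rewrite LE linearN -LE AdKV.
have E1 w z : 'D_w (fun a => 'd (fun b => cmap (A 1%g) (p a * (p b)^-1)%g) k z) k = - S w z.
  have dS : der (fun t => - Ll (P t) (rv p k z)) k w (- S w z).
    apply: der_opp; rewrite /S (deriveE _ (sm_diff (sm_Ll (rv p k z)))).
    exact: sm_der.
  rewrite -(der_D dS).
  apply: near_eq_derive; apply: filterS Pdom => t td.
    have <- : Ll (P t) (- rv p k z) = - Ll (P t) (rv p k z) by exact: linearN.
    rewrite -Qv -(der_d (LlE z Qk Q1 td)); congr ('d _ _ z).
    by apply/funext => b; rewrite /P /Q mulgA mulgVK.
rewrite (E1 v u) (E1 u v) opprK addrC; exact: S_antisym.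
Qed.

End MaurerCartan.

(** The left side of the Maurer-Cartan equation is visibly antisymmetric, and for the inverse chart
    at the identity [rv] is the identity map, so every pair of vectors is reached. *)
Lemma adC u v : ad A u v = - ad A v u.
Proof.
have h w z := @maurer_cartan _ c1 o Ef psm_c1 w z.
have rc w : rv c1 o w = w by rewrite rv1 ?c1o // vel_c1.
by have h1 := h v u; have h2 := h u v; rewrite !rc in h1 h2; rewrite -h1 -h2 opprB.
Qed.

End Lie.

(** * Coadjoint action *)

Section Duality.
Context {R : realType} {n : nat}.
Implicit Types (m : 'cV[R]_n) (x : 'rV[R]_n).

Lemma pairing_linearl x : linear (fun m => pairing m x : R^o).
Proof. by move=> a m m'; rewrite /pairing mulmxDr -scalemxAr !mxE. Qed.

Lemma pairing_linearr m : linear (fun x => pairing m x : R^o).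
Proof. by move=> a x x'; rewrite /pairing mulmxDl -scalemxAl !mxE. Qed.

Lemma pairingDl m m' x : pairing (m + m') x = pairing m x + pairing m' x.
Proof. by rewrite /pairing mulmxDr mxE. Qed.

Lemma pairingDr m x x' : pairing m (x + x') = pairing m x + pairing m x'.
Proof. by rewrite /pairing mulmxDl mxE. Qed.

Lemma pairingNl m x : pairing (- m) x = - pairing m x.
Proof. by rewrite /pairing mulmxN mxE. Qed.

Lemma pairingNr m x : pairing m (- x) = - pairing m x.
Proof. by rewrite /pairing mulNmx mxE. Qed.

Lemma pairingZl a m x : pairing (a *: m) x = a * pairing m x.
Proof. by rewrite /pairing -scalemxAr mxE. Qed.

Lemma pairingZr a m x : pairing m (a *: x) = a * pairing m x.
Proof. by rewrite /pairing -scalemxAl mxE. Qed.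

Lemma pairing0l x : pairing 0 x = 0 :> R.
Proof. by rewrite /pairing mulmx0 mxE. Qed.

Lemma pairing0r m : pairing m 0 = 0.
Proof. by rewrite /pairing mul0mx mxE. Qed.

Definition pairingE := (pairingDl, pairingDr, pairingNl, pairingNr, pairing0l, pairing0r).

Lemma pairing_covec (f : 'rV[R]_n -> R) x : linear (f : _ -> R^o) -> pairing (covec f) x = f x.
Proof.
move=> /linear_pack[g gE]; rewrite -[f x]/((f : _ -> R^o) x) gE.
rewrite {2}[x]row_sum_delta linear_sum /pairing mxE; apply: eq_bigr => i _.
by rewrite linearZ mxE.
Qed.

Lemma pairing_dvec (f : 'cV[R]_n -> R) m : linear (f : _ -> R^o) -> pairing m (dvec f) = f m.
Proof.
move=> /linear_pack[g gE]; rewrite -[f m]/((f : _ -> R^o) m) gE.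
have {2}-> : m = \sum_i m i 0 *: delta_mx i 0.
  by rewrite {1}[m]matrix_sum_delta; apply: eq_bigr => i _; rewrite big_ord1.
rewrite linear_sum /pairing mxE; apply: eq_bigr => i _.
by rewrite linearZ mxE /GRing.scale /= mulrC.
Qed.

Lemma pairing_delta m i : pairing m (delta_mx 0 i) = m i 0.
Proof. by rewrite /pairing -rowE mxE. Qed.

Lemma pairing_deltal x i : pairing (delta_mx i 0) x = x 0 i.
Proof. by rewrite /pairing -colE mxE. Qed.

Lemma covec_eq m m' : (forall x, pairing m x = pairing m' x) -> m = m'.
Proof. by move=> h; apply/colP => i; rewrite -!pairing_delta h. Qed.

Lemma vec_eq x x' : (forall m, pairing m x = pairing m x') -> x = x'.
Proof. by move=> h; apply/rowP => i; rewrite -!pairing_deltal h. Qed.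

Lemma eq_covec (f f' : 'rV[R]_n -> R) : f =1 f' -> covec f = covec f'.
Proof. by move=> h; apply/colP => i; rewrite !mxE h. Qed.

Section Calculus.
Context {E : normedModType R}.

Lemma der_mx p q (f : E -> 'M[R]_(p, q)) y v (w : 'M[R]_(p, q)) :
  (forall i j, der (fun z => f z i j : R^o) y v (w i j)) -> der f y v w.
Proof.
move=> h; rewrite [w]matrix_sum_delta.
have -> : f = (fun z => \sum_i \sum_j (f z i j : R^o) *: delta_mx i j).
  by apply/funext => z; rewrite [LHS]matrix_sum_delta.
apply: der_sum => i; apply: der_sum => j.
have := der_scale (h i j) (der_cst (delta_mx i j : 'M[R]_(p, q)) y v).
by rewrite scaler0 addr0.
Qed.

Lemma der_pairing (f : E -> 'cV[R]_n) (h : E -> 'rV[R]_n) y v f' h' :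
  der f y v f' -> der h y v h' ->
  der (fun z => pairing (f z) (h z) : R^o) y v (pairing f' (h y) + pairing (f y) h').
Proof.
apply: (@der_bil _ _ _ R^o (fun m x => pairing m x)) => [m|x].
  exact: pairing_linearr.
exact: pairing_linearl.
Qed.

Lemma sm_pairing (f : E -> 'cV[R]_n) (h : E -> 'rV[R]_n) y :
  sm y f -> sm y h -> sm y (fun z => pairing (f z) (h z) : R^o).
Proof.
apply: (@sm_bil _ E _ _ R^o (fun m x => pairing m x)) => [m|x].
  exact: pairing_linearr.
exact: pairing_linearl.
Qed.

Lemma der_covec (f : E -> 'rV[R]_n -> R) y v f' :
  (forall x, der (fun z => f z x : R^o) y v (f' x)) ->
  der (fun z => covec (f z)) y v (covec f').
Proof.
move=> h; apply: der_mx => i j; rewrite mxE.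
by apply: der_near (h (delta_mx 0 i)); near=> z; rewrite mxE.
Unshelve. all: by end_near. Qed.

Lemma sm_covec (f : E -> 'rV[R]_n -> R) y :
  (forall x, sm y (fun z => f z x : R^o)) -> sm y (fun z => covec (f z)).
Proof.
move=> h; apply: sm_mx => i j.
by apply: sm_ext (h (delta_mx 0 i)); near=> z; rewrite mxE.
Unshelve. all: by end_near. Qed.

Lemma sm_dvec (f : E -> 'cV[R]_n -> R) y :
  (forall m, sm y (fun z => f z m : R^o)) -> sm y (fun z => dvec (f z)).
Proof.
move=> h; apply: sm_mx => i j.
by apply: sm_ext (h (delta_mx j 0)); near=> z; rewrite mxE.
Unshelve. all: by end_near. Qed.

End Calculus.
End Duality.

(* The unification of two unfolded adjoint actions diverges, whence the locked copies. *)
Definition Adl (R : realType) (n : nat) (G : groupType) (A : atlas G 'rV[R]_n) :=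
  locked (Ad A).
Definition adl (R : realType) (n : nat) (G : groupType) (A : atlas G 'rV[R]_n) :=
  locked (ad A).
Definition Adsl (R : realType) (n : nat) (G : groupType) (A : atlas G 'rV[R]_n) :=
  locked (Adstar A).
Definition adsl (R : realType) (n : nat) (G : groupType) (A : atlas G 'rV[R]_n) :=
  locked (adstar A).

Section Coadjoint.
Context {R : realType} {n : nat} {G : groupType} (A : atlas G 'rV[R]_n).
Hypothesis hG : lie_group A.
Local Notation g := ('rV[R]_n).
Local Notation gd := ('cV[R]_n).
Implicit Types (m : gd) (x : G) (u v w : g).

Let gf : findim g := findim_mx _ _.
Let gdf : findim gd := findim_mx _ _.

Lemma AdlE : Adl A = Ad A. Proof. by rewrite /Adl -lock. Qed.
Lemma adlE : adl A = ad A. Proof. by rewrite /adl -lock. Qed.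
Lemma AdslE : Adsl A = Adstar A. Proof. by rewrite /Adsl -lock. Qed.
Lemma adslE : adsl A = adstar A. Proof. by rewrite /adsl -lock. Qed.

Lemma Adl_linear x : linear (Adl A x).
Proof. by rewrite AdlE; exact: Ad_linear. Qed.

Lemma Adl1 v : Adl A 1%g v = v.
Proof. by rewrite AdlE; exact: Ad1. Qed.

Lemma AdlM x y v : Adl A (x * y)%g v = Adl A x (Adl A y v).
Proof. by rewrite AdlE; exact: AdM. Qed.

Lemma AdlK x v : Adl A x^-1%g (Adl A x v) = v.
Proof. by rewrite AdlE; exact: AdK. Qed.

Lemma AdlKV x v : Adl A x (Adl A x^-1%g v) = v.
Proof. by rewrite AdlE; exact: AdKV. Qed.

Lemma adl_linearl w : linear (fun u => adl A u w).
Proof. by rewrite adlE; exact: ad_linearl. Qed.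

Lemma adl_linearr u : linear (adl A u).
Proof. by rewrite adlE; exact: ad_linearr. Qed.

Lemma Adl_adl x v w : Adl A x (adl A v w) = adl A (Adl A x v) (Adl A x w).
Proof. by rewrite AdlE adlE; exact: Ad_ad. Qed.

Lemma adlC u v : adl A u v = - adl A v u.
Proof. by rewrite adlE; exact: adC. Qed.

Lemma adl_jacobi u v w : adl A u (adl A v w) = adl A (adl A u v) w + adl A v (adl A u w).
Proof. by rewrite adlE; exact: jacobi. Qed.

Lemma der_Adl (K : normedModType R) (p : K -> G) (k v : K) w : findim K -> psm A p k ->
  der (fun k' => Adl A (p k') w) k v (adl A (rv A p k v) (Adl A (p k) w)).
Proof. by rewrite AdlE adlE; exact: der_Ad. Qed.

Lemma sm_Adl (K : normedModType R) (p : K -> G) (w : K -> g) k : findim K ->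
  psm A p k -> sm k w -> sm k (fun k' => Adl A (p k') (w k')).
Proof. by rewrite AdlE; exact: sm_Ad. Qed.

Lemma Adsl_covec x m : Adsl A x m = covec (fun v => pairing m (Adl A x^-1%g v)).
Proof. by rewrite AdslE AdlE. Qed.

Lemma adsl_covec u m : adsl A u m = covec (fun v => - pairing m (adl A u v)).
Proof. by rewrite adslE adlE. Qed.

Lemma adDl u v w : adl A (u + v) w = adl A u w + adl A v w.
Proof. by have := adl_linearl w 1 u v; rewrite !scale1r. Qed.

Lemma adNl u w : adl A (- u) w = - adl A u w.
Proof.
by have [L LE] := linear_pack (adl_linearl w); rewrite -[LHS]/((adl A)^~ w _) LE linearN -LE.
Qed.

Lemma adZl a u w : adl A (a *: u) w = a *: adl A u w.
Proof.
by have [L LE] := linear_pack (adl_linearl w); rewrite -[LHS]/((adl A)^~ w _) LE linearZ -LE.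
Qed.

Lemma adZr a u w : adl A u (a *: w) = a *: adl A u w.
Proof. by have [L ->] := linear_pack (adl_linearr u); rewrite linearZ. Qed.

Lemma ad0r w : adl A w 0 = 0.
Proof. by have := adZr 0 w 0; rewrite !scale0r. Qed.

Lemma pairing_Adstar x m v : pairing (Adsl A x m) v = pairing m (Adl A x^-1%g v).
Proof.
rewrite Adsl_covec; apply: pairing_covec => a u w.
by rewrite Adl_linear pairingDr pairingZr.
Qed.

Lemma pairing_adstar u m v : pairing (adsl A u m) v = - pairing m (adl A u v).
Proof.
rewrite adsl_covec; apply: pairing_covec => a w w'.
by rewrite adl_linearr pairingDr pairingZr opprD -mulrN.
Qed.

Lemma Adstar1 m : Adsl A 1%g m = m.
Proof. by apply: covec_eq => v; rewrite pairing_Adstar invg1 Adl1. Qed.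

Lemma AdstarM x y m : Adsl A (x * y)%g m = Adsl A x (Adsl A y m).
Proof.
apply: covec_eq => v.
by rewrite !pairing_Adstar invgM AdlM.
Qed.

Lemma AdstarK x m : Adsl A x^-1%g (Adsl A x m) = m.
Proof. by rewrite -AdstarM mulVg Adstar1. Qed.

Lemma AdstarKV x m : Adsl A x (Adsl A x^-1%g m) = m.
Proof. by rewrite -AdstarM mulgV Adstar1. Qed.

Lemma Adstar_linear x : linear (Adsl A x).
Proof.
move=> a m m'; apply: covec_eq => v.
by rewrite pairing_Adstar !pairingDl !pairingZl !pairing_Adstar.
Qed.

Lemma adstar_linearl m : linear (fun u => adsl A u m).
Proof.
move=> a u v; apply: covec_eq => w.
rewrite pairing_adstar pairingDl pairingZl !pairing_adstar adDl adZl pairingDr pairingZr.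
by rewrite opprD mulrN.
Qed.

Lemma adstar_linearr u : linear (adsl A u).
Proof.
move=> a m m'; apply: covec_eq => w.
by rewrite pairing_adstar !pairingDl !pairingZl !pairing_adstar opprD mulrN.
Qed.

Lemma Adstar_adstar x u m : Adsl A x (adsl A u m) = adsl A (Adl A x u) (Adsl A x m).
Proof.
apply: covec_eq => w; rewrite pairing_Adstar !pairing_adstar pairing_Adstar.
by rewrite Adl_adl AdlK.
Qed.

Section Calculus.
Context {K : normedModType R} (Kf : findim K).

(** The inverse inside the coadjoint action contributes [- Ad] of the inverse of [p k]; equivariance
    of the bracket absorbs it. *)
Lemma der_Adstar (p : K -> G) (k v : K) m : psm A p k ->
  der (fun k' => Adsl A (p k') m) k v (adsl A (rv A p k v) (Adsl A (p k) m)).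
Proof.
move=> pk; rewrite (_ : (fun _ => _) = fun k' => covec (fun w => pairing m (Adl A (p k')^-1%g w))); last first.
  by apply/funext => k'; exact: Adsl_covec.
rewrite adsl_covec; apply: der_covec => w.
have := der_pairing (der_cst m k v) (der_Adl v w Kf (psmV hG pk)).
rewrite pairing0l add0r rvV // => H; apply: der_eq H _.
by rewrite -AdlE adNl pairingNr -Adl_adl -pairing_Adstar.
Qed.

Lemma sm_Adstar (p : K -> G) (m : K -> gd) k : psm A p k -> sm k m ->
  sm k (fun k' => Adsl A (p k') (m k')).
Proof.
move=> pk mk; rewrite (_ : (fun _ => _) = fun k' => covec (fun w => pairing (m k') (Adl A (p k')^-1%g w))); last first.
  by apply/funext => k'; exact: Adsl_covec.
apply: sm_covec => w; apply: sm_pairing => //.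
by apply: sm_Adl => //; [exact: psmV|exact: sm_cst].
Qed.

Lemma sm_adstar (u : K -> g) (m : K -> gd) k : sm k u -> sm k m ->
  sm k (fun k' => adsl A (u k') (m k')).
Proof.
move=> uk mk; apply: (sm_bil gf gdf) uk mk; first exact: adstar_linearr.
exact: adstar_linearl.
Qed.

Lemma der_adstar (u : K -> g) (m : K -> gd) (k v : K) u' m' : der u k v u' -> der m k v m' ->
  der (fun k' => adsl A (u k') (m k')) k v (adsl A u' (m k) + adsl A (u k) m').
Proof.
apply: (der_bil gf gdf); first exact: adstar_linearr.
exact: adstar_linearl.
Qed.

End Calculus.
End Coadjoint.

(** * The atlas of the cotangent bundle *)

Section Cotangent.
Context {R : realType} {n : nat} {M : Type} (A : atlas M 'rV[R]_n).
Hypothesis Aa : is_atlas A.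
Local Notation g := ('rV[R]_n).
Local Notation gd := ('cV[R]_n).
Let Ef : findim g := findim_mx _ _.
Let Df : findim gd := findim_mx _ _.

Definition trans x y w (v : g) : g :=
  'd (cmap (A y) \o cinv (A x)) (cmap (A x) w) v.

Lemma trans_linear x y w : linear (trans x y w).
Proof. exact: linearP. Qed.

Lemma sm_trans x y w : cdom (A x) w -> cdom (A y) w ->
  sm (cmap (A x) w) (cmap (A y) \o cinv (A x)).
Proof. by move=> xw yw; have [_ _ /(_ x y w xw yw)[]] := Aa. Qed.

Lemma trans_comp x y z w v : cdom (A x) w -> cdom (A y) w -> cdom (A z) w ->
  trans y z w (trans x y w v) = trans x z w v.
Proof.
move=> xw yw zw; apply/esym/der_d.
have [_ A2 /(_ x y w xw yw)[h _]] := Aa.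
have e1 := sm_der v (sm_trans xw yw).
have e2 : der (cmap (A z) \o cinv (A y)) ((cmap (A y) \o cinv (A x)) (cmap (A x) w))
   (trans x y w v) (trans y z w (trans x y w v)).
  by rewrite /= A2 //; apply: sm_der; exact: sm_trans.
apply: der_near (der_comp e1 e2).
by apply: filterS h => e [_ [ye _]]; rewrite /= A2.
Qed.

Lemma trans_id x w v : cdom (A x) w -> trans x x w v = v.
Proof.
move=> xw; apply: der_d; apply: der_near (der_id _ _).
by have := atlas_near Aa xw; apply: filterS => e [_ /= ->].
Qed.

Lemma trans_inv x w v : cdom (A x) w -> trans w x w (trans x w w v) = v.
Proof.
by move=> xw; have [A1 _ _] := Aa; rewrite trans_comp ?trans_id.
Qed.

Lemma trans_inv' x w v : cdom (A x) w -> trans x w w (trans w x w v) = v.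
Proof.
by move=> xw; have [A1 _ _] := Aa; rewrite trans_comp ?trans_id.
Qed.

Lemma pairing_trans x y w (m : gd) v :
  pairing (covec (fun v => pairing m (trans x y w v))) v = pairing m (trans x y w v).
Proof.
apply: pairing_covec => a u u'.
by rewrite trans_linear pairingDr pairingZr.
Qed.

Lemma cot_cmapE (p q : M * gd) : cdom (A p.1) q.1 ->
  cmap (cot_atlas A p) q = (cmap (A p.1) q.1, covec (fun v => pairing q.2 (trans p.1 q.1 q.1 v))).
Proof. by []. Qed.

Lemma cot_cinvE (p : M * gd) (e : g * gd) :
  cinv (cot_atlas A p) e = (cinv (A p.1) e.1,
    covec (fun v => pairing e.2 (trans (cinv (A p.1) e.1) p.1 (cinv (A p.1) e.1) v))).
Proof. by []. Qed.

Lemma cot_is_atlas : is_atlas (cot_atlas A).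
Proof.
have [A1 A2 A3] := Aa.
split=> [p|p [y b] /= py|p q z pz qz].
- exact: A1.
- rewrite A2 //; congr pair; apply: covec_eq => v.
  rewrite (@pairing_trans y p.1 y) (@pairing_trans p.1 y y) trans_inv' //.
have [h1 h2] := A3 p.1 q.1 z.1 pz qz.
have near1 : \forall e \near cmap (cot_atlas A p) z, cdom (A p.1) (cinv (A p.1) e.1) /\
   cdom (A q.1) (cinv (A p.1) e.1) /\ cmap (A p.1) (cinv (A p.1) e.1) = e.1.
  exact: (near_fst (e := cmap (cot_atlas A p) z) h1).
split.
  apply: filterS near1 => e [pe [qe eE]]; split=> //; split=> //.
  rewrite cot_cinvE cot_cmapE //= eE [RHS]surjective_pairing; congr pair.
  by apply: covec_eq => v; rewrite !pairing_trans trans_inv.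
(* The fibre formula passes through the chart centred at the moving base point, which varies without
   regularity. The cocycle rule [trans_comp] cancels it and leaves a transition between two fixed
   charts. *)
apply: (sm_ext (f := fun e : g * gd => (cmap (A q.1) (cinv (A p.1) e.1),
    covec (fun v => pairing e.2 ('d (cmap (A p.1) \o cinv (A q.1))
      (cmap (A q.1) (cinv (A p.1) e.1)) v))))).
  apply: filterS near1 => e [pe [qe eE]].
  apply: (congr1 (pair _)); apply: covec_eq => v; set w := cinv (A p.1) e.1.
  have E1 : pairing (covec (fun v => pairing e.2 (trans q.1 p.1 w v))) v = pairing e.2 (trans q.1 p.1 w v).
    exact: pairing_trans.
  have E2 (m : gd) : pairing (covec (fun v => pairing m (trans q.1 w w v))) v = pairing m (trans q.1 w w v).
    exact: pairing_trans.
  have E3 : pairing (covec (fun v => pairing e.2 (trans w p.1 w v))) (trans q.1 w w v) =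
      pairing e.2 (trans w p.1 w (trans q.1 w w v)).
    exact: pairing_trans.
  apply: (etrans E1); apply/esym/(etrans (E2 _))/(etrans E3).
  apply: congr1; apply: trans_comp => //; have [h _ _] := Aa; exact: h.
have s1 : sm (cmap (cot_atlas A p) z) (fun e : g * gd => cmap (A q.1) (cinv (A p.1) e.1)).
  exact: (sm_comp (g := fun e => cmap (A q.1) (cinv (A p.1) e)) Ef (sm_pfst (cmap (cot_atlas A p) z) Ef Df) h2).
apply: sm_pair => //; apply: sm_covec => v; apply: sm_pairing; first exact: sm_psnd.
apply: (sm_d (p := fun e : g * gd => cmap (A q.1) (cinv (A p.1) e.1)) Ef s1) => //.
  exact: sm_cst.
by rewrite /= A2 //; exact: sm_trans.
Qed.

End Cotangent.

(** * Right translation of vectors and covectors *)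

Section RightTranslation.
Context {R : realType} {n : nat} {G : groupType} (A : atlas G 'rV[R]_n).
Hypothesis hG : lie_group A.
Implicit Types K : normedModType R.
Local Notation g := ('rV[R]_n).
Local Notation gd := ('cV[R]_n).
Local Notation o := (cmap (A 1%g) 1%g).
Local Notation c1 := (cinv (A 1%g)).
Let Aa := lie_atlas hG.
Let Ef : findim g := findim_mx _ _.
Let Df : findim gd := findim_mx _ _.

(** [rho x] is the tangent map at x of right translation by [x^-1]; [lam x], that of right
    translation by x at the identity, is its inverse. Expressing [rho] through [rv] ties it to the
    group calculus. *)
Definition rho := locked (fun x v => rv A (cinv (A x)) (cmap (A x) x) v : g).

Definition lam := locked (fun x v => tmap A A (fun h => (h * x)%g) 1%g v : g).

Lemma rho_tmap x v : tmap A A (fun h => (h * x^-1)%g) x v = rho x v.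
Proof.
rewrite /rho -lock (rv_vel hG) ?cmapK ?vel_cinv0 //; exact: psm_cinv0.
Qed.

Lemma rv_rho K (p : K -> G) k v : psm A p k -> rv A p k v = rho (p k) (vel A p k v).
Proof. by move=> pk; rewrite (rv_vel hG) // rho_tmap. Qed.

Lemma rho_linear x : linear (rho x).
Proof. by rewrite /rho -lock; exact: rv_linear. Qed.

Lemma lamE x v : lam x v = vel A (fun t => (c1 t * x)%g) o v.
Proof. by rewrite /lam -lock tmapE. Qed.

Lemma rho_lam x v : rho x (lam x v) = v.
Proof.
have p1 : psm A (fun t => c1 t * x)%g o.
  by apply: (psmM hG); [exact: (psm_c1 hG)|exact: psm_cst].
have := rv_rho v p1; rewrite (c1o hG) mul1g -lamE => <-.
by rewrite (rv_mulr hG) ?rv1 ?(c1o hG) ?vel_c1 //; exact: (psm_c1 hG).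
Qed.

Lemma lam_rho x v : lam x (rho x v) = v.
Proof.
have p1 := psm_cinv0 Aa Ef x.
pose q t := (cinv (A x) t * x^-1)%g.
have q1 : q (cmap (A x) x) = 1%g by rewrite /q cmapK // mulgV.
have qk : psm A q (cmap (A x) x) by apply: (psmM hG) => //; exact: psm_cst.
have E1 : rho x v = vel A q (cmap (A x) x) v.
  by rewrite /rho -lock rvE cmapK.
rewrite E1 /lam -lock.
have := tmap_vel Aa v (smooth_mulr hG x) qk; rewrite q1 => ->.
rewrite -[RHS](vel_cinv0 Aa x v); congr (vel A _ _ v).
by apply/funext => t; rewrite /q mulgVK.
Qed.

Lemma rv_trans x w v : cdom (A x) w ->
  rv A (cinv (A x)) (cmap (A x) w) v = rho w (trans A x w w v).
Proof.
move=> xw; rewrite rv_rho; last exact: psm_cinv.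
by rewrite /vel; have [_ A2 _] := Aa; rewrite A2.
Qed.

(** The vector [lam w v] seen in the fixed chart at x, where smooth dependence on w makes sense. *)
Definition lam_chart x w (v : g) : g := 'd (fun t => cmap (A x) (c1 t * w)%g) o v.

Lemma lam_trans x w v : cdom (A x) w -> lam w v = trans A x w w (lam_chart x w v).
Proof.
move=> xw; rewrite lamE.
have p1 : psm A (fun t => c1 t * w)%g o.
  by apply: (psmM hG); [exact: (psm_c1 hG)|exact: psm_cst].
have e1 : (c1 o * w = w)%g by rewrite (c1o hG) mul1g.
have xw' : cdom (A x) (c1 o * w)%g by rewrite e1.
apply: (etrans (vel_chart Aa Ef v p1 xw')).
rewrite e1 /tinv; have [_ A2 _] := Aa; rewrite A2 //.
Qed.

Lemma sm_lam_chart K (p : K -> G) k v : findim K -> psm A p k ->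
  sm k (fun k' => lam_chart (p k) (p k') v).
Proof.
move=> Kf pk.
apply: (@sm_partial2 _ K g g (fun z => cmap (A (p k)) (c1 z.2 * p z.1)%g) (fun=> o)) => //.
  apply: (@psm_sm1 _ _ _ A _ (fun z : K * g => c1 z.2 * p z.1)%g).
    by apply: (psmM hG); [apply: psm_psnd => //; exact: (psm_c1 hG)|exact: psm_pfst].
  by rewrite /= (c1o hG) mul1g.
all: exact: sm_cst.
Qed.

Lemma psm_cot K (p : K -> G) (a : K -> gd) k : psm A p k ->
  sm k (fun k' => covec (fun v => pairing (a k') (trans A (p k) (p k') (p k') v))) ->
  psm (cot_atlas A) (fun k' => (p k', a k')) k.
Proof. by move=> [p1 p2] ak; split=> //; exact: sm_pair. Qed.

Lemma vel_cot K (p : K -> G) (a : K -> gd) k v : psm A p k ->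
  sm k (fun k' => covec (fun v => pairing (a k') (trans A (p k) (p k') (p k') v))) ->
  vel (cot_atlas A) (fun k' => (p k', a k')) k v = (vel A p k v,
    'd (fun k' => covec (fun v => pairing (a k') (trans A (p k) (p k') (p k') v))) k v).
Proof. by move=> [p1 p2] ak; apply: der_d; apply: der_pair; exact: sm_der. Qed.

Lemma psm_cotP K (z : K -> G * gd) k : psm (cot_atlas A) z k ->
  psm A (fun k' => (z k').1) k /\
  sm k (fun k' => covec (fun v => pairing (z k').2 (trans A (z k).1 (z k').1 (z k').1 v))).
Proof.
move=> [h1 h2]; split; last exact: (sm_snd Ef Df h2).
by split=> //; exact: (sm_fst Ef Df h2).
Qed.

(** Its inverse [lcov x] is [T_e^* R_x], the right trivialisation of covectors at x; [rcov x]
    rebuilds the covector. *)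
Definition rcov (x : G) (m : gd) : gd := covec (fun v => pairing m (rho x v)).

Lemma pairing_rcov x m v : pairing (rcov x m) v = pairing m (rho x v).
Proof.
apply: pairing_covec => a u w.
by rewrite rho_linear pairingDr pairingZr.
Qed.

Lemma rcov_near K (p : K -> G) (m : K -> gd) k : psm A p k ->
  \forall k' \near k,
    covec (fun v => pairing (m k') (rv A (cinv (A (p k))) (cmap (A (p k)) (p k')) v)) =
    covec (fun v => pairing (rcov (p k') (m k')) (trans A (p k) (p k') (p k') v)).
Proof.
move=> [h _]; apply: filterS h => k' xk.
by apply: eq_covec => v; rewrite (rv_trans _ xk) pairing_rcov.
Qed.

Lemma sm_rcov K (p : K -> G) (m : K -> gd) k : psm A p k -> sm k m ->
  sm k (fun k' => covec (fun v => pairing (rcov (p k') (m k')) (trans A (p k) (p k') (p k') v))).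
Proof.
move=> pk mk; apply: sm_ext (rcov_near m pk) _.
apply: sm_covec => v; apply: sm_pairing => //.
have [_ ps] := pk.
apply: (sm_comp (g := fun e => rv A (cinv (A (p k))) e v) Ef ps).
apply: (@sm_rv _ _ _ _ hG _ _ (fun=> v)) => //; [exact: psm_cinv0|exact: sm_cst].
Qed.

Lemma psm_rcov K (p : K -> G) (m : K -> gd) k : psm A p k -> sm k m ->
  psm (cot_atlas A) (fun k' => (p k', rcov (p k') (m k'))) k.
Proof. by move=> pk mk; apply: psm_cot => //; exact: sm_rcov. Qed.

Definition lcov (x : G) (m : gd) : gd := covec (fun v => pairing m (lam x v)).

Lemma lam_linear x : linear (lam x).
Proof. by rewrite /lam -lock; exact: tmap_linear. Qed.

Lemma pairing_lcov x m v : pairing (lcov x m) v = pairing m (lam x v).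
Proof.
apply: pairing_covec => a u w.
by rewrite lam_linear pairingDr pairingZr.
Qed.

Lemma rcov_lcov x m : rcov x (lcov x m) = m.
Proof. by apply: covec_eq => v; rewrite pairing_rcov pairing_lcov lam_rho. Qed.

Lemma lcov_rcov x m : lcov x (rcov x m) = m.
Proof. by apply: covec_eq => v; rewrite pairing_lcov pairing_rcov rho_lam. Qed.

Lemma sm_lcov K (z : K -> G * gd) k : findim K -> psm (cot_atlas A) z k ->
  sm k (fun k' => lcov (z k').1 (z k').2).
Proof.
move=> Kf /psm_cotP[h1 h2].
apply: (sm_ext (f := fun k' => covec (fun v => pairing
    (covec (fun v => pairing (z k').2 (trans A (z k).1 (z k').1 (z k').1 v)))
    (lam_chart (z k).1 (z k').1 v)))).
  have [h _] := h1; apply: filterS h => k' xk.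
  apply: eq_covec => v; rewrite (lam_trans v xk).
  exact: pairing_trans.
apply: sm_covec => v; apply: sm_pairing => //.
exact: (sm_lam_chart (p := fun k' => (z k').1)).
Qed.

End RightTranslation.

(** * The trivialised symplectic form *)

Section Trivialization.
Context {R : realType} {n : nat} {G : groupType} (A : atlas G 'rV[R]_n).
Hypothesis hG : lie_group A.
Implicit Types K : normedModType R.
Local Notation g := ('rV[R]_n).
Local Notation gd := ('cV[R]_n).
Local Notation VV := ('cV[R]_n * 'cV[R]_n * 'rV[R]_n)%type.
Local Notation o := (cmap (A 1%g) 1%g).
Local Notation c1 := (cinv (A 1%g)).
Local Notation PPA := (PP_atlas A).
Local Notation TSA := (TsS_atlas A).
Let Aa := lie_atlas hG.
Let Ef : findim g := findim_mx _ _.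
Let Df : findim gd := findim_mx _ _.
Let VVf : findim VV. Proof. exact: _. Qed.

Lemma PP_is_atlas : is_atlas PPA.
Proof. by apply: prod_is_atlas => //; exact: vec_is_atlas. Qed.

Lemma TsS_is_atlas : is_atlas TSA.
Proof. by apply: prod_is_atlas; try exact: vec_is_atlas; try exact: cot_is_atlas; exact: _. Qed.

Lemma sd_is_atlas : is_atlas (sd_atlas A).
Proof. by apply: prod_is_atlas => //; exact: vec_is_atlas. Qed.

(* The right trivialisation of alpha_g *)
Definition shift (v : VV) : gd := v.1.2 + adsl A v.2 v.1.1.

Lemma untrivE p : untriv A p = ((p.1, rcov A p.1 (shift p.2)), (p.2.1.1, p.2.2)).
Proof.
case: p => x [[mu nu] xi]; rewrite /untriv /shift /= adslE.
by congr ((_, _), _); apply: eq_covec => v; rewrite (rho_tmap hG).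
Qed.

Lemma trivE z : triv A z = (z.1.1, (z.2.1, lcov A z.1.1 z.1.2 - adsl A z.2.2 z.2.1, z.2.2)).
Proof.
case: z => [[x al] [mu xi]]; rewrite /triv /= adslE.
congr (_, (_, _ - _, _)); apply: eq_covec => v.
by rewrite /lam -lock.
Qed.

Lemma trivK : cancel (triv A) (untriv A).
Proof.
move=> z; rewrite trivE untrivE /shift /= subrK (rcov_lcov hG).
by case: z => [[x al] [mu xi]].
Qed.

Lemma untrivK : cancel (untriv A) (triv A).
Proof.
move=> p; rewrite untrivE trivE /shift /= (lcov_rcov hG) addrK.
by case: p => x [[mu nu] xi].
Qed.

Lemma psm_PP K (p : K -> PP R n G) k :
  psm PPA p k <-> psm A (fun k' => (p k').1) k /\ sm k (fun k' => (p k').2).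
Proof.
split=> [/(psm_prod _ _ Ef VVf)[h1 /psm_vec h2] //|[h1 h2]].
by apply/(psm_prod _ _ Ef VVf); split=> //; exact/psm_vec.
Qed.

Section Components.
Context {K : normedModType R} (f : K -> VV) (k : K).

Lemma sm_mu : sm k f -> sm k (fun k' => (f k').1.1).
Proof. by move=> h; apply: sm_fst; apply: sm_fst. Qed.

Lemma sm_nu : sm k f -> sm k (fun k' => (f k').1.2).
Proof. by move=> h; apply: (@sm_snd _ gd gd) => //; apply: sm_fst. Qed.

Lemma sm_xi : sm k f -> sm k (fun k' => (f k').2).
Proof. by move=> h; apply: sm_snd. Qed.

Lemma der_mu v w : der f k v w -> der (fun k' => (f k').1.1) k v w.1.1.
Proof. by move=> h; apply: (@der_fst _ gd gd) => //; apply: der_fst. Qed.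

Lemma der_nu v w : der f k v w -> der (fun k' => (f k').1.2) k v w.1.2.
Proof. by move=> h; apply: (@der_snd _ gd gd) => //; apply: der_fst. Qed.

Lemma der_xi v w : der f k v w -> der (fun k' => (f k').2) k v w.2.
Proof. by move=> h; apply: der_snd. Qed.

Lemma sm_shift : sm k f -> sm k (fun k' => shift (f k')).
Proof.
move=> h; apply: sm_add; first exact: sm_nu.
by apply: (sm_adstar hG); [exact: sm_xi|exact: sm_mu].
Qed.

Definition dshift (v w : VV) : gd := w.1.2 + (adsl A w.2 v.1.1 + adsl A v.2 w.1.1).

Lemma der_shift v w : der f k v w -> der (fun k' => shift (f k')) k v (dshift (f k) w).
Proof.
move=> h; apply: der_add; first exact: der_nu.
by apply: (der_adstar hG); [exact: der_xi|exact: der_mu].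
Qed.

End Components.

Lemma psm_untriv K (p : K -> PP R n G) k : psm PPA p k ->
  psm TSA (fun k' => untriv A (p k')) k.
Proof.
move=> /psm_PP[h1 h2].
have -> : (fun k' => untriv A (p k')) = (fun k' =>
    (((p k').1, rcov A (p k').1 (shift (p k').2)), ((p k').2.1.1, (p k').2.2))).
  by apply/funext => k'; rewrite untrivE.
apply/psm_prod; split=> /=; first by apply: (psm_rcov hG) => //; exact: sm_shift.
by apply/psm_vec; apply: sm_pair; [exact: sm_mu|exact: sm_xi].
Qed.

Lemma smooth_untriv : smooth PPA TSA (untriv A).
Proof.
apply: psm_smooth => [|p]; first exact: PP_is_atlas.
by apply: psm_untriv; apply: psm_cinv0; exact: PP_is_atlas.
Qed.

Lemma psm_triv K (z : K -> TsS R n G) k : findim K -> psm TSA z k ->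
  psm PPA (fun k' => triv A (z k')) k.
Proof.
move=> Kf /psm_prod[h1 /psm_vec h2].
have -> : (fun k' => triv A (z k')) = (fun k' => ((z k').1.1,
    ((z k').2.1, lcov A (z k').1.1 (z k').1.2 - adsl A (z k').2.2 (z k').2.1, (z k').2.2))).
  by apply/funext => k'; rewrite trivE.
have s1 : sm k (fun k' => (z k').2.1) by exact: (@sm_fst _ gd g).
have s2 : sm k (fun k' => (z k').2.2) by exact: (@sm_snd _ gd g).
apply/psm_PP; split=> /=; first by have [] := psm_cotP h1.
apply: sm_pair => //; apply: sm_pair => //; apply: sm_sub.
  exact: (sm_lcov hG (z := fun k' => (z k').1)).
exact: (sm_adstar hG).
Qed.

Lemma smooth_triv : smooth TSA PPA (triv A).
Proof.
apply: psm_smooth => [|p]; first exact: TsS_is_atlas.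
by apply: psm_triv; apply: psm_cinv0; exact: TsS_is_atlas.
Qed.

Lemma triv_diffeomorphism : diffeomorphism TSA PPA (triv A) (untriv A).
Proof. by split; [exact: smooth_triv|exact: smooth_untriv|exact: trivK|exact: untrivK]. Qed.

Lemma Adsl0 x : Adsl A x 0 = 0.
Proof. by have [L ->] := linear_pack (Adstar_linear A x); rewrite linear0. Qed.

Lemma lam_mulr x y v : lam A (x * y)%g v = tmap A A (fun h => (h * y)%g) x (lam A x v).
Proof.
have p1 : psm A (fun t => c1 t * x)%g o.
  by apply: (psmM hG); [exact: (psm_c1 hG)|exact: psm_cst].
have := tmap_vel Aa v (smooth_mulr hG y) p1; rewrite (c1o hG) mul1g -(lamE hG) => ->.
by rewrite (lamE hG); congr (vel A _ _ v); apply/funext => t; rewrite mulgA.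
Qed.

(** Since the coadjoint action fixes 0, right translation by [(x, 0)] has tangent map
    [(a, l) |-> (T R_x a, l)]. Testing the lift on [(0, l)] fixes xi; testing it on right-invariant
    vectors [lam A y v] fixes the trivialised covector. *)
Lemma cot_lift_triv (x : G) (z z' : TsS R n G) :
  is_cot_lift A (fun b => sdmul A b (x, 0)) z z' -> triv A z' = act_P (triv A z) x.
Proof.
rewrite !trivE; case: z z' => [[y al] [mu xi]] [[y' al'] [mu' xi']] [].
rewrite /TsS_base /sdmul /= -AdslE Adsl0 addr0 => -[-> ->] h.
have rE : (fun b : G * gd => ((b.1 * x)%g, b.2 + Adsl A b.1 0)) = (fun b => ((b.1 * x)%g, b.2)).
  by apply/funext => b; rewrite Adsl0 addr0.
have tE (a : g) (l : gd) : tmap (sd_atlas A) (sd_atlas A)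
    (fun b : G * gd => ((b.1 * x)%g, b.2 + Adsl A b.1 0)) (y, mu) (a, l) =
    (tmap A A (fun h => (h * x)%g) y a, l).
  rewrite rE (tmapE _ sd_is_atlas).
  have p1 : psm (sd_atlas A) (fun e : g * gd => ((cinv (A y) e.1 * x)%g, e.2))
      (cmap (A y) y, mu).
    apply/psm_prod; split=> /=.
      apply: (psmM hG); last exact: psm_cst.
      by apply: psm_pfst => //; exact: psm_cinv0.
    by apply/psm_vec; exact: sm_psnd.
  apply: (etrans (vel_prod Ef Df (a, l) p1)); congr pair => /=.
    rewrite (tmapE _ Aa).
    have pc : psm A (fun t => cinv (A y) t * x)%g (cmap (A y) y).
      by apply: (psmM hG); [exact: psm_cinv0|exact: psm_cst].
    apply: (etrans (@vel_comp _ _ _ A g (g * gd)%type (fun t => cinv (A y) t * x)%g fst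
      (cmap (A y) y, mu) (a, l) pc (sm_pfst _ Ef Df))).
    by congr (vel A _ _ _); exact: (der_d (der_fst Ef Df (der_id _ (a, l)))).
  exact: (der_d (der_snd Ef Df (der_id (cmap (A y) y, mu) (a, l)))).
have h' (a : g) (l : gd) :
    pairing al' (tmap A A (fun h => (h * x)%g) y a) + pairing l xi' = pairing al a + pairing l xi.
  by have := h (a, l); rewrite /TsS_pair /= tE.
have -> : xi' = xi.
  apply: vec_eq => l; have := h' 0 l; rewrite pairing0r add0r.
  have [L ->] := linear_pack (tmap_linear A A (fun h => (h * x)%g) y).
  by rewrite linear0 pairing0r add0r.
rewrite /act_P /=; congr (_, (_, _ - _, _)).
apply: covec_eq => v; rewrite !pairing_lcov lam_mulr.
by have := h' (lam A y v) 0; rewrite !pairing0l !addr0.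
Qed.

Lemma tmap_TsS_base K (z : K -> TsS R n G) k v : psm TSA z k ->
  tmap TSA (sd_atlas A) TsS_base (z k) (vel TSA z k v) =
  (vel A (fun k' => (z k').1.1) k v, 'd (fun k' => (z k').2.1) k v).
Proof.
move=> zk; have fT : findim ((g * gd) * (gd * g))%type by exact: _.
have sb : smooth TSA (sd_atlas A) TsS_base.
  apply: psm_smooth => [|p]; first exact: TsS_is_atlas.
  have := psm_cinv0 TsS_is_atlas fT p => /psm_prod[h1 /psm_vec h2].
  apply/psm_prod; split=> /=; first by have [] := psm_cotP h1.
  by apply/psm_vec; exact: (@sm_fst _ gd g).
rewrite (tmap_vel TsS_is_atlas v sb zk); apply: (etrans (vel_prod Ef Df v _)) => //.
exact: (smooth_psm TsS_is_atlas fT sb zk).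
Qed.

(** In a canonical chart the Liouville form is [p dq]: the base transitions in the covector and in
    the vector cancel. The second summand is the linear factor g^*, whose covectors are elements of
    g. *)
Lemma rep1_liouville (z : TsS R n G) v :
  \forall e \near cmap (TSA z) z,
    rep1 TSA (liouville A) z v e = pairing e.1.2 v.1.1 + pairing v.2.1 e.2.2.
Proof.
have fT : findim ((g * gd) * (gd * g))%type by exact: _.
have zz : cdom (TSA z) z by have [h _ _] := TsS_is_atlas; exact: h.
have pz := psm_cinv0 TsS_is_atlas fT z.
apply: filterS2 (psm_near TsS_is_atlas fT pz) (atlas_near TsS_is_atlas zz) => e pe [ze eE].
rewrite /rep1 /liouville -[tinv TSA z e v]/(vel TSA (cinv (TSA z)) e v).
rewrite (tmap_TsS_base v pe) /TsS_pair.
case: z zz pz pe ze eE => [[x al] [mu xi]] zz pz pe [/= ze _] eE.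
have {}eE : cmap (A x) (cinv (A x) e.1.1) = e.1.1 by have := congr1 (fun w => w.1.1) eE.
set w := cinv (A x) e.1.1 in eE ze *.
congr (_ + _).
  have E1 : vel A (fun k' : (g * gd) * (gd * g) => cinv (A x) k'.1.1) e v = trans A x w w v.1.1.
    have pc : psm A (cinv (A x)) e.1.1 by rewrite -eE; exact: psm_cinv.
    have s1 : sm e (fun k' : (g * gd) * (gd * g) => k'.1.1).
      by apply: sm_fst; exact: sm_pfst.
    apply: (etrans (@vel_comp _ _ _ A _ _ (cinv (A x)) (fun k' => k'.1.1) e v pc s1)).
    have -> : 'd (fun k' : (g * gd) * (gd * g) => k'.1.1) e v = v.1.1.
      by apply: der_d; apply: (@der_fst _ g gd) => //; exact: (der_fst _ _ (der_id e v)).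
    by rewrite /vel /trans -/w eE.
  apply: (etrans (congr1 (pairing _) E1)).
  have E2 : pairing (covec (fun u => pairing e.1.2 (trans A w x w u))) (trans A x w w v.1.1) =
      pairing e.1.2 (trans A w x w (trans A x w w v.1.1)) by exact: pairing_trans.
  by apply: (etrans E2); rewrite (trans_inv Aa).
congr pairing; apply: der_d.
by apply: (@der_fst _ gd g) => //; exact: (der_snd _ _ (der_id e v)).
Qed.

Lemma extd_liouville (z : TsS R n G) u v :
  extd TSA (liouville A) z u v =
  (pairing u.1.2 v.1.1 + pairing v.2.1 u.2.2) - (pairing v.1.2 u.1.1 + pairing u.2.1 v.2.2).
Proof.
have fT : findim ((g * gd) * (gd * g))%type by exact: _.
have h w w' : 'D_w (rep1 TSA (liouville A) z w') (cmap (TSA z) z) =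
    pairing w.1.2 w'.1.1 + pairing w'.2.1 w.2.2 :> R.
  have := rep1_liouville z w' => /near_eq_derive -/(_ w) ->; apply: der_D.
  have d12 : der (fun e : (g * gd) * (gd * g) => e.1.2) (cmap (TSA z) z) w w.1.2.
    by apply: (@der_snd _ g gd) => //; exact: (der_fst _ _ (der_id _ w)).
  have d22 : der (fun e : (g * gd) * (gd * g) => e.2.2) (cmap (TSA z) z) w w.2.2.
    by apply: (@der_snd _ gd g) => //; exact: (der_snd _ _ (der_id _ w)).
  apply: (@der_add _ _ R^o).
    by apply: der_eq; [exact: (der_pairing d12 (der_cst w'.1.1 _ _))|rewrite pairing0r addr0].
  by apply: der_eq; [exact: (der_pairing (der_cst w'.2.1 _ _) d22)|rewrite pairing0l add0r].
by rewrite /extd !h.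
Qed.

(** The right Maurer-Cartan form in the fixed chart at x, differentiable in the coordinate e. *)
Let rvc (x : G) (e v : g) : g := rv A (cinv (A x)) e v.

Lemma sm_rvc x v : sm (cmap (A x) x) (fun e => rvc x e v).
Proof. by apply: (@sm_rv _ _ _ _ hG _ _ (fun=> v)) => //; [exact: psm_cinv0|exact: sm_cst]. Qed.

Lemma rvc_rho x v : rvc x (cmap (A x) x) v = rho A x v.
Proof. by rewrite /rho -lock. Qed.

Lemma tmap_untriv (p : PP R n G) U : exists2 W : gd,
  tmap PPA TSA (untriv A) p U = ((U.1, W), (U.2.1.1, U.2.2)) &
  forall u, pairing W u = pairing (dshift p.2 U.2) (rho A p.1 u) +
    pairing (shift p.2) ('D_(U.1) (fun e => rvc p.1 e u) (cmap (A p.1) p.1)).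
Proof.
have fT : findim (g * VV)%type by exact: _.
set x := p.1; set k : g * VV := (cmap (A x) x, p.2).
pose c (e : g * VV) := cinv (A x) e.1.
have ck : psm A c k by apply: psm_pfst => //; exact: psm_cinv0.
have ck0 : c k = x by rewrite /c cmapK.
have sk : sm k (fun e : g * VV => shift e.2) by apply: sm_shift; exact: sm_psnd.
pose W0 (e : g * VV) := covec (fun v => pairing (shift e.2) (rvc x e.1 v)).
have dW : der W0 k U (covec (fun u => pairing (dshift p.2 U.2) (rho A p.1 u) +
    pairing (shift p.2) ('D_(U.1) (fun e => rvc p.1 e u) (cmap (A p.1) p.1)))).
  apply: der_covec => u.
  have d1 : der (fun e : g * VV => shift e.2) k U (dshift k.2 U.2).
    by apply: der_shift; exact: (der_snd Ef VVf (der_id k U)).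
  have d2 : der (fun e : g * VV => rvc x e.1 u) k U ('D_(U.1) (fun e => rvc x e u) (cmap (A x) x)).
    rewrite (deriveE _ (sm_diff (sm_rvc x u))).
    exact: (der_comp (der_fst Ef VVf (der_id k U)) (sm_der _ (sm_rvc x u))).
  by have := der_pairing d1 d2; rewrite /= rvc_rho.
exists ('d W0 k U); last first.
  move=> u; rewrite (der_d dW); apply: pairing_covec => a w w'.
  rewrite rho_linear !pairingDr !pairingZr.
  have -> : 'D_(U.1) (fun e => rvc p.1 e (a *: w + w')) (cmap (A p.1) p.1) =
      a *: 'D_(U.1) (fun e => rvc p.1 e w) (cmap (A p.1) p.1) +
      'D_(U.1) (fun e => rvc p.1 e w') (cmap (A p.1) p.1).
    rewrite !(deriveE _ (sm_diff (sm_rvc _ _))); apply: der_d.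
    have := der_add (der_scalec a (sm_der U.1 (sm_rvc p.1 w))) (sm_der U.1 (sm_rvc p.1 w')).
    by apply: der_near; near=> e; rewrite /rvc rv_linear.
  by rewrite pairingDr pairingZr -[a *: (_ + _)]/(a * (_ + _)) mulrDr addrACA.
have nW : \forall e \near k, W0 e =
    covec (fun v => pairing (rcov A (c e) (shift e.2)) (trans A (c k) (c e) (c e) v)).
  have h1 := rcov_near hG (fun e : g * VV => shift e.2) ck.
  have xx : cdom (A x) x by have [h _ _] := Aa; exact: h.
  have h2 := @near_fst _ g VV _ k (atlas_near Aa xx).
  apply: filterS2 h1 h2 => e <- [_ eE]; apply: eq_covec => v.
  by rewrite ck0 /c eE.
rewrite (tmapE _ PP_is_atlas).
have -> : (fun e => untriv A (cinv (PPA p) e)) = (fun e =>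
    ((c e, rcov A (c e) (shift e.2)), (e.2.1.1, e.2.2))).
  by apply/funext => e; rewrite untrivE.
have pc := psm_rcov hG ck sk.
have s2 : sm k (fun e : g * VV => (e.2.1.1, e.2.2)).
  by apply: sm_pair; [apply: sm_mu|apply: sm_xi]; exact: sm_psnd.
have pz : psm TSA (fun e : g * VV => ((c e, rcov A (c e) (shift e.2)), (e.2.1.1, e.2.2))) k.
  by apply/psm_prod; split=> //; exact/psm_vec.
apply: (etrans (vel_prod _ _ U pz)); congr pair => /=.
  have e1 : vel A c k U = U.1.
    apply: (etrans (@vel_comp _ _ _ A _ _ (cinv (A x)) fst k U (psm_cinv0 Aa Ef x) (sm_pfst k Ef VVf))).
    rewrite (der_d (der_fst Ef VVf (der_id k U))); exact: vel_cinv0.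
  have e2 := der_d (der_near nW (derE U (proj1 dW))).
  exact: (etrans (vel_cot U ck (sm_rcov hG ck sk)) (congr2 pair e1 e2)).
apply: der_d; have d := der_snd Ef VVf (der_id k U).
by apply: der_pair; [exact: (der_mu d)|exact: (der_xi d)].
Unshelve. all: by end_near. Qed.

Lemma omega_PE (p : PP R n G) U V :
  omega_P A p U V =
    pairing (dshift p.2 U.2) (rho A p.1 V.1) - pairing (dshift p.2 V.2) (rho A p.1 U.1)
    + pairing (shift p.2) (adl A (rho A p.1 U.1) (rho A p.1 V.1))
    + (pairing V.2.1.1 U.2.2 - pairing U.2.1.1 V.2.2).
Proof.
have [W WE Wp] := tmap_untriv p U; have [W' WE' Wp'] := tmap_untriv p V.
rewrite /omega_P /pullback2 WE WE' extd_liouville /= Wp Wp'.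
(* The derivatives of [rvc] contributed by [W] and [W'] form the left side of the Maurer-Cartan
   equation for the inverse chart at [p.1]. *)
have := maurer_cartan hG Ef (psm_cinv0 Aa Ef p.1) V.1 U.1.
rewrite -/(rvc p.1 _ _) -/(rvc p.1 _ _) !rvc_rho -adlE => <-.
rewrite pairingDr pairingNr.
have sum3 (a b c a' b' c' : R) : a + b + c - (a' + b' + c') = a - a' + (b - b') + (c - c') by ring.
exact: sum3.
Qed.

Lemma theta_PE (p : PP R n G) U :
  theta_P A p U = pairing (shift p.2) (rho A p.1 U.1) + pairing U.2.1.1 p.2.2.
Proof.
rewrite /theta_P /pullback1 /liouville.
have fT : findim (g * VV)%type by exact: _.
have pc := psm_cinv0 PP_is_atlas fT p.
have pu := psm_untriv pc.
have zk : untriv A (cinv (PPA p) (cmap (PPA p) p)) = untriv A p.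
  by rewrite cmapK //; exact: PP_is_atlas.
have E1 := tmap_TsS_base U pu; rewrite zk in E1.
rewrite (tmapE _ PP_is_atlas) E1 /TsS_pair untrivE /= pairing_rcov.
set k : g * VV := (cmap (A p.1) p.1, p.2).
congr (_ + _).
  apply: congr1; apply: congr1.
  have -> : (fun e => (untriv A (cinv (PPA p) e)).1.1) = (fun e : g * VV => cinv (A p.1) e.1).
    by apply/funext => e; rewrite untrivE.
  apply: (etrans (@vel_comp _ _ _ A _ _ (cinv (A p.1)) fst k U (psm_cinv0 Aa Ef _) (sm_pfst k Ef VVf))).
  rewrite (der_d (der_fst Ef VVf (der_id k U))); exact: vel_cinv0.
rewrite -[RHS]/(pairing U.2.1.1 p.2.2); congr pairing.
have -> : (fun e => (untriv A (cinv (PPA p) e)).2.1) = (fun e : g * VV => e.2.1.1).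
  by apply/funext => e; rewrite untrivE.
exact: (der_d (der_mu (der_snd Ef VVf (der_id k U)))).
Qed.

(** The generator of eta at h is the left translate of eta, whose right trivialisation is
    [Ad_h eta]. *)
Lemma momentumE (p : PP R n G) : momentum A p = Adsl A p.1^-1%g (shift p.2).
Proof.
rewrite /momentum Adsl_covec invgK; apply: eq_covec => v.
rewrite theta_PE /generator (tmapE _ Aa).
have p1 : psm A (fun t => p.1 * c1 t)%g o.
  by apply: (psmM hG); [exact: psm_cst|exact: (psm_c1 hG)].
have pk : psm PPA (fun t => act_P p (c1 t)) o by apply/psm_PP; split=> //; exact: sm_cst.
have E1 := vel_prod Ef VVf v pk; rewrite /= in E1; rewrite E1 /=.
have -> : vel (vec_atlas VV) (fun=> p.2) o v = 0 by exact: vel_cst.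
rewrite pairing0l addr0; apply: congr1.
have := rv_rho hG v p1; rewrite (c1o hG) mulg1 => <-.
rewrite (rv_mull hG) ?rv1 ?(c1o hG) ?vel_c1 ?AdlE //; exact: (psm_c1 hG).
Qed.

End Trivialization.

(** * Poisson reduction *)

Section BracketAlgebra.
Context {R : realType} {V W : zmodType} (pr : W -> V -> R) (br : V -> V -> V) (cs : V -> W -> W).
Hypotheses (prDl : forall m m' x, pr (m + m') x = pr m x + pr m' x)
  (prDr : forall m x x', pr m (x + x') = pr m x + pr m x')
  (prNl : forall m x, pr (- m) x = - pr m x) (prNr : forall m x, pr m (- x) = - pr m x)
  (brDl : forall x x' y, br (x + x') y = br x y + br x' y)
  (brDr : forall x y y', br x (y + y') = br x y + br x y')
  (brNl : forall x y, br (- x) y = - br x y) (brNr : forall x y, br x (- y) = - br x y)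
  (brC : forall x y, br x y = - br y x)
  (brJ : forall x y z, br x (br y z) = br (br x y) z + br y (br x z))
  (prcs : forall x m y, pr (cs x m) y = - pr m (br x y)).

(* Points are triples (mu, nu, xi), and differentials of functions are triples
   (d/dmu, d/dnu, d/dxi). *)
Definition PBv (v : W * W * V) (s t : V * V * W) : R :=
  pr t.2 s.1.1 - pr s.2 t.1.1 + pr v.1.2 (br s.1.2 t.1.2)
  + pr (cs s.1.2 t.2 - cs t.1.2 s.2) v.2 + pr v.1.1 (br s.1.1 t.1.2 - br t.1.1 s.1.2).

Definition contr (w : W * W * V) (s : V * V * W) : R :=
  pr w.1.1 s.1.1 + pr w.1.2 s.1.2 + pr s.2 w.2.

(** The bracket of the semidirect product of g with the sum of g and g^*, acted on by ad and ad^*.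
    The reduced bracket is its Lie-Poisson bracket plus a constant cocycle; see [PBv_contr]. *)
Definition LBr (s t : V * V * W) : V * V * W :=
  (br s.1.1 t.1.2 - br t.1.1 s.1.2, br s.1.2 t.1.2, cs s.1.2 t.2 - cs t.1.2 s.2).

(** The solution of [i_X Omega = - t] without its group component; [v.1.2 + cs v.2 v.1.1] is the
    trivialised covector N. *)
Definition Xham (v : W * W * V) (t : V * V * W) : W * W * V :=
  (t.2 + cs t.1.2 v.1.1,
   cs t.1.2 (v.1.2 + cs v.2 v.1.1) - cs (- t.1.1 - br v.2 t.1.2) v.1.1 - cs v.2 (t.2 + cs t.1.2 v.1.1),
   - t.1.1 - br v.2 t.1.2).

Let E := (prDl, prDr, prNl, prNr, brDl, brDr, brNl, brNr, prcs).

(** Antisymmetry and Jacobi under the pairing: [lra] treats values of [pr] as atoms, so it suffices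
    to supply the right instances. *)
Let brCp m x y : pr m (br x y) = - pr m (br y x).
Proof. by rewrite brC prNr. Qed.

Let brCp2 m x y z : pr m (br (br x y) z) = - pr m (br (br y x) z).
Proof. by rewrite (brC x y) brNl prNr. Qed.

Let brJp m x y z : pr m (br x (br y z)) = pr m (br (br x y) z) + pr m (br y (br x z)).
Proof. by rewrite brJ prDr. Qed.

Lemma contr_Xham v s t : contr (Xham v t) s = PBv v s t.
Proof.
case: v s t => [[mu nu] xi] [[a b] c] [[a' b'] c']; rewrite /contr /Xham /PBv /= !E.
have := brJp mu xi b' b; have := brCp nu b b'; have := brCp mu b' a.
have := brCp c' b xi; have := brCp c b' xi; lra.
Qed.

Lemma PBv_antisym v s t : PBv v s t = - PBv v t s.
Proof.
case: v s t => [[mu nu] xi] [[a b] c] [[a' b'] c']; rewrite /PBv /= !E.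
have := brCp nu b b'; lra.
Qed.

Lemma PBv_contr v s t : PBv v s t = pr t.2 s.1.1 - pr s.2 t.1.1 + contr v (LBr s t).
Proof. by rewrite /PBv /contr /LBr /=; ring. Qed.

(** Jacobi for [LBr] together with the cocycle condition on the constant part; the hypotheses fed to
    [lra] are grouped by mu, nu, xi and the constant terms. *)
Lemma PBv_jacobi v s t r :
  PBv v (LBr s t) r + PBv v (LBr t r) s + PBv v (LBr r s) t = 0.
Proof.
case: v s t r => [[mu nu] xi] [[a1 b1] c1] [[a2 b2] c2] [[a3 b3] c3].
have jac m a x y : pr m (br (br a x) y) - pr m (br (br a y) x) - pr m (br a (br x y)) = 0.
  have := brJp m a x y; have := brCp m x (br a y); lra.
have hmu : pr mu (br (br a1 b2) b3) - pr mu (br (br a1 b3) b2) - pr mu (br a1 (br b2 b3)) +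
   (pr mu (br (br a2 b3) b1) - pr mu (br (br a2 b1) b3) - pr mu (br a2 (br b3 b1))) +
   (pr mu (br (br a3 b1) b2) - pr mu (br (br a3 b2) b1) - pr mu (br a3 (br b1 b2))) = 0.
  by rewrite !jac !addr0.
have hnu : pr nu (br (br b1 b2) b3) + pr nu (br (br b2 b3) b1) + pr nu (br (br b3 b1) b2) = 0.
  have := jac nu b1 b2 b3; have := brCp2 nu b1 b3 b2; have := brCp nu b1 (br b2 b3); lra.
have x1 := brJp c1 b2 b3 xi; have x2 := brJp c2 b3 b1 xi; have x3 := brJp c3 b1 b2 xi.
have y1 := brCp c1 b2 a3; have y2 := brCp c1 b3 a2; have y3 := brCp c2 b1 a3.
have y4 := brCp c2 b3 a1; have y5 := brCp c3 b1 a2; have y6 := brCp c3 b2 a1.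
rewrite /PBv /LBr /= !E; lra.
Qed.

End BracketAlgebra.

(** * Manifold structures on vector spaces, products and bijective images *)

Section Manifolds.
Context {R : realType}.
Implicit Types E F : normedModType R.

Lemma atlas_manifold (M : Type) E (A : atlas M E) : is_atlas A ->
  (forall x y, x <> y -> exists U V : set M,
        [/\ mopen A U, mopen A V, U x, V y & U `&` V = set0]) ->
  (exists B : nat -> set M, (forall i, mopen A (B i)) /\
        forall U x, mopen A U -> U x -> exists i, B i x /\ B i `<=` U) ->
  is_manifold A.
Proof.
move=> Aa T2 SC; have [A1 A2 A3] := Aa; split=> // x y /=; split.
  rewrite openE => _ [z [xz yz] <-]; rewrite /interior /=.
  have [h _] := A3 _ _ _ xz yz; apply: filterS h => e [h1 [h2 h3]].
  by exists (cinv (A x) e).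
by apply: sm_smooth => _ [z [xz yz] <-]; have [] := A3 _ _ _ xz yz.
Qed.

Lemma rat_approx (r d : R) : 0 < d -> exists q : rat, `|r - ratr q| < d.
Proof.
move=> d0; have /rat_in_itvoo[q] : r - d < r + d by lra.
by rewrite in_itv /= => /andP[h1 h2]; exists q; rewrite ltr_norml; apply/andP; split; lra.
Qed.

(** Rational combinations of the [b i], with coordinates within [d / (S + 1)]; the 1 covers
    [S = 0]. *)
Lemma findim_dense E : findim E -> exists (J : countType) (s : J -> E),
  forall x (d : R), 0 < d -> exists j, `|x - s j| < d.
Proof.
case=> [[I [b [c [_ cE]]]]].
exists {ffun I -> rat}, (fun q : {ffun I -> rat} => \sum_i ratr (q i) *: b i) => x d d0.
pose S := \sum_i `|b i|.
have S0 : 0 <= S by apply: sumr_ge0.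
have d1 : 0 < d / (S + 1) by rewrite divr_gt0 // ltr_wpDl.
have /choice[q qx] i : exists q : rat, `|c i x - ratr q| < d / (S + 1) by exact: rat_approx.
exists [ffun i => q i].
rewrite {1}[x]cE -sumrB; apply: (le_lt_trans (ler_norm_sum _ _ _)).
apply: (@le_lt_trans _ _ (\sum_i (d / (S + 1)) * `|b i|)).
  apply: ler_sum => i _; rewrite ffunE -scalerBl normrZ ler_wpM2r //.
  exact: ltW (qx i).
rewrite -mulr_sumr -/S mulrAC ltr_pdivrMr ?ltr_wpDl // ltr_pM2l //; lra.
Qed.

Lemma vec_manifold E : findim E -> is_manifold (vec_atlas E).
Proof.
move=> Ef; apply: atlas_manifold; first exact: vec_is_atlas.
  move=> x y xy; pose d := `|x - y| / 2.
  have d0 : 0 < d by rewrite divr_gt0 // normr_gt0 subr_eq0; apply/eqP.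
  exists (ball x d), (ball y d); split; [exact/mopen_vec/ball_open|exact/mopen_vec/ball_open|exact: ballxx|exact: ballxx|].
  apply/seteqP; split=> // z []; rewrite -!ball_normE /= => h1 h2.
  have := ler_distD z x y; rewrite (distrC z y).
  have : `|x - y| = d + d by rewrite /d; lra.
  by move=> ->; lra.
have [J [s sE]] := findim_dense Ef.
(* A countable base: balls of radius [1 / (k + 1)] about a countable dense family; codes that decode
   to nothing give the empty set. *)
exists (fun i => if unpickle i is Some (j, k) then ball (s j) k.+1%:R^-1 else set0); split.
  move=> i; case: unpickle => [[j k]|]; apply/mopen_vec; last exact: open0.
  exact: ball_open.
move=> U x /mopen_vec Uo Ux.
have [d d0 dU] := near_ball (open_near Uo Ux).
have [k kd] : exists k : nat, (k.+1%:R^-1 : R) < d / 2.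
  have [k _ /(_ k (leqnn k))] := near_infty_natSinv_lt (PosNum (divr_gt0 d0 (ltr0n R 2))).
  by move=> h; exists k.
have k0 : (0 : R) < k.+1%:R^-1 by rewrite invr_gt0.
have [j xj] := sE x _ k0.
exists (pickle (j, k)); rewrite pickleK; split.
  by rewrite -ball_normE /= distrC.
move=> z; rewrite -ball_normE /= => zj; apply: dU.
apply: (le_lt_trans (ler_distD (s j) z x)); rewrite (splitr d) (distrC z (s j)) (distrC (s j) x).
by apply: ltrD; [exact: lt_trans zj kd|exact: lt_trans xj kd].
Qed.

Section Prod.
Context {M N : Type} {E F : normedModType R} (A : atlas M E) (B : atlas N F).
Hypotheses (Am : is_manifold A) (Bm : is_manifold B) (Ef : findim E) (Ff : findim F).
Let Aa := manifold_atlas Am.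
Let Ba := manifold_atlas Bm.
Let ABa : is_atlas (prod_atlas A B) := prod_is_atlas Aa Ba Ef Ff.
Let EFf : findim (E * F)%type. Proof. exact: _. Qed.

Lemma smooth_fst : smooth (prod_atlas A B) A fst.
Proof.
apply: (psm_smooth ABa) => x; have h := psm_cinv0 ABa EFf x.
by have [h' _] := (psm_prod A B Ef Ff _ _).1 h.
Qed.

Lemma smooth_snd : smooth (prod_atlas A B) B snd.
Proof.
apply: (psm_smooth ABa) => x; have h := psm_cinv0 ABa EFf x.
by have [_ h'] := (psm_prod A B Ef Ff _ _).1 h.
Qed.

Lemma prod_manifold : is_manifold (prod_atlas A B).
Proof.
have [_ _ _ T2A [P [Po PB]]] := Am; have [_ _ _ T2B [Q [Qo QB]]] := Bm.
have o1 U : mopen A U -> mopen (prod_atlas A B) (fst @^-1` U).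
  by move=> Uo; exact: (smooth_mopen ABa Aa EFf smooth_fst Uo).
have o2 U : mopen B U -> mopen (prod_atlas A B) (snd @^-1` U).
  by move=> Uo; exact: (smooth_mopen ABa Ba EFf smooth_snd Uo).
apply: atlas_manifold => //.
  move=> [x y] [x' y'] ne; have [xx'|xx'] := pselect (x = x').
    have /T2B[U [V [Uo Vo Uy Vy UV]]] : y <> y' by move=> yy'; apply: ne; rewrite xx' yy'.
    exists (snd @^-1` U), (snd @^-1` V); split; [exact: o2|exact: o2|done|done|].
    by rewrite -preimage_setI UV preimage_set0.
  have [U [V [Uo Vo Ux Vx UV]]] := T2A _ _ xx'.
  exists (fst @^-1` U), (fst @^-1` V); split; [exact: o1|exact: o1|done|done|].
  by rewrite -preimage_setI UV preimage_set0.
exists (fun i => if unpickle i is Some (j, k) then fst @^-1` (P j) `&` snd @^-1` (Q k) else set0).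
split.
  move=> i; case: unpickle => [[j k]|].
    apply/(mopenP ABa EFf) => x [x1 x2]; have cx := psm_cinv0 ABa EFf x.
    apply: filterI; apply: (mopen_plot ABa cx); rewrite ?(cmapK ABa) //.
      exact: o1.
    exact: o2.
  by apply/(mopenP ABa EFf).
move=> U [x y] Uo Uxy.
(* A box inside U is found in the product chart, then shrunk to a base set in each factor. *)
have [[Y1 Y2] [n1 n2] Y12] := (mopenP ABa EFf U).2 Uo _ Uxy.
have [V1 [V1o V1x V1Y]] := near_open n1; have [V2 [V2o V2x V2Y]] := near_open n2.
have [A1 A2 _] := Aa; have [B1 B2 _] := Ba.
have [j [jx jS]] := PB _ x (mopen_chart Aa Ef x V1o) (conj (A1 x) V1x).
have [k [ky kS]] := QB _ y (mopen_chart Ba Ff y V2o) (conj (B1 y) V2x).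
exists (pickle (j, k)); rewrite pickleK; split=> // -[x' y'] [/= /jS[dx vx] /kS[dy vy]].
have /= := Y12 (cmap (A x) x', cmap (B y) y') (conj (V1Y _ vx) (V2Y _ vy)).
by rewrite A2 ?B2.
Qed.

End Prod.

Section Transport.
Context {M N : Type} {E : normedModType R} (A : atlas M E) (f : M -> N) (h : N -> M).
Hypotheses (Am : is_manifold A) (Ef : findim E) (fK : cancel f h) (hK : cancel h f).

Definition transport_atlas : atlas N E := fun y =>
  Chart (h @^-1` cdom (A (h y))) (fun z => cmap (A (h y)) (h z)) (fun e => f (cinv (A (h y)) e)).

Let Aa := manifold_atlas Am.

Lemma transport_is_atlas : is_atlas transport_atlas.
Proof.
have [A1 A2 A3] := Aa; split=> [x|x y xy|x y z xz yz] /=; first exact: A1.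
  by rewrite A2 // hK.
have [n s] := A3 _ _ _ xz yz; split; first by apply: filterS n => e; rewrite fK.
by apply: sm_ext s; apply: nearW => e /=; rewrite fK.
Qed.

Lemma transport_mopen U : mopen A U -> mopen transport_atlas (h @^-1` U).
Proof.
move=> Uo; apply/(mopenP transport_is_atlas Ef) => x Ux /=.
by have := (mopenP Aa Ef U).2 Uo _ Ux; apply: filterS => e; rewrite fK.
Qed.

Lemma transport_mopenV U : mopen transport_atlas U -> mopen A (f @^-1` U).
Proof.
move=> Uo; apply/(mopenP Aa Ef) => x Ux /=.
by have := (mopenP transport_is_atlas Ef U).2 Uo _ Ux; rewrite /= fK.
Qed.

Lemma transport_manifold : is_manifold transport_atlas.
Proof.
have [_ _ _ T2 [P [Po PB]]] := Am.
apply: atlas_manifold; first exact: transport_is_atlas.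
  move=> x y xy; have /T2[U [V [Uo Vo Ux Vy UV]]] : h x <> h y by move/(can_inj hK).
  exists (h @^-1` U), (h @^-1` V); split=> //; [exact: transport_mopen|exact: transport_mopen|].
  by rewrite -preimage_setI UV preimage_set0.
exists (fun i => h @^-1` (P i)); split=> [i|U x Uo Ux]; first exact: transport_mopen.
have [|i [ix iU]] := PB _ (h x) (transport_mopenV Uo); first by rewrite /= hK.
by exists i; split=> // y /= /iU /=; rewrite hK.
Qed.

End Transport.
End Manifolds.

(** * The reduced bracket and Hamiltonian vectors *)

Section PoissonReduction.
Context {R : realType} {n : nat} {G : groupType} (A : atlas G 'rV[R]_n).
Hypothesis hG : lie_group A.
Local Notation g := ('rV[R]_n).
Local Notation gd := ('cV[R]_n).
Local Notation VV := ('cV[R]_n * 'cV[R]_n * 'rV[R]_n)%type.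
Local Notation DV := ('rV[R]_n * 'rV[R]_n * 'cV[R]_n)%type.
Local Notation PPA := (PP_atlas A).
Let Aa := lie_atlas hG.
Let Ef : findim g := findim_mx _ _.
Let Df : findim gd := findim_mx _ _.
Let VVf : findim VV. Proof. exact: _. Qed.
Let DVf : findim DV. Proof. exact: _. Qed.

Local Notation PB := (PBv (@pairing R n) (adl A) (adsl A)).
Local Notation ct := (contr (@pairing R n)).
Local Notation XH := (Xham (adl A) (adsl A)).
Local Notation LB := (LBr (adl A) (adsl A)).

Definition grad (H : VV -> R) (v : VV) : DV := (ddmu H v, ddnu H v, ddxi H v).

Lemma linearR (E : normedModType R) (f : E -> R^o) :
  (forall a x y, f (a *: x + y) = a * f x + f y) -> linear f.
Proof. by []. Qed.

Let ringDZ (a x1 x2 y1 y2 z1 z2 : R) :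
  a * x1 + x2 + (a * y1 + y2) + (a * z1 + z2) = a * (x1 + y1 + z1) + (x2 + y2 + z2).
Proof. by ring. Qed.

Let ringBZ (a x1 x2 y1 y2 : R) :
  a * x1 + x2 - (a * y1 + y2) = a * (x1 - y1) + (x2 - y2).
Proof. by ring. Qed.

Let pE := (@pairingDl R n, @pairingDr R n, @pairingZl R n, @pairingZr R n).

Lemma contr_linearl t : linear (fun w => ct w t : R^o).
Proof. by apply: linearR => a w w'; rewrite /contr /= !pE ringDZ. Qed.

Lemma contr_linearr w : linear (fun t => ct w t : R^o).
Proof. by apply: linearR => a t t'; rewrite /contr /= !pE ringDZ. Qed.

Definition PB0 (s t : DV) : R := pairing t.2 s.1.1 - pairing s.2 t.1.1.

Lemma PB0_linearl t : linear (fun s => PB0 s t : R^o).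
Proof. by apply: linearR => a w w'; rewrite /PB0 /= !pE ringBZ. Qed.

Lemma PB0_linearr s : linear (fun t => PB0 s t : R^o).
Proof. by apply: linearR => a w w'; rewrite /PB0 /= !pE ringBZ. Qed.

Lemma linear_zero (E F : normedModType R) (f : E -> F) : linear f -> f 0 = 0.
Proof. by move=> fl; have [L ->] := linear_pack fl; rewrite linear0. Qed.

Lemma near_all (E : normedModType R) (x : E) (P : E -> Prop) :
  (forall y, P y) -> \forall y \near x, P y.
Proof. exact: nearW. Qed.

Lemma triple_eq (S T U : Type) (p q : S * T * U) :
  p.1.1 = q.1.1 -> p.1.2 = q.1.2 -> p.2 = q.2 -> p = q.
Proof. by case: p q => [[? ?] ?] [[? ?] ?] /= -> -> ->. Qed.

Lemma LBr_linearl (t : DV) : linear (fun s : DV => LB s t : DV).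
Proof.
move=> a x y; apply: triple_eq; rewrite /LBr /=.
- by rewrite (adl_linearl A) (adl_linearr hG) scalerBr opprD addrACA.
- by rewrite (adl_linearl A).
- by rewrite (adstar_linearl hG) (adstar_linearr hG) scalerBr opprD addrACA.
Qed.

Lemma LBr_linearr (s : DV) : linear (fun t : DV => LB s t : DV).
Proof.
move=> a x y; apply: triple_eq; rewrite /LBr /=.
- by rewrite (adl_linearl A) (adl_linearr hG) scalerBr opprD addrACA.
- by rewrite (adl_linearr hG).
- by rewrite (adstar_linearl hG) (adstar_linearr hG) scalerBr opprD addrACA.
Qed.

Lemma d_grad (H : VV -> R^o) v w : sm v H -> 'd H v w = ct w (grad H v).
Proof.
move=> /sm_diff Hd; rewrite /contr /grad /ddmu /ddnu /ddxi /=.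
have [L LE] := linear_pack (linearP ('d H v)).
have DE u : 'D_u H v = L u by rewrite deriveE // LE.
rewrite (pairing_dvec (f := fun l => 'D_(l, 0, 0) H v)); last first.
  by move=> a x y; rewrite !DE -linearP; congr (L _); apply: triple_eq => /=; rewrite ?(scaler0, addr0).
rewrite (pairing_dvec (f := fun l => 'D_(0, l, 0) H v)); last first.
  by move=> a x y; rewrite !DE -linearP; congr (L _); apply: triple_eq => /=; rewrite ?(scaler0, addr0).
rewrite (pairing_covec (f := fun l => 'D_(0, 0, l) H v)); last first.
  by move=> a x y; rewrite !DE -linearP; congr (L _); apply: triple_eq => /=; rewrite ?(scaler0, addr0).
rewrite !DE LE -!linearD; case: w => [[w1 w2] w3].
by congr (L _); apply: triple_eq => /=; rewrite ?(addr0, add0r).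
Qed.

Lemma reduced_bracketE H K v : reduced_bracket A H K v = PB v (grad H v) (grad K v).
Proof. by rewrite /PBv adlE adslE; case: v => [[mu nu] xi]. Qed.

Lemma sm_grad (H : VV -> R^o) v : sm v H -> sm v (grad H).
Proof.
move=> Hs; apply: sm_pair; [apply: sm_pair|]; [apply: sm_dvec|apply: sm_dvec|apply: sm_covec];
  by move=> m; apply: (sm_D _ Hs).
Qed.

Lemma sm_PB (s t : VV -> DV) v : sm v s -> sm v t ->
  sm v (fun x => PB x (s x) (t x) : R^o).
Proof.
move=> ss st.
have h1 : sm v (fun x => PB0 (s x) (t x) : R^o).
  by apply: sm_bil ss st => // a; [exact: PB0_linearr|exact: PB0_linearl].
have h2 : sm v (fun x => LB (s x) (t x) : DV).
  by apply: sm_bil ss st => // a; [exact: LBr_linearr|exact: LBr_linearl].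
have h3 : sm v (fun x : VV => ct x (LB (s x) (t x)) : R^o).
  apply: (sm_bil (B := fun w d => ct w d : R^o) VVf DVf _ _ (sm_id v) h2) => a.
    exact: contr_linearr.
  exact: contr_linearl.
by apply: sm_ext (sm_add h1 h3); apply: near_all => x; rewrite PBv_contr.
Qed.

(** Three arguments move: the two differentials, and the point, which enters linearly and only
    through the [LBr] part. *)
Lemma der_PB (s t : VV -> DV) v w s' t' : der s v w s' -> der t v w t' ->
  der (fun x => PB x (s x) (t x) : R^o) v w
    (PB v s' (t v) + PB v (s v) t' + ct w (LB (s v) (t v))).
Proof.
move=> ds dt.
have h1 : der (fun x => PB0 (s x) (t x) : R^o) v w (PB0 s' (t v) + PB0 (s v) t').
  by apply: (der_bil (B := fun a b => PB0 a b : R^o) _ _ _ _ ds dt) => // a; [exact: PB0_linearr|exact: PB0_linearl].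
have h2 : der (fun x => LB (s x) (t x) : DV) v w (LB s' (t v) + LB (s v) t').
  by apply: (der_bil (B := fun a b => LB a b : DV) _ _ _ _ ds dt) => // a; [exact: LBr_linearr|exact: LBr_linearl].
have h3 : der (fun x : VV => ct x (LB (s x) (t x)) : R^o) v w
    (ct w (LB (s v) (t v)) + ct v (LB s' (t v) + LB (s v) t')).
  apply: (der_bil (B := fun w d => ct w d : R^o) VVf DVf _ _ (der_id v w) h2) => a.
    exact: contr_linearr.
  exact: contr_linearl.
apply: der_near (der_eq (der_add h1 h3) _); first by apply: near_all => x; rewrite PBv_contr.
have -> : ct v (LB s' (t v) + LB (s v) t') = ct v (LB s' (t v)) + ct v (LB (s v) t').
  by have := contr_linearr v 1 (LB s' (t v)) (LB (s v) t'); rewrite !scale1r.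
rewrite !PBv_contr -!/(PB0 _ _).
move: (PB0 _ _) (PB0 _ _) (ct _ _) (ct _ _) (ct _ _) => a b c d e; ring.
Qed.

Let adJ := adl_jacobi hG.
Let adsP (x : g) (m : gd) (y : g) : pairing (adsl A x m) y = - pairing m (adl A x y).
Proof. exact: pairing_adstar. Qed.

Lemma PB_ham v s t : ct (XH v t) s = PB v s t.
Proof.
exact: (contr_Xham (@pairingDl R n) (@pairingDr R n) (@pairingNl R n) (@pairingNr R n) (adDl A) (adNl A) (adlC hG) adJ adsP).
Qed.

Lemma PB_antisym v s t : PB v s t = - PB v t s.
Proof.
exact: (PBv_antisym (@pairingDl R n) (@pairingDr R n) (@pairingNl R n) (@pairingNr R n) (adlC hG) adsP).
Qed.

Lemma PB_jacobi v s t r : PB v (LB s t) r + PB v (LB t r) s + PB v (LB r s) t = 0.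
Proof.
exact: (PBv_jacobi (@pairingDl R n) (@pairingDr R n) (@pairingNl R n) (@pairingNr R n) (adDl A) (adNl A) (adlC hG) adJ adsP).
Qed.

Local Notation br := (reduced_bracket A).

Lemma bracket_deriv (H K : VV -> R) v : sm v (H : VV -> R^o) ->
  br H K v = 'd (H : VV -> R^o) v (XH v (grad K v)).
Proof. by move=> Hs; rewrite reduced_bracketE d_grad // PB_ham. Qed.

Lemma sm_bracket (H K : VV -> R) v : sm v (H : VV -> R^o) -> sm v (K : VV -> R^o) ->
  sm v (br H K : VV -> R^o).
Proof.
move=> Hs Ks; apply: sm_ext (sm_PB (sm_grad Hs) (sm_grad Ks)).
by apply: near_all => x; rewrite reduced_bracketE.
Qed.

(** The Hessian, written through [grad] so that it can be paired with Hamiltonian vectors. *)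
Definition hess (H : VV -> R) v (u w : VV) : R := ct w ('d (grad H) v u).

Lemma hessC (H : VV -> R^o) v u w : sm v H -> hess H v u w = hess H v w u.
Proof.
have hE u' w' : sm v H -> hess H v u' w' = 'D_u' ('D_w' H) v.
  move=> Hs; symmetry; apply: der_D.
  have dg := sm_der u' (sm_grad Hs).
  apply: der_near (der_lin DVf (contr_linearr w') dg).
  apply: filterS (sm_near Hs) => y Hy; rewrite -(d_grad w' Hy) deriveE //; exact: sm_diff Hy.
by move=> Hs; exact: (etrans (hE u w Hs) (etrans (schwarz _ _ _ Hs) (esym (hE w u Hs)))).
Qed.

(** Differentiating the bracket of f and h along [X k] gives one Hessian term for each of them and
    an algebraic term; in the cyclic sum the symmetric Hessians cancel in pairs. *)
Lemma bracket_bracket (f h k : VV -> R^o) v : sm v f -> sm v h -> sm v k ->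
  let X := fun f => XH v (grad f v) in
  br (br f h) k v = hess f v (X k) (X h) - hess h v (X k) (X f)
    + PB v (LB (grad f v) (grad h v)) (grad k v).
Proof.
move=> fs hs ks X; rewrite (bracket_deriv _ (sm_bracket fs hs)).
have df := sm_der (X k) (sm_grad fs); have dh := sm_der (X k) (sm_grad hs).
rewrite (der_d (der_near _ (der_PB df dh))); last by apply: near_all => x; rewrite reduced_bracketE.
have e1 := esym (PB_ham v ('d (grad f) v (X k)) (grad h v)).
have e2 := etrans (PB_antisym v (grad f v) ('d (grad h) v (X k)))
  (congr1 -%R (esym (PB_ham v ('d (grad h) v (X k)) (grad f v)))).
exact: (congr2 _ (congr2 _ e1 e2) (PB_ham v _ _)).
Qed.

Lemma bracket_poisson : poisson_manifold (vec_atlas VV) br.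
Proof.
split; first exact: vec_manifold.
move=> f h k /smooth_vecP fs /smooth_vecP hs /smooth_vecP ks; split.
- by apply/smooth_vecP => v; exact: sm_bracket.
- by move=> v; rewrite !reduced_bracketE PB_antisym.
- move=> a v; rewrite bracket_deriv; last by apply: sm_add => //; apply: (sm_lin (L := fun x : R^o => a *: x)) => // b x y; rewrite scalerDr !scalerA mulrC.
  rewrite !bracket_deriv //; apply: der_d; apply: der_add; last exact: sm_der.
  exact: (der_scalec a (sm_der _ (fs v))).
- move=> v; rewrite bracket_deriv; last exact: sm_mul.
  rewrite !bracket_deriv //; apply: der_d.
  apply: (der_eq (der_scale (sm_der _ (fs v)) (sm_der _ (hs v)))).
  by rewrite addrC; congr (_ + _); rewrite mulrC.
- move=> v; rewrite !bracket_bracket //.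
  have := PB_jacobi v (grad f v) (grad h v) (grad k v).
  rewrite (hessC _ _ (fs v)) (hessC _ _ (hs v)) (hessC _ _ (ks v)).
  move: (hess _ _ _ _) (hess _ _ _ _) (hess _ _ _ _) => a b c.
  move: (PB _ _ _) (PB _ _ _) (PB _ _ _) => x y z xyz.
  by rewrite -[RHS]xyz; ring.
Qed.

Local Notation shift := (shift A).

Lemma mulgK_orbit (x y : G) (v : VV) : exists z, (y, v) = act_P (x, v) z.
Proof. by exists (x^-1 * y)%g; rewrite /act_P /= mulgA mulgV mul1g. Qed.

Let PPa : is_atlas PPA := PP_is_atlas hG.
Let PPf : findim (g * VV)%type. Proof. exact: _. Qed.

Lemma tmap_snd (p : PP R n G) v : tmap PPA (vec_atlas VV) snd p v = v.2.
Proof. by apply: der_d; exact: (der_snd Ef VVf (der_id _ _)). Qed.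

Lemma dfun_snd (k : VV -> R^o) (p : PP R n G) v : sm p.2 k ->
  dfun PPA (k \o snd) p v = ct v.2 (grad k p.2).
Proof.
move=> ks; apply: der_d.
apply: (der_eq (der_comp (der_snd Ef VVf (der_id _ _)) (sm_der v.2 _))); last exact: d_grad.
exact: ks.
Qed.

(** The equivalence supplies existence and uniqueness of the Hamiltonian vector at once. *)
Lemma omega_ham (p : PP R n G) (X : g * VV) (t : DV) :
  (forall V, omega_P A p X V = - ct V.2 t) <-> X = (lam A p.1 t.1.2, XH p.2 t).
Proof.
have r0 : rho A p.1 0 = 0 by exact: (linear_zero (rho_linear A p.1)).
pose mu := p.2.1.1; pose xi := p.2.2; pose N := shift p.2.
have dsE l m z : dshift A p.2 (l, m, z) = m + (adsl A z mu + adsl A xi l) by [].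
have ads0 x : adsl A x 0 = 0 by exact: (linear_zero (adstar_linearr hG x)).
have adsl0 m : adsl A 0 m = 0 by exact: (linear_zero (adstar_linearl hG m)).
split=> [H|-> [r' [[l' m'] z']]].
  case: X H => r [[l m] z] H; case: t H => [[a b] c] H.
  have H0 r' l' m' z' : pairing (m + (adsl A z mu + adsl A xi l)) (rho A p.1 r')
      - pairing (m' + (adsl A z' mu + adsl A xi l')) (rho A p.1 r)
      + pairing N (adl A (rho A p.1 r) (rho A p.1 r')) + (pairing l' z - pairing l z')
      = - (pairing l' a + pairing m' b + pairing c z').
    have := H (r', (l', m', z')); rewrite omega_PE //; exact.
  (* Testing along nu gives the group component; the tests along mu, xi and the group then give z, l
     and m, each from components already known. *)
  have rE : rho A p.1 r = b.
    apply: vec_eq => m'; have := H0 0 0 m' 0.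
    rewrite r0 (ad0r hG) ads0 adsl0 !addr0 !(pairing0l, pairing0r) !(sub0r, add0r, addr0, subr0).
    by move/oppr_inj.
  have zE : z = - a - adl A xi b.
    apply: vec_eq => l'; have := H0 0 l' 0 0.
    rewrite r0 (ad0r hG) adsl0 !add0r rE (pairing_adstar hG) !(pairing0l, pairing0r).
    rewrite !(sub0r, add0r, addr0, subr0) opprK pairingDr !pairingNr; lra.
  have lE : l = c + adsl A b mu.
    apply: covec_eq => z'; have := H0 0 0 0 z'.
    rewrite r0 (ad0r hG) ads0 !(add0r, addr0) rE (pairing_adstar hG) !(pairing0l, pairing0r).
    rewrite !(sub0r, add0r, addr0, subr0) opprK pairingDl (pairing_adstar hG) (adlC hG b) pairingNr.
    by lra.
  have mE : m = adsl A b N - adsl A z mu - adsl A xi l.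
    clearbody N; apply: covec_eq => v; have := H0 (lam A p.1 v) 0 0 0.
    rewrite (rho_lam hG) ads0 adsl0 !(add0r, addr0) rE !(pairing0l, pairing0r).
    rewrite !(sub0r, add0r, addr0, subr0, oppr0) !pairingE (pairing_adstar hG b); lra.
  by rewrite -[r](lam_rho hG p.1) rE; congr (_, (_, _, _)) => //=; rewrite ?mE zE lE.
rewrite omega_PE //= (rho_lam hG) !dsE /Xham /= -/mu -/xi -/N.
have NE : p.2.1.2 + adsl A xi mu = N by [].
rewrite /contr /= NE; clearbody N.
rewrite !(pairingDl, pairingNl, pairingDr, pairingNr).
rewrite (pairing_adstar hG _ N) (pairing_adstar hG xi l').
have -> : pairing (adsl A z' mu) t.1.2 = - pairing (adsl A t.1.2 mu) z'.
  by rewrite !(pairing_adstar hG) (adlC hG) pairingNr.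
lra.
Qed.

Lemma poisson_red : poisson_reduction PPA (omega_P A) (@act_P R n G) (vec_atlas VV) snd
  (reduced_bracket A).
Proof.
have Gm : is_manifold A by have [] := hG.
split.
- split; first exact: (smooth_snd Gm (vec_manifold VVf) Ef VVf).
  by move=> p w; exists (0, w); rewrite tmap_snd.
- by move=> q; exists (1%g, q).
- move=> [x v] [y w]; split=> [/= ->|[z]]; first exact: mulgK_orbit.
  by rewrite /act_P => -[].
- exact: bracket_poisson.
move=> h k /smooth_vecP hs /smooth_vecP ks p.
have hamP X : ham_vec PPA (omega_P A) (k \o snd) p X <-> X = (lam A p.1 (ddnu k p.2), XH p.2 (grad k p.2)).
  rewrite -(omega_ham p X (grad k p.2)) /ham_vec.
  by split=> H V; rewrite H dfun_snd.
exists (lam A p.1 (ddnu k p.2), XH p.2 (grad k p.2)); split.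
  by split; [exact/hamP|move=> X /hamP].
by rewrite dfun_snd // PB_ham reduced_bracketE.
Qed.

End PoissonReduction.

(** * Coadjoint orbits *)

Section Minor.
Context {F : fieldType}.

(** One-sided inverses of the factors in the full-rank factorisation compress M to the identity. *)
Lemma full_minor (n d : nat) (M : 'M[F]_n) : \rank M = d ->
  exists (P : 'M[F]_(n, d)) (Q : 'M[F]_(d, n)), Q *m M *m P = 1%:M.
Proof.
move=> <-; exists (pinvmx (row_base M)), (pinvmx (col_base M)).
have minor M' : col_base M *m row_base M = M' ->
    pinvmx (col_base M) *m M' *m pinvmx (row_base M) = 1%:M.
  have h := mulVpmx (col_base_full M).
  move=> <-; rewrite (mulmxA (pinvmx _)) h mul1mx.
  by rewrite mulmxVp // row_base_free.
exact: minor (mulmx_base M).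
Qed.

(** Right multiplication by P preserves the rank of M, so the row space of M meets the kernel of P
    only in 0. *)
Lemma minor_kernel (n d : nat) (M : 'M[F]_n) (P : 'M[F]_(n, d)) (Q : 'M[F]_(d, n)) (v : 'rV_n) :
  \rank M = d -> Q *m M *m P \in unitmx -> v *m M *m P = 0 -> v *m M = 0.
Proof.
move=> rM QMP vMP; apply/eqP; rewrite -submx0.
have rMP : \rank (M *m P) = \rank M.
  have := mxrankM_maxr Q (M *m P); rewrite mulmxA (mxrank_unit QMP) => dMP.
  by apply/eqP; rewrite eqn_leq mxrankM_maxl /= rM.
have : \rank (M :&: kermx P)%MS = 0%N.
  by apply/eqP; rewrite -(eqn_add2l (\rank (M *m P))) mxrank_mul_ker rMP addn0.
move/eqP; rewrite mxrank_eq0 => /eqP <-.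
by rewrite sub_capmx submxMl /=; apply/sub_kermxP.
Qed.

End Minor.

(** * Local sections of the orbit map *)

Section OrbitSection.
Context {R : realType} {n : nat} {G : groupType} (A : atlas G 'rV[R]_n).
Hypothesis hG : lie_group A.
Local Notation g := ('rV[R]_n).
Local Notation gd := ('cV[R]_n).
Implicit Types m : gd.
Let Aa := lie_atlas hG.
Let Ef : findim g := findim_mx _ _.
Let Df : findim gd := findim_mx _ _.

(** The rows are the generators of the basis vectors at m, so the row space is the tangent space of
    the orbit and the rank its dimension. *)
Definition gmx m : 'M[R]_n := \matrix_i (adsl A (delta_mx 0 i) m)^T.

Lemma gmxE m v : (adsl A v m)^T = v *m gmx m.
Proof.
apply: (linear_row_mx (L := fun v => (adsl A v m)^T)) => a x y.
by rewrite (adstar_linearl hG) linearP.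
Qed.

Lemma gmx_linear : linear gmx.
Proof. by move=> a x y; apply/matrixP => i j; rewrite !mxE (adstar_linearr hG) !mxE. Qed.

(** Equivariance of ad^* makes the matrix at the translated point a two-sided multiple of the one at
    m. *)
Lemma rank_gmx_le y m : (\rank (gmx (Adsl A y m)) <= \rank (gmx m))%N.
Proof.
pose D := \matrix_i Adl A y^-1%g (delta_mx 0 i).
have DE v : Adl A y^-1%g v = v *m D by apply: linear_row_mx; exact: Adl_linear.
pose E := \matrix_i (Adsl A y (delta_mx 0 i)^T)^T.
have EE v : (Adsl A y v^T)^T = v *m E.
  apply: (linear_row_mx (L := fun v : g => (Adsl A y v^T)^T)) => a u w.
  by rewrite linearP Adstar_linear linearP.
suff -> : gmx (Adsl A y m) = D *m gmx m *m E.
  exact: leq_trans (mxrankM_maxl _ _) (mxrankM_maxr _ _).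
apply/row_matrixP => i; rewrite !rowE -gmxE !mulmxA -DE -gmxE -EE trmxK (Adstar_adstar hG).
by rewrite (AdlKV hG).
Qed.

Lemma rank_gmx y m : \rank (gmx (Adsl A y m)) = \rank (gmx m).
Proof.
apply/eqP; rewrite eqn_leq rank_gmx_le /=.
by have := rank_gmx_le y^-1%g (Adsl A y m); rewrite (AdstarK hG).
Qed.

Section Point.
Context (mu : gd) (d : nat).
Hypothesis rmu : \rank (gmx mu) = d.
Local Notation f x := (Adsl A x mu).

(* A local section s of the orbit map, defined on the image of an injective
   projection L of the orbit, valid on W *)
Definition orbit_section (m0 : gd) (L : gd -> 'rV[R]_d) (K : 'rV[R]_d -> g)
    (s : 'rV[R]_d -> G) (W : set G) : Prop :=
  [/\ linear L, forall b, L (adsl A (K b) m0) = b,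
      forall v, L (adsl A v m0) = 0 -> adsl A v m0 = 0,
      mopen A W &
      forall x, W x -> [/\ f (s (L (f x))) = f x, psm A s (L (f x)) &
        \forall b \near L (f x), L (f (s b)) = b]].

(** Straightened by F, the map [L (fe e)] becomes the linear map [A0] up to a constant; constancy of
    the rank then makes [fe] itself, locally, a function of [A0]. *)
Lemma orbit_section_exists (x0 : G) : exists L K s W, orbit_section (f x0) L K s W /\ W x0.
Proof.
pose m0 := f x0.
have [P [Q PQ]] : exists (P : 'M[R]_(n, d)) (Q : 'M[R]_(d, n)), Q *m gmx m0 *m P = 1%:M.
  by apply: full_minor; rewrite rank_gmx.
pose L (m : gd) : 'rV[R]_d := m^T *m P; pose K (b : 'rV[R]_d) : g := b *m Q.
have Ll : linear L by move=> a x y; rewrite /L linearP mulmxDl scalemxAl.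
have Kl : linear K by move=> a x y; rewrite /K mulmxDl scalemxAl.
have df : findim 'rV[R]_d := findim_mx _ _.
have LS v m : L (adsl A v m) = v *m gmx m *m P by rewrite /L gmxE.
have LSK b : L (adsl A (K b) m0) = b by rewrite LS /K -!mulmxA (mulmxA Q) PQ mulmx1.
have ker x v : Q *m gmx (f x) *m P \in unitmx -> L (adsl A v (f x)) = 0 -> adsl A v (f x) = 0.
  move=> u; rewrite LS => /(minor_kernel _ u) h; apply: trmx_inj.
  by rewrite gmxE h ?trmx0 // rank_gmx.
pose c := cinv (A x0); pose e0 := cmap (A x0) x0; pose fe e := f (c e).
have ce0 : c e0 = x0 := cmapK Aa x0.
have pc : psm A c e0 := psm_cinv0 Aa Ef x0.
have sfe e : psm A c e -> sm e fe by move=> h; apply: (sm_Adstar hG) => //; exact: sm_cst.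
have dfe e v : psm A c e -> der fe e v (adsl A (rv A c e v) (fe e)) by move=> h; exact: der_Adstar.
pose A0 v := L (adsl A (rho A x0 v) m0); pose K' b := lam A x0 (K b).
have A0l : linear A0 by move=> a x y; rewrite /A0 rho_linear (adstar_linearl hG) Ll.
have K'l : linear K' by move=> a x y; rewrite /K' Kl lam_linear.
have A0K b : A0 (K' b) = b by rewrite /A0 /K' (rho_lam hG) LSK.
pose b0 := L m0.
(* F replaces the part of [e - e0] seen by [A0] with the nonlinear [L (fe e) - b0], whence [LF]; the
   two corrections agree to first order, so the derivative at [e0] is the identity. *)
pose F e := e - K' (A0 (e - e0)) + K' (L (fe e) - b0).
have [A0' A0E] := linear_pack A0l; have [K'' K'E] := linear_pack K'l.
have A0D x y : A0 (x + y) = A0 x + A0 y by rewrite A0E linearD.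
have A0B x y : A0 (x - y) = A0 x - A0 y by rewrite A0E linearB.
have LF e : L (fe e) = A0 (F e) - A0 e0 + b0.
  rewrite /F A0D !A0B !A0K.
  move: (A0 e) (A0 e0) (L (fe e)) => u v w.
  by rewrite subKr [v + _]addrC addrK subrK.
have Fs : sm e0 F.
  apply: sm_add; first apply: sm_sub; first exact: sm_id.
    apply: sm_lin => //; apply: sm_lin => //; apply: sm_sub; [exact: sm_id|exact: sm_cst].
  apply: sm_lin => //; apply: sm_sub; last exact: sm_cst.
  by apply: sm_lin => //; exact: sfe.
have Fd v : 'd F e0 v = v.
  have d1 := der_lin df K'l (der_lin Ef A0l (der_sub (der_id e0 v) (der_cst e0 e0 v))).
  have d2 := der_lin df K'l (der_sub (der_lin Df Ll (dfe e0 v pc)) (der_cst b0 e0 v)).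
  rewrite (der_d (der_add (der_sub (der_id e0 v) d1) d2)) !subr0.
  have -> : rv A c e0 v = rho A x0 v by rewrite /rho -lock.
  by rewrite /fe ce0 -/m0 -/(A0 v) subrK.
have [Fi [Fis FFi FiF]] := inverse_function Fs Fd.
have Fe0 : F e0 = e0.
  rewrite /F subrr A0E linear0 K'E linear0 subr0 /fe ce0 -/m0 -/b0 subrr linear0.
  by rewrite addr0.
have Fie0 : Fi e0 = e0 by rewrite -{1}Fe0; exact: (nbhs_singleton FiF).
rewrite Fe0 in Fis FFi.
(* Invertibility of the compressed matrix persists near [e0]; by [ker] it keeps L injective on the
   tangent spaces of the orbit at nearby points. *)
pose good e := psm A c e /\ Q *m gmx (fe e) *m P \in unitmx.
have ngood : \forall e \near e0, good e.
  suff : \forall e \near e0, Q *m gmx (fe e) *m P \in unitmx.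
    by apply: filterS2 (psm_near Aa Ef pc) => e h1 h2.
  have s1 : sm e0 (fun e => \det (Q *m gmx (fe e) *m P) : R^o).
    apply: sm_det; apply: (sm_lin (L := fun m => Q *m gmx m *m P) Df); last exact: sfe.
    by move=> a x y; rewrite gmx_linear linearP mulmxDl -scalemxAl.
  have d0 : \det (Q *m gmx (fe e0) *m P) != 0 by rewrite /fe ce0 PQ det1 oner_neq0.
  have h := @cvgr_neq0 _ _ _ _ (nbhs_filter e0) _ _ (sm_cont s1) d0.
  move: h.
  by apply: filterS => e; rewrite unitmxE unitfE.
pose ok y := [/\ F (Fi y) = y, sm y Fi & good (Fi y)].
have nok : \forall y \near e0, ok y.
  have n3 : \forall y \near e0, good (Fi y) by apply: (near_pull Fis); rewrite Fie0.
  by apply: filterS3 FFi (sm_near Fis) n3 => y.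
have [r r0 okr] := near_ball nok.
pose h y := fe (Fi y).
have sh y : ok y -> sm y h.
  by move=> [_ s1 [p1 _]]; apply: (sm_comp Ef s1); exact: sfe.
have Lh y : ok y -> L (h y) = A0 y - A0 e0 + b0 by move=> [FF _ _]; rewrite /h LF FF.
(* Along a fibre of [A0], h moves tangentially to the orbit with zero image under L, hence with zero
   derivative. *)
have dh y w : `|y - e0| < r -> A0 w = 0 -> der h y w 0.
  move=> yr A0w; have [FF s1 [p1 u1]] := okr y yr.
  have dD := der_comp (sm_der w s1) (dfe _ ('d Fi y w) p1).
  apply: (der_eq dD); apply: ker => //.
  rewrite -A0w; have d1 := der_lin Df Ll dD.
  have d2 : der (fun z => A0 z - A0 e0 + b0) y w (A0 w - 0 + 0).
    by apply: der_add (der_cst _ _ _); apply: der_sub (der_cst _ _ _); exact: der_lin (der_id y w).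
  rewrite subr0 addr0 in d2.
  have yo : \forall z \near y, `|z - e0| < r.
    apply: filterS (ball_near y (_ : 0 < r - `|y - e0|)); last by rewrite subr_gt0.
    move=> z zy; have := ler_distD y z e0; lra.
  have d3 : der (fun z => L (h z)) y w (A0 w).
    by apply: der_near d2; apply: filterS yo => z /okr /Lh.
  exact: etrans (esym (der_d d1)) (der_d d3).
(* The ball is convex, so h is constant along the segment from y to y'. *)
have hE y y' : `|y - e0| < r -> `|y' - e0| < r -> A0 y = A0 y' -> h y' = h y.
  move=> yr yr' AA; have A0w : A0 (y' - y) = 0.
    by rewrite A0B AA subrr.
  rewrite -[in LHS](subrK y y') [y' - y + y]addrC; apply: mean_value_const => t t01.
  apply: dh => //; pose k := Num.max `|y - e0| `|y' - e0|.
  apply: (@le_lt_trans _ _ k); last by rewrite gt_max yr yr'.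
  apply: segment_ball t01; rewrite ?le_max ?lexx ?orbT //.
  by rewrite [y + (y' - y)]addrC subrK lexx orbT.
(* An affine section through [e0] of [A0] up to a constant; [Fi] and the chart lift it to G. *)
pose sg b := e0 + K' (b - b0).
have ssg b : sm b sg.
  apply: sm_add; first exact: sm_cst.
  by apply: sm_lin => //; apply: sm_sub; [exact: sm_id|exact: sm_cst].
have sgb0 : sg b0 = e0 by rewrite /sg subrr K'E linear0 addr0.
pose s b := c (Fi (sg b)).
have ps b : ok (sg b) -> psm A s b.
  move=> [_ s1 [p1 _]].
  exact: (psm_comp (p := c) (g := fun b => Fi (sg b)) Ef p1 (sm_comp Ef (ssg b) s1)).
have Ls b : ok (sg b) -> L (f (s b)) = b.
  move=> /Lh; rewrite /h /fe -/(s b) => ->.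
  by rewrite /sg A0D A0K [A0 e0 + _]addrC addrK subrK.
have noks : \forall b \near b0, `|sg b - e0| < r.
  have := ball_near e0 r0; rewrite -{1}sgb0; exact: (near_pull (ssg b0)).
have L0 : L (fe e0) = b0 by rewrite /fe ce0.
have sL : sm e0 (fun e => L (fe e)) by apply: sm_lin => //; exact: sfe.
(* Both [F e] and [sg (L (fe e))] have to lie in the ball: they have the same image under [A0], so h
   agrees at them. *)
have nW : \forall e \near e0, [/\ Fi (F e) = e, `|F e - e0| < r,
    `|sg (L (fe e)) - e0| < r & \forall b \near L (fe e), `|sg b - e0| < r].
  have n2 : \forall e \near e0, `|F e - e0| < r.
    by have := ball_near e0 r0; rewrite -{1}Fe0; exact: (near_pull Fs).
  have n34 : \forall b \near b0, `|sg b - e0| < r /\ \forall b' \near b, `|sg b' - e0| < r.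
    by apply: filterS2 noks (near_join noks) => b.
  rewrite -{1}L0 in n34; have n5 := near_pull sL n34.
  by apply: filterS3 FiF n2 n5 => e h1 h2 [h3 h4].
have [V [Vo Ve0 VW]] := near_open nW.
exists L, K, s, (cdom (A x0) `&` cmap (A x0) @^-1` V); split; last first.
  by split => //; have [] := Aa.
split => //.
- by move=> v; apply: ker; rewrite -/m0 PQ unitmx1.
- exact: mopen_chart.
move=> x [xx0 /VW[h1 h2 h3 h4]].
have xE : c (cmap (A x0) x) = x by have [_ /(_ _ _ xx0)] := Aa.
rewrite /fe xE in h3 h4.
split.
- have := hE _ _ h2 h3 _; rewrite /h /fe h1 xE -/(s _); apply.
  have /Lh := okr _ h2; rewrite /h h1 /fe xE => ->.
  rewrite /sg A0D A0K addrK [RHS]addrC subrK //.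
- exact: ps (okr _ h3).
- by apply: filterS h4 => b /okr /Ls.
Qed.

End Point.
End OrbitSection.

(** * The manifold structure of the orbit *)

Section OrbitAtlas.
Context {R : realType} {n : nat} {G : groupType} (A : atlas G 'rV[R]_n).
Hypothesis hG : lie_group A.
Variable mu : 'cV[R]_n.
Local Notation g := ('rV[R]_n).
Local Notation gd := ('cV[R]_n).
Local Notation f x := (Adsl A x mu).
Local Notation OS := (orbit_space A mu).
Local Notation d := (\rank (gmx A mu)).
Local Notation om := (orbit_map A mu).
Let Aa := lie_atlas hG.
Let Ef : findim g := findim_mx _ _.
Let Df : findim gd := findim_mx _ _.
Let df : findim 'rV[R]_d := findim_mx _ _.

Record orbit_chart := OrbitChart {
  och_L : gd -> 'rV[R]_d;
  och_K : 'rV[R]_d -> g;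
  och_s : 'rV[R]_d -> G;
  och_W : set G }.

Definition orbit_chart_at (o : OS) (c : orbit_chart) : Prop :=
  orbit_section A mu (sval o) (och_L c) (och_K c) (och_s c) (och_W c) /\
  exists2 x, och_W c x & f x = sval o.

Lemma sval_orbit_map x : sval (om x) = f x.
Proof. by rewrite AdslE. Qed.

Lemma orbit_eq (o o' : OS) : sval o = sval o' -> o = o'.
Proof. by case: o o' => [m p] [m' p'] /= e; subst m'; congr exist; exact: Prop_irrelevance. Qed.

Lemma orbit_rep (o : OS) : exists x, o = om x.
Proof. by case: o => m [x xm]; exists x; exact: orbit_eq. Qed.

Lemma orbit_charts_exist : exists ch : OS -> orbit_chart, forall o, orbit_chart_at o (ch o).
Proof.
have /choice[c hc] : forall o, exists c, orbit_chart_at o c; last by exists c.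
move=> o; have [x oE] := orbit_rep o.
have [L [K [s [W [h Wx]]]]] := orbit_section_exists hG (erefl d) x.
exists (OrbitChart L K s W); rewrite /orbit_chart_at oE sval_orbit_map; split => //.
by exists x.
Qed.

Lemma stab_shift x y z : f x = f y -> f (z * (y^-1 * x))%g = f z.
Proof. by move=> xy; rewrite !(AdstarM hG) xy (AdstarK hG). Qed.

(* The stabiliser element (q k)^-1 * x, acting on the right, leaves f \o q unchanged
   and moves q k to the point x of W *)
Lemma near_orbit_dom (K : normedModType R) (q : K -> G) (k : K) (W : set G) x : psm A q k -> mopen A W -> W x ->
  f x = f (q k) -> \forall k' \near k, exists2 y, W y & f y = f (q k').
Proof.
move=> qk Wo Wx xq.
have pq : psm A (fun k' => q k' * ((q k)^-1 * x))%g k by apply: psmM => //; exact: psm_cst.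
have Wk : W (q k * ((q k)^-1 * x))%g by rewrite mulgA mulgV mul1g.
have := mopen_plot Aa pq Wo Wk; apply: filterS => k' Wk'.
by exists (q k' * ((q k)^-1 * x))%g => //; exact: stab_shift.
Qed.

Variable ch : OS -> orbit_chart.
Hypothesis hch : forall o, orbit_chart_at o (ch o).

(** A chart domain is the image of an open set of G rather than the trace of a neighbourhood in g^*,
    since an orbit may return arbitrarily close to itself. *)
Definition orbit_atlas : atlas OS 'rV[R]_d := fun o =>
  Chart [set o' | exists2 x, och_W (ch o) x & f x = sval o'] (fun o' => och_L (ch o) (sval o'))
    (fun b => om (och_s (ch o) b)).

Local Notation B := orbit_atlas.
Local Notation sec o := (och_s (ch o)).

Lemma och_linear o : linear (och_L (ch o)). Proof. by have [[]] := hch o. Qed.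
Lemma och_section o b : och_L (ch o) (adsl A (och_K (ch o) b) (sval o)) = b.
Proof. by have [[]] := hch o. Qed.
Lemma och_ker o v : och_L (ch o) (adsl A v (sval o)) = 0 -> adsl A v (sval o) = 0.
Proof. by have [[_ _ h _ _] _] := hch o; exact: h. Qed.
Lemma och_open o : mopen A (och_W (ch o)). Proof. by have [[]] := hch o. Qed.

Lemma och_dom o o' : cdom (B o) o' -> [/\ f (sec o (cmap (B o) o')) = sval o',
  psm A (sec o) (cmap (B o) o') &
  \forall b \near cmap (B o) o', och_L (ch o) (f (sec o b)) = b].
Proof. by move=> [x Wx xo]; have [[_ _ _ _ h] _] := hch o; have := h x Wx; rewrite xo. Qed.

Lemma och_center o : cdom (B o) o. Proof. by have [] := hch o. Qed.

Lemma near_orbit_cdom (K : normedModType R) (q : K -> G) (k : K) o : psm A q k -> cdom (B o) (om (q k)) ->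
  \forall k' \near k, cdom (B o) (om (q k')).
Proof.
move=> qk [x Wx]; rewrite sval_orbit_map => xq.
have := near_orbit_dom qk (@och_open o) Wx xq; apply: filterS => k' [y Wy yq].
by exists y; rewrite ?sval_orbit_map.
Qed.

Lemma sm_och (K : normedModType R) (q : K -> G) (k : K) o : findim K -> psm A q k ->
  sm k (fun k' => och_L (ch o) (sval (om (q k')))).
Proof.
move=> Kf qk; apply: (sm_lin Df (och_linear o)).
by rewrite /= -AdslE; apply: (sm_Adstar hG) => //; exact: sm_cst.
Qed.

Lemma orbit_is_atlas : is_atlas B.
Proof.
split.
- exact: och_center.
- by move=> o o' /och_dom[h _ _]; apply: orbit_eq; rewrite sval_orbit_map.
move=> o1 o2 o h1 h2; have [e1 p1 n1] := och_dom h1.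
have oE : o = om (sec o1 (cmap (B o1) o)) by apply: orbit_eq; rewrite sval_orbit_map.
split; last exact: sm_och.
have d1 : cdom (B o1) (om (sec o1 (cmap (B o1) o))) by rewrite -oE.
have d2 : cdom (B o2) (om (sec o1 (cmap (B o1) o))) by rewrite -oE.
apply: filterS3 (near_orbit_cdom p1 d1) (near_orbit_cdom p1 d2) n1 => b c1 c2 c3.
split; [exact: c1|split; [exact: c2|]].
exact: etrans (congr1 (och_L (ch o1)) (sval_orbit_map _)) c3.
Qed.

Let Ba := orbit_is_atlas.

Lemma psm_orbit_map (K : normedModType R) (q : K -> G) (k : K) : findim K -> psm A q k -> psm B (fun k' => om (q k')) k.
Proof.
move=> Kf qk; split; last exact: sm_och.
exact: near_orbit_cdom qk (@och_center _).
Qed.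

Lemma smooth_orbit_map : smooth A B om.
Proof. by apply: psm_smooth => // x; apply: psm_orbit_map => //; exact: psm_cinv0. Qed.

Lemma sec_center o : [/\ f (sec o (cmap (B o) o)) = sval o, psm A (sec o) (cmap (B o) o) &
  \forall b \near cmap (B o) o, och_L (ch o) (f (sec o b)) = b].
Proof. exact/och_dom/och_center. Qed.

Lemma smooth_incl : smooth B (vec_atlas gd) (@orbit_incl _ _ _ A mu).
Proof.
apply: psm_smooth => // o; apply/psm_vec; have [_ p _] := sec_center o.
apply: sm_ext (sm_Adstar hG df p (sm_cst mu _)); apply: near_all => b.
exact: esym (sval_orbit_map _).
Qed.

Lemma tmap_incl o t : tmap B (vec_atlas gd) (@orbit_incl _ _ _ A mu) o t =
  adsl A (rv A (sec o) (cmap (B o) o) t) (sval o).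
Proof.
have [e p _] := sec_center o; rewrite -e; apply: der_d.
apply: der_near (der_Adstar hG df t mu p); apply: near_all => b.
by rewrite /local_rep /= AdslE.
Qed.

Lemma tmap_orbit_map x v :
  tmap A B om x v = och_L (ch (om x)) (adsl A (rho A x v) (f x)).
Proof.
apply: der_d; apply: der_near (der_lin Df (och_linear _) (der_eq (der_Adstar hG Ef v mu (psm_cinv0 Aa Ef x)) _)).
  by apply: near_all => e; rewrite /local_rep /= AdslE.
by rewrite (cmapK Aa) /rho -lock.
Qed.

(** The coordinate is the restriction of a linear map on g^*, so applied to the ambient velocity it
    recovers the components. *)
Lemma och_tmap_incl o t :
  och_L (ch o) (tmap B (vec_atlas gd) (@orbit_incl _ _ _ A mu) o t) = t.
Proof.
have [e p h] := sec_center o; rewrite tmap_incl -e.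
rewrite -(der_d (der_lin Df (och_linear o) (der_Adstar hG df t mu p))).
by apply: der_d; apply: der_near (der_id _ t); apply: filterS h => b ->.
Qed.

Lemma immersion_incl : immersion B (vec_atlas gd) (@orbit_incl _ _ _ A mu).
Proof.
split; first exact: smooth_incl.
by move=> o t t' tt'; rewrite -(och_tmap_incl o t) tt' och_tmap_incl.
Qed.

Lemma submersion_orbit_map : submersion A B om.
Proof.
split; first exact: smooth_orbit_map.
move=> x w; exists (lam A x (och_K (ch (om x)) w)).
by rewrite tmap_orbit_map (rho_lam hG) -sval_orbit_map och_section.
Qed.

(** A stabiliser element moves any representative of the point into U. *)
Lemma orbit_map_open U : mopen A U -> mopen B (om @` U).
Proof.
move=> Uo; apply/(mopenP Ba df) => o [x Ux xo].
have [e p _] := sec_center o.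
have xe : f x = f (sec o (cmap (B o) o)) by rewrite e -xo sval_orbit_map.
have := near_orbit_dom p Uo Ux xe; apply: filterS => b [y Uy yb].
exists y; first exact: Uy.
exact: orbit_eq (etrans (sval_orbit_map y) (etrans yb (esym (sval_orbit_map _)))).
Qed.

(** Separation comes from g^* through the injective inclusion, countability from G through the open
    orbit map. *)
Lemma orbit_manifold : is_manifold B.
Proof.
have [[_ _ _ _ [P [Po PB]]] _ _] := hG.
apply: atlas_manifold => //.
  have [_ _ _ T2 _] := vec_manifold Df => o o' oo'.
  have /T2[U [V [Uo Vo Uu Vv UV]]] : sval o <> sval o' by move/orbit_eq.
  exists (@orbit_incl _ _ _ A mu @^-1` U), (@orbit_incl _ _ _ A mu @^-1` V); split => //.
  - exact: (smooth_mopen Ba vec_is_atlas df smooth_incl Uo).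
  - exact: (smooth_mopen Ba vec_is_atlas df smooth_incl Vo).
  - by rewrite -preimage_setI UV preimage_set0.
exists (fun i => om @` P i); split=> [i|U o Uo Uoo]; first exact: orbit_map_open.
have [x oE] := orbit_rep o; rewrite oE in Uoo *.
have [i [ix iU]] := PB _ x (smooth_mopen Aa Ba Ef smooth_orbit_map Uo) Uoo.
by exists i; split; [exists x|move=> _ [y /iU yU <-]].
Qed.

Lemma orbit_structureB : orbit_structure B.
Proof. by split; [exact: orbit_manifold|exact: submersion_orbit_map|exact: immersion_incl]. Qed.

Lemma is_genE o eta t : is_gen B o eta t <->
  adsl A (rv A (sec o) (cmap (B o) o) t) (sval o) = adsl A eta (sval o).
Proof. by rewrite /is_gen tmap_incl -adslE. Qed.

Lemma gen_exists o t : is_gen B o (rv A (sec o) (cmap (B o) o) t) t.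
Proof. exact/is_genE. Qed.

(** The generator and the ambient image of its component vector have the same projection under
    [och_L], which is injective on the tangent space. *)
Lemma gen_velocity o eta : is_gen B o eta (och_L (ch o) (adsl A eta (sval o))).
Proof.
apply/is_genE; set t := och_L _ _; apply/eqP; rewrite -subr_eq0; apply/eqP.
have adB x y m : adsl A (x - y) m = adsl A x m - adsl A y m.
  have [L LE] := linear_pack (adstar_linearl hG m).
  have E z : adsl A z m = L z by rewrite -LE.
  by rewrite !E linearB.
rewrite -adB; apply: och_ker; rewrite adB -tmap_incl.
have [L LE] := linear_pack (och_linear o).
by rewrite LE linearB -LE och_tmap_incl subrr.
Qed.

End OrbitAtlas.

(** * Marsden-Weinstein reduction *)

Section MarsdenWeinstein.
Context {R : realType} {n : nat} {G : groupType} (A : atlas G 'rV[R]_n).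
Hypothesis hG : lie_group A.
Variable mu : 'cV[R]_n.
Local Notation g := ('rV[R]_n).
Local Notation gd := ('cV[R]_n).
Local Notation VV := ('cV[R]_n * 'cV[R]_n * 'rV[R]_n)%type.
Local Notation f x := (Adsl A x mu).
Local Notation OS := (orbit_space A mu).
Local Notation d := (\rank (gmx A mu)).
Local Notation om := (orbit_map A mu).
Local Notation PPA := (PP_atlas A).
Let Aa := lie_atlas hG.
Let Am : is_manifold A. Proof. by have [] := hG. Qed.
Let Ef : findim g := findim_mx _ _.
Let Df : findim gd := findim_mx _ _.
Let df : findim 'rV[R]_d := findim_mx _ _.
Let VVf : findim VV. Proof. exact: _. Qed.
Let PPf : findim (g * VV)%type. Proof. exact: _. Qed.

Local Notation HC := (g * gd * g)%type.
Local Notation HQ := ('rV[R]_d * gd * g)%type.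
Let HC1f : findim (g * gd)%type. Proof. exact: _. Qed.
Let HCf : findim HC. Proof. exact: _. Qed.
Let HQ1f : findim ('rV[R]_d * gd)%type. Proof. exact: _. Qed.
Let HQf : findim HQ. Proof. exact: _. Qed.

(** * The level set of the momentum map *)

Section LevelSet.
Local Notation CP := {p : PP R n G | momentum A p = mu}.
Local Notation CMA := (prod_atlas (prod_atlas A (vec_atlas gd)) (vec_atlas g)).

Definition level_pt (z : G * gd * g) : PP R n G :=
  (z.1.1, (z.1.2, f z.1.1 - adsl A z.2 z.1.2, z.2)).

Lemma shift_level_pt z : shift A (level_pt z).2 = f z.1.1.
Proof. by rewrite /shift /= subrK. Qed.

Lemma momentum_level_pt z : momentum A (level_pt z) = mu.
Proof. by rewrite (momentumE hG) shift_level_pt (AdstarK hG). Qed.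

Definition of_level (z : G * gd * g) : CP := exist _ (level_pt z) (momentum_level_pt z).

Definition to_level (p : PP R n G) : G * gd * g := (p.1, p.2.1.1, p.2.2).

Lemma level_shift (p : PP R n G) : momentum A p = mu -> shift A p.2 = f p.1.
Proof. by rewrite (momentumE hG) => <-; rewrite (AdstarKV hG). Qed.

Lemma level_ptK (p : PP R n G) : momentum A p = mu -> level_pt (to_level p) = p.
Proof.
move/level_shift; case: p => [x [[m v] z]] /=; rewrite /level_pt /shift /= => <-.
by rewrite addrK.
Qed.

Lemma level_snd (p p' : PP R n G) : momentum A p = mu -> momentum A p' = mu ->
  f p.1 = f p'.1 -> p.2.1.1 = p'.2.1.1 -> p.2.2 = p'.2.2 -> p.2 = p'.2.
Proof.
move=> /level_shift h /level_shift h' ff e1 e2; apply: triple_eq => //.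
move: h; rewrite ff -h' /shift e1 e2; exact: addIr.
Qed.

Lemma CP_eq (z z' : CP) : sval z = sval z' -> z = z'.
Proof. by case: z z' => [p hp] [p' hp'] /= e; subst p'; congr exist; exact: Prop_irrelevance. Qed.

Lemma of_levelK : cancel of_level (fun z => to_level (sval z)).
Proof. by case=> [[x m] z]. Qed.

Lemma to_levelK : cancel (fun z => to_level (sval z)) of_level.
Proof. by move=> z; apply: CP_eq; exact: level_ptK (svalP z). Qed.

Definition level_atlas : atlas CP HC :=
  transport_atlas CMA of_level (fun z => to_level (sval z)).
Local Notation C := level_atlas.

Let CMm : is_manifold CMA.
Proof.
apply: prod_manifold => //; last exact: vec_manifold.
by apply: prod_manifold => //; exact: vec_manifold.
Qed.
Lemma level_manifold : is_manifold C.
Proof. exact: (transport_manifold CMm HCf of_levelK to_levelK). Qed.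

Let Ca := manifold_atlas level_manifold.

Lemma psm_level (K : normedModType R) (q : K -> CP) k : psm C q k <->
  [/\ psm A (fun k' => (sval (q k')).1) k, sm k (fun k' => (sval (q k')).2.1.1) &
      sm k (fun k' => (sval (q k')).2.2)].
Proof.
transitivity (psm CMA (fun k' => to_level (sval (q k'))) k); first by split.
rewrite (psm_prod _ _ HC1f Ef) (psm_prod _ _ Ef Df) !psm_vec.
by split=> [[[? ?] ?]|[? ? ?]]; split.
Qed.

Lemma psm_level_pt (K : normedModType R) (q : K -> G) (m : K -> gd) (z : K -> g) k :
  findim K -> psm A q k -> sm k m -> sm k z -> psm PPA (fun k' => level_pt (q k', m k', z k')) k.
Proof.
move=> Kf pq sm_ sz; apply/psm_PP => //; split=> //=.
apply: sm_pair => //; apply: sm_pair => //; apply: sm_sub.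
  by apply: (sm_Adstar hG) => //; exact: sm_cst.
exact: (sm_adstar hG).
Qed.

Let c11 (q : HC) : sm q (fun e : HC => e.1.1).
Proof. exact: (sm_fst Ef Df (sm_fst HC1f Ef (sm_id q))). Qed.
Let c12 (q : HC) : sm q (fun e : HC => e.1.2).
Proof. exact: (sm_snd Ef Df (sm_fst HC1f Ef (sm_id q))). Qed.
Let c2 (q : HC) : sm q (fun e : HC => e.2).
Proof. exact: (sm_snd HC1f Ef (sm_id q)). Qed.

Let cx (z : CP) : psm A (fun e : HC => cinv (A (sval z).1) e.1.1) (cmap (C z) z).
Proof.
have h : psm A (cinv (A (sval z).1)) ((cmap (C z) z : HC).1.1) by exact: psm_cinv0.
exact: (psm_comp (g := fun e : HC => e.1.1) Ef h (c11 _)).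
Qed.

Lemma smooth_sval : smooth C PPA (fun z => sval z).
Proof. by apply: (psm_smooth Ca) => z; apply: psm_level_pt HCf _ _ _; [exact: cx|exact: c12|exact: c2]. Qed.

(* The inclusion has the smooth retraction p |-> of_level (to_level p) *)
Lemma smooth_retraction : smooth PPA C (fun p => of_level (to_level p)).
Proof.
have PPa := PP_is_atlas hG.
apply: (psm_smooth PPa) => p; have [p1 p2] := (psm_PP A _ _).1 (psm_cinv0 PPa PPf p).
by apply/psm_level; split; [exact: p1|exact: sm_mu p2|exact: sm_xi p2].
Qed.

(** The nu-component w stays implicit: differentiating the equation of the level set gives its
    shifted version, the only form in which [omega_P] uses it. *)
Lemma tmap_sval (z : CP) v : exists2 w,
  tmap C PPA (fun z => sval z) z v = (v.1.1, (v.1.2, w, v.2)) &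
  dshift A (sval z).2 (v.1.2, w, v.2) = adsl A (rho A (sval z).1 v.1.1) (f (sval z).1).
Proof.
pose x := (sval z).1; pose e0 : HC := cmap (C z) z.
pose F (e : HC) : VV := (level_pt (cinv (A x) e.1.1, e.1.2, e.2)).2.
have zE : of_level (to_level (sval z)) = z by exact: to_levelK.
have Fs : sm e0 F.
  by have [] := (psm_PP A _ _).1 (psm_level_pt HCf (cx z) (c12 e0) (c2 e0)).
have d11 : der (fun e : HC => e.1.1) e0 v v.1.1 := der_fst Ef Df (der_fst HC1f Ef (der_id e0 v)).
have d12 : der (fun e : HC => e.1.2) e0 v v.1.2 := der_snd Ef Df (der_fst HC1f Ef (der_id e0 v)).
have d2 : der (fun e : HC => e.2) e0 v v.2 := der_snd HC1f Ef (der_id e0 v).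
have dF := sm_der v Fs.
have FE : 'd F e0 v = (v.1.2, ('d F e0 v).1.2, v.2).
  apply: triple_eq => //=.
    by rewrite -(der_d (der_mu dF)) (der_d d12).
  by rewrite -(der_d (der_xi dF)) (der_d d2).
exists ('d F e0 v).1.2; last first.
  have e1 : F e0 = (sval z).2 by rewrite -[in RHS]zE /F /= (cmapK Aa).
  rewrite -FE -e1 -(der_d (der_shift hG dF)).
  have d3 := der_comp d11 (der_Adstar hG Ef v.1.1 mu (psm_cinv0 Aa Ef x)).
  apply: der_d; apply: (der_near _ (der_eq d3 _)).
    by apply: near_all => e; rewrite /F shift_level_pt.
  by rewrite (cmapK Aa) /rho -lock.
rewrite -FE; apply: der_d; apply: der_near (der_pair d11 dF).
have n1 : \forall e \near e0, cmap (A x) (cinv (A x) e.1.1) = e.1.1.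
  have [A1 _ _] := Aa.
  have nA : \forall b \near e0.1.1, cmap (A x) (cinv (A x) b) = b.
    by apply: filterS (atlas_near Aa (A1 x)) => b [].
  exact: near_pull (c11 e0) nA.
by apply: filterS n1 => e h; rewrite /local_rep /= h.
Qed.

Lemma level_embedding : embedding C PPA (fun z => sval z).
Proof.
have PPa := PP_is_atlas hG.
split.
- split; first exact: smooth_sval.
  move=> z u v; have [w -> _] := tmap_sval z u; have [w' -> _] := tmap_sval z v.
  by case: u v => [[? ?] ?] [[? ?] ?] /= [-> -> _ ->].
- by move=> z z' /CP_eq.
move=> U; split=> [Uo|[V Vo ->]]; last exact: (smooth_mopen Ca PPa HCf smooth_sval Vo).
exists ((fun p => of_level (to_level p)) @^-1` U).
  exact: (smooth_mopen PPa Ca PPf smooth_retraction Uo).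
by apply/funext => z /=; rewrite to_levelK.
Qed.

End LevelSet.

(** * The reduced two-form and the projection *)

Section ReducedForm.
Variable ch : OS -> orbit_chart A mu.
Hypothesis hch : forall o, orbit_chart_at o (ch o).
Local Notation B := (orbit_atlas ch).
Local Notation QB := (QQ_atlas B).
Local Notation sec o := (och_s (ch o)).
Let Bm : is_manifold B := orbit_manifold hG hch.
Let Ba := manifold_atlas Bm.
Let QB1m : is_manifold (prod_atlas B (vec_atlas gd)).
Proof. by apply: prod_manifold => //; exact: vec_manifold. Qed.
Let QBm : is_manifold QB.
Proof. by apply: prod_manifold => //; exact: vec_manifold. Qed.
Let QBa := manifold_atlas QBm.

(** One definite generator of t, the right-trivialised velocity of the section; by [pairing_ad_gen]
    any other gives the same form. *)
Definition gen_of (o : OS) (t : 'rV[R]_d) : g := rv A (sec o) (cmap (B o) o) t.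

Definition reduced_form (q : QQ A mu) (u v : HQ) : R :=
  pairing v.1.2 u.2 - pairing u.1.2 v.2
  - pairing (sval q.1.1) (adl A (gen_of q.1.1 u.1.1) (gen_of q.1.1 v.1.1)).

(** [<m, [eta, eta']>] is [- <ad^*_eta m, eta'>], hence depends on eta only through its tangent
    vector; antisymmetry gives the same for eta'. *)
Lemma pairing_ad_gen (o : OS) eta eta' t t' : is_gen B o eta t -> is_gen B o eta' t' ->
  pairing (sval o) (adl A (gen_of o t) (gen_of o t')) = pairing (sval o) (adl A eta eta').
Proof.
move=> /(is_genE hG hch) h /(is_genE hG hch) h'; apply: oppr_inj.
rewrite -!(pairing_adstar hG) /gen_of h !(pairing_adstar hG); congr (- _).
rewrite (adlC hG) (adlC hG eta) !pairingNr -!(pairing_adstar hG) h'; exact: erefl.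
Qed.

Lemma reduced_form_specP : reduced_form_spec B reduced_form.
Proof.
move=> q eta eta' t t' l l' z z' h h'.
rewrite /reduced_form /= (pairing_ad_gen h h') adlE; exact: erefl.
Qed.

Lemma reduced_form_alternating : Defs.alternating reduced_form.
Proof.
move=> q; split=> [a u u' v|u v]; rewrite /reduced_form /=.
  rewrite /gen_of rv_linear (adl_linearl A) !(pairingDl, pairingDr, pairingZl, pairingZr).
  move: (pairing _ _) (pairing _ _) (pairing _ _) (pairing _ _) (pairing _ _) (pairing _ _).
  by move=> x1 x2 x3 x4 x5 x6; ring.
rewrite (adlC hG) pairingNr.
by move: (pairing _ _) (pairing _ _) (pairing _ _) => x1 x2 x3; ring.
Qed.

(** Tests in the linear factors isolate z and l. For t, testing on the velocities of all eta forces
    the ambient tangent vector of t to vanish. *)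
Lemma reduced_form_nondegenerate : Defs.nondegenerate reduced_form.
Proof.
move=> q [[t l] z] H; pose o := q.1.1.
have gen0 : gen_of o 0 = 0 by exact: (linear_zero (rv_linear A _ _)).
have z0 : z = 0.
  apply: vec_eq => l'; have := H (0, l', 0).
  by rewrite /reduced_form /= gen0 (ad0r hG) !pairing0r !subr0.
have l0 : l = 0.
  apply: covec_eq => z'; have := H (0, 0, z').
  by rewrite /reduced_form /= gen0 (ad0r hG) !pairing0r !pairing0l subr0 sub0r => /eqP; rewrite oppr_eq0 => /eqP.
suff t0 : adsl A (gen_of o t) (sval o) = 0.
  have := och_tmap_incl hG hch o t; rewrite (tmap_incl hG hch) -/(gen_of o t) t0.
  by rewrite (linear_zero (och_linear hch o)) => <-; rewrite z0 l0.
apply: covec_eq => eta; rewrite (pairing_adstar hG) pairing0l.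
rewrite -(pairing_ad_gen (gen_exists hG hch o t) (gen_velocity hG hch o eta)).
have := H (och_L (ch o) (adsl A eta (sval o)), 0, 0).
rewrite /reduced_form /= !pairing0r !pairing0l subrr sub0r; exact.
Qed.

Section Chart.
Variable q : QQ A mu.
Let s := sec q.1.1.
Let kap (b t t' : 'rV[R]_d) : R := pairing (f (s b)) (adl A (rv A s b t) (rv A s b t')).

Let psm_q (e : HQ) : psm A s e.1.1 -> psm QB (cinv (QB q)) e.
Proof.
move=> pe; apply/(psm_prod _ _ HQ1f Ef); split.
  apply/(psm_prod _ _ df Df); split.
    apply: (psm_orbit_map hG hch HQf (q := fun e : HQ => s e.1.1)).
    exact: (psm_comp (g := fun e : HQ => e.1.1) df pe (sm_fst df Df (sm_fst HQ1f Ef (sm_id e)))).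
  by apply/psm_vec; exact: (sm_snd df Df (sm_fst HQ1f Ef (sm_id e))).
by apply/psm_vec; exact: (sm_snd HQ1f Ef (sm_id e)).
Qed.

(** [pairing_ad_gen] allows the generators at the moving point to be replaced by velocities of the
    single section s; only the orbit term then varies with e. *)
Let rep2E (e u v : HQ) : psm A s e.1.1 ->
  rep2 QB reduced_form q u v e = pairing v.1.2 u.2 - pairing u.1.2 v.2 - kap e.1.1 u.1.1 v.1.1.
Proof.
move=> pe; have pq := psm_q pe.
have gE w : is_gen B (om (s e.1.1)) (rv A s e.1.1 w.1.1) (tinv QB q e w).1.1.
  have ps := psm_orbit_map hG hch df pe.
  have e1 := der_fst df Df (der_fst HQ1f Ef (vel_der w pq)).
  have e2 := der_comp (der_fst df Df (der_fst HQ1f Ef (der_id e w))) (vel_der w.1.1 ps).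
  have -> : (tinv QB q e w).1.1 = vel B (fun b => om (s b)) e.1.1 w.1.1.
    exact: (etrans (esym (der_d e1)) (der_d e2)).
  rewrite /is_gen (tmap_vel Ba _ (smooth_incl hG hch) ps) -adslE.
  have d1 : der (fun b => orbit_incl (om (s b))) e.1.1 w.1.1 (adsl A (rv A s e.1.1 w.1.1) (f (s e.1.1))).
    apply: der_near (der_Adstar hG df w.1.1 mu pe); apply: near_all => b.
    exact: esym (sval_orbit_map _ _ _).
  exact: etrans (der_d d1) (congr1 (adsl A _) (esym (sval_orbit_map A mu (s e.1.1)))).
have tE w : (tinv QB q e w).1.2 = w.1.2 /\ (tinv QB q e w).2 = w.2.
  split.
    apply: etrans (esym (der_d (der_snd df Df (der_fst HQ1f Ef (vel_der w pq))))) _.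
    exact: (der_d (der_snd df Df (der_fst HQ1f Ef (der_id e w)))).
  apply: etrans (esym (der_d (der_snd HQ1f Ef (vel_der w pq)))) _.
  exact: (der_d (der_snd HQ1f Ef (der_id e w))).
have [u1 u2] := tE u; have [v1 v2] := tE v.
rewrite /rep2 /reduced_form u1 u2 v1 v2; congr (_ - _).
apply: etrans (pairing_ad_gen (gE u) (gE v)) _.
exact: (congr1 (fun m => pairing m (adl A (rv A s e.1.1 u.1.1) (rv A s e.1.1 v.1.1)))
  (sval_orbit_map A mu (s e.1.1))).
Qed.

Let sm_kap b t t' : psm A s b -> sm b (fun b => kap b t t' : R^o).
Proof.
move=> pb; apply: sm_pairing; first by apply: (sm_Adstar hG) => //; exact: sm_cst.
apply: (sm_bil (B := adl A) Ef Ef (adl_linearr hG) (adl_linearl A)).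
  exact: (sm_rv hG df pb (sm_cst t b)).
exact: (sm_rv hG df pb (sm_cst t' b)).
Qed.

Lemma reduced_form_smooth_at : exists W : set HQ,
  [/\ open W, W (cmap (QB q) q), W `<=` cmap (QB q) @` cdom (QB q) &
      forall u v, smooth_on W (rep2 QB reduced_form q u v : HQ -> R^o)].
Proof.
have [_ ps _] := sec_center hch q.1.1.
have c11 (e : HQ) : sm e (fun e : HQ => e.1.1) := sm_fst df Df (sm_fst HQ1f Ef (sm_id e)).
have n1 : \forall e \near cmap (QB q) q, psm A s e.1.1.
  exact: (near_pull (c11 (cmap (QB q) q)) (psm_near Aa Ef ps)).
have [Q1 _ _] := QBa.
have [W [Wo Wq WP]] := near_open (filterI n1 (atlas_near QBa (Q1 q))).
exists W; split => //.
  by move=> e /WP[_ [h1 h2]]; exists (cinv (QB q) e).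
move=> u v; apply: sm_smooth => e /WP[pe _].
have h1 : sm e (fun e : HQ => pairing v.1.2 u.2 - pairing u.1.2 v.2 - kap e.1.1 u.1.1 v.1.1 : R^o).
  by apply: sm_sub; [exact: sm_cst|exact: (sm_comp df (c11 e) (sm_kap _ _ pe))].
apply: sm_ext h1.
have n2 := near_pull (c11 e) (psm_near Aa Ef pe).
by apply: filterS n2 => e' /rep2E ->.
Qed.

Let alp (t b : 'rV[R]_d) : R^o := pairing (f (s b)) (rv A s b t).

Let sm_alp t b : psm A s b -> sm b (alp t).
Proof.
move=> pb; apply: sm_pairing; first by apply: (sm_Adstar hG) => //; exact: sm_cst.
exact: (sm_rv hG df pb (sm_cst t b)).
Qed.

(* The orbit term is exact on the section: kappa = - d alpha, by Maurer-Cartan *)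
Let kapE b t t' : psm A s b -> kap b t t' = 'D_t' (alp t) b - 'D_t (alp t') b.
Proof.
move=> pb.
have da u v : 'D_u (alp v) b = pairing (adsl A (rv A s b u) (f (s b))) (rv A s b v)
    + pairing (f (s b)) ('D_u (fun b => rv A s b v) b).
  apply: der_D; apply: der_pairing; first exact: der_Adstar.
  have h := sm_rv hG df pb (sm_cst v b).
  by apply: (der_eq (sm_der u h)); rewrite deriveE //; exact: sm_diff h.
rewrite !da !(pairing_adstar hG).
have mc : 'D_t' (fun b => rv A s b t) b - 'D_t (fun b => rv A s b t') b = adl A (rv A s b t') (rv A s b t).
  by rewrite adlE; exact: (maurer_cartan hG df pb).
have := congr1 (pairing (f (s b))) mc; rewrite pairingDr pairingNr.
rewrite /kap (adlC hG (rv A s b t')) pairingNr.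
move: (pairing _ _) (pairing _ _) (pairing _ _) => x y z; lra.
Qed.

(** Each summand is a difference of second derivatives of [alp]; the six terms cancel pairwise by
    Schwarz. *)
Lemma reduced_form_closed_at u v w :
  'D_u (rep2 QB reduced_form q v w : HQ -> R^o) (cmap (QB q) q)
  + 'D_v (rep2 QB reduced_form q w u : HQ -> R^o) (cmap (QB q) q)
  + 'D_w (rep2 QB reduced_form q u v : HQ -> R^o) (cmap (QB q) q) = 0.
Proof.
have [_ ps _] := sec_center hch q.1.1.
pose e0 : HQ := cmap (QB q) q; pose b0 := cmap (B q.1.1) q.1.1.
have c11 : sm e0 (fun e : HQ => e.1.1) := sm_fst df Df (sm_fst HQ1f Ef (sm_id e0)).
have DE x y z : 'D_x (rep2 QB reduced_form q y z : HQ -> R^o) e0 =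
    'D_(x.1.1) ('D_(y.1.1) (alp z.1.1)) b0 - 'D_(x.1.1) ('D_(z.1.1) (alp y.1.1)) b0.
  have sk := sm_kap y.1.1 z.1.1 ps.
  have d1 := der_fst df Df (der_fst HQ1f Ef (der_id e0 x)).
  have d2 := der_comp d1 (sm_der x.1.1 sk).
  have d3 := der_sub (der_cst (pairing z.1.2 y.2 - pairing y.1.2 z.2 : R^o) e0 x) d2.
  have n2 := near_pull c11 (psm_near Aa Ef ps).
  have -> : 'D_x (rep2 QB reduced_form q y z : HQ -> R^o) e0 = 0 - 'd (fun b => kap b y.1.1 z.1.1 : R^o) b0 x.1.1.
    by apply: der_D; apply: der_near d3; apply: filterS n2 => e' /rep2E ->.
  have dd a c t : der ('D_a (alp c)) b0 t ('D_t ('D_a (alp c)) b0).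
    have h := sm_D a (sm_alp c ps).
    by apply: (der_eq (sm_der t h)); rewrite deriveE //; exact: sm_diff h.
  have d4 := der_sub (dd z.1.1 y.1.1 x.1.1) (dd y.1.1 z.1.1 x.1.1).
  rewrite (der_d (der_near _ d4)) ?sub0r ?opprB //.
  by apply: filterS (psm_near Aa Ef ps) => b /kapE ->.
rewrite !DE.
have sw x y z : 'D_y ('D_x (alp z)) b0 = 'D_x ('D_y (alp z)) b0 := schwarz x y findim_R (sm_alp z ps).
have key (V : zmodType) (a b c a' b' c' : V) :
    a = a' -> b = b' -> c = c' -> a - b + (c - a') + (b' - c') = 0.
  move=> -> -> ->; have -> : a' - b' + (c' - a') = c' - b' by rewrite addrC addrA subrK.
  by rewrite addrA subrK subrr.
exact: (key R^o _ _ _ _ _ _ (sw v.1.1 u.1.1 w.1.1) (sw w.1.1 u.1.1 v.1.1) (sw w.1.1 v.1.1 u.1.1)).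
Qed.

End Chart.

Lemma reduced_form_symplectic : symplectic QB reduced_form.
Proof.
split.
- exact: QBm.
- exact: reduced_form_smooth_at.
- exact: reduced_form_alternating.
- exact: reduced_form_nondegenerate.
- exact: reduced_form_closed_at.
Qed.

Local Notation CP := {p : PP R n G | momentum A p = mu}.
Local Notation C := (level_atlas).

Definition level_pr (z : CP) : QQ A mu := (om (sval z).1, (sval z).2.1.1, (sval z).2.2).

Let Ca := manifold_atlas level_manifold.

Lemma smooth_level_pr : smooth C QB level_pr.
Proof.
apply: (psm_smooth Ca) => z; have /psm_level[p1 p2 p3] := psm_cinv0 Ca HCf z.
apply/(psm_prod _ _ HQ1f Ef); split; last exact/psm_vec.
by apply/(psm_prod _ _ df Df); split; [exact: psm_orbit_map|exact/psm_vec].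
Qed.

Lemma tmap_level_pr (z : CP) v :
  tmap C QB level_pr z v = (tmap A B om (sval z).1 v.1.1, v.1.2, v.2).
Proof.
pose x := (sval z).1; pose e0 : HC := cmap (C z) z.
have d11 : der (fun e : HC => e.1.1) e0 v v.1.1 := der_fst Ef Df (der_fst HC1f Ef (der_id e0 v)).
have d12 : der (fun e : HC => e.1.2) e0 v v.1.2 := der_snd Ef Df (der_fst HC1f Ef (der_id e0 v)).
have d2 : der (fun e : HC => e.2) e0 v v.2 := der_snd HC1f Ef (der_id e0 v).
have sr := smooth_local_rep x (smooth_orbit_map hG hch).
apply: der_d; exact: (der_pair (der_pair (der_comp d11 (sm_der _ sr)) d12) d2).
Qed.

Lemma level_pr_fibre (z z' : CP) : level_pr z = level_pr z' <->
  exists2 x, coadj_stab A mu x & sval z' = act_P (sval z) x.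
Proof.
split=> [e|[x sx e]]; last first.
  have e1 : (sval z').1 = ((sval z).1 * x)%g := congr1 fst e.
  have ff : f (sval z).1 = f (sval z').1.
    by rewrite e1 (AdstarM hG); move: sx; rewrite /coadj_stab /= -AdslE => ->.
  apply: triple_eq.
  - apply: orbit_eq; exact: etrans (sval_orbit_map _ _ _) (etrans ff (esym (sval_orbit_map _ _ _))).
  - exact: esym (congr1 (fun p : PP R n G => p.2.1.1) e).
  - exact: esym (congr1 (fun p : PP R n G => p.2.2) e).
have ff : f (sval z).1 = f (sval z').1.
  by rewrite -!sval_orbit_map; exact: (congr1 (fun q : QQ A mu => sval q.1.1) e).
have e2 : (sval z).2.1.1 = (sval z').2.1.1 := congr1 (fun q : QQ A mu => q.1.2) e.
have e3 : (sval z).2.2 = (sval z').2.2 := congr1 (fun q : QQ A mu => q.2) e.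
exists ((sval z).1^-1 * (sval z').1)%g.
  by rewrite /coadj_stab /= -AdslE (AdstarM hG) -ff (AdstarK hG).
have pair_eq (p p' : PP R n G) : p.1 = p'.1 -> p.2 = p'.2 -> p = p'.
  by case: p p' => [? ?] [? ?] /= -> ->.
apply: pair_eq; first by rewrite /= mulgA mulgV mul1g.
exact: esym (level_snd (svalP z) (svalP z') ff e2 e3).
Qed.

(** On the level set [dN(U)] is [ad^*_(r(U)) N], so the first two terms of the form contribute [-
    <N, [r(U), r(V)]>] each and the third adds one back: the orbit term, with coefficient -1. *)
Lemma level_pullback : pullback2 C QB level_pr reduced_form =
  pullback2 C PPA (fun z => sval z) (omega_P A).
Proof.
apply/funext => z; apply/funext => u; apply/funext => v; rewrite /pullback2.
have [w -> dw] := tmap_sval z u; have [w' -> dw'] := tmap_sval z v.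
rewrite !tmap_level_pr (omega_PE hG) /= dw dw' (level_shift (svalP z)).
set x := (sval z).1.
have gE t : is_gen B (om x) (rho A x t) (tmap A B om x t).
  by rewrite (tmap_orbit_map hG hch) -sval_orbit_map; exact: gen_velocity.
rewrite /reduced_form /= (pairing_ad_gen (gE _) (gE _)).
rewrite (sval_orbit_map A mu x).
rewrite !(pairing_adstar hG) (adlC hG (rho A x v.1.1)) pairingNr.
move: (pairing _ _) (pairing _ _) (pairing _ _) => a b c; ring.
Qed.

Lemma mw_red : mw_reduction PPA (omega_P A) (@act_P R n G) (coadj_stab A mu) C QB reduced_form.
Proof.
split.
- exact: level_manifold.
- exact: level_embedding.
- exact: reduced_form_symplectic.
exists level_pr; split.
- split; first exact: smooth_level_pr.
  move=> z [[t l] y]; have [v vt] := (submersion_orbit_map hG hch).2 (sval z).1 t.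
  by exists (v, l, y); rewrite tmap_level_pr vt.
- move=> [[b m] y]; have [x ->] := orbit_rep b.
  by exists (of_level (x, m, y)).
- exact: level_pr_fibre.
- exact: level_pullback.
Qed.

End ReducedForm.
End MarsdenWeinstein.

Theorem proposition5p2 (R : realType) (n : nat) (G : groupType)
    (A : atlas G 'rV[R]_n) (hG : lie_group A) :
  (* T^*T^*G is identified with G x g_1^* x g_2^* x g_3, and the cotangent lift
     of right translation becomes (h, mu, nu, xi) |-> (h g, mu, nu, xi) *)
  [/\ diffeomorphism (TsS_atlas A) (PP_atlas A) (triv A) (untriv A),
      forall (x : G) (z z' : TsS R n G),
        is_cot_lift A (fun b => sdmul A b (x, 0)) z z' ->
        triv A z' = act_P (triv A z) x,
      (* Poisson reduction *)
      poisson_reduction (PP_atlas A) (omega_P A) act_P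
        (vec_atlas ('cV[R]_n * 'cV[R]_n * 'rV[R]_n)%type) snd (reduced_bracket A) &
      (* Marsden-Weinstein reduction *)
      forall mu : 'cV[R]_n,
      exists (d : nat) (B : atlas (orbit_space A mu) 'rV[R]_d),
        [/\ orbit_structure B,
            forall (o : orbit_space A mu) t, exists eta, is_gen B o eta t,
            forall (o : orbit_space A mu) eta, exists t, is_gen B o eta t &
            exists w, reduced_form_spec B w /\
            exists C : atlas {p | momentum A p = mu} ('rV[R]_n * 'cV[R]_n * 'rV[R]_n)%type,
              mw_reduction (PP_atlas A) (omega_P A) act_P (coadj_stab A mu) C
                (QQ_atlas B) w]].

Proof.
split.
- exact: triv_diffeomorphism.
- by move=> x z z'; exact: cot_lift_triv.
- exact: poisson_red.
move=> mu; have [ch hch] := orbit_charts_exist hG mu.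
exists (\rank (gmx A mu)), (orbit_atlas ch); split.
- exact: orbit_structureB.
- by move=> o t; eexists; exact: (gen_exists hG hch).
- by move=> o eta; eexists; exact: (gen_velocity hG hch).
exists (reduced_form ch); split; first exact: reduced_form_specP.
by exists (@level_atlas _ _ _ _ hG mu); exact: mw_red.
Qed.
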